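(* Let $(W,G)$ be a Berglund-Hübsch potential and group with associated data $M,N,\Delta,\Delta^\vee,K_N,K_N^\vee$. There is a natural isomorphism between the $B$ ring of the Berglund-Hübsch construction, with components twisted by certain one-dimensional spaces, and the cohomology of $$\mathbb C[(K_N^\vee\oplus K_N)_0]\otimes\Lambda^*(N_{\mathbb C})$$ with respect to $$d^B=\sum_{m\in\Delta}[m]\otimes({\rm contr.}\,m)+\sum_{n\in\Delta^\vee}[n]\otimes(\wedge n)=\sum_{m\in\Delta}[m]\otimes({\rm contr.}\,m)+\sum_{j=1}^d[v_j]\otimes(\wedge v_j).$$
   Context: **Berglund-Hübsch data.** Let $(a_{ij})$ be an invertible $d\times d$ matrix of nonnegative integers and $W=\sum_{i=1}^d\prod_{j=1}^d x_j^{a_{ij}}$. Assume there are positive rationals $q_j$ with $\sum_j a_{ij}q_j=1$ for all $i$, and that $W$ is nondegenerate: the hypersurface $W=0$ in $\mathbb C^d$ is smooth away from the origin. ${\rm Aut}(W)$ is the finite group of diagonal $\gamma=(\gamma_j)\in(\mathbb C^* )^d$ preserving $W$ under $x_j\mapsto\gamma_jx_j$, and $G\subseteq{\rm Aut}(W)$ is a subgroup. Let $M_0=\bigoplus_i\mathbb Z u_i$, $N_0=\bigoplus_j\mathbb Z v_j$ with the pairing $u_i\cdot v_j=a_{ij}$, extended bilinearly. Put $N=\{\sum_jt_jv_j\in N_0\otimes\mathbb Q:(e^{2\pi i t_j})_j\in G\}\supseteq N_0$ (so $N/N_0\cong G$) and $M=\{m\in M_0\otimes\mathbb Q: m\cdot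 n\in\mathbb Z\ \forall n\in N\}\supseteq M_0$; these are dual lattices of rank $d$. Write $N_{\mathbb C}=N\otimes\mathbb C$ and $M_{\mathbb Q}=M\otimes\mathbb Q$. Put $\Delta=\{u_1,\dots,u_d\}\subset M$, $\Delta^\vee=\{v_1,\dots,v_d\}\subset N$, $K_N=\sum_j\mathbb Q_{\ge0}v_j$, $K_N^\vee=\{m\in M_{\mathbb Q}:m\cdot n\ge0\ \forall n\in K_N\}$. **The complex.** $\mathbb C[(K_N^\vee\oplus K_N)_0]$ is the vector space with basis $[m\oplus n]$ indexed by pairs of lattice points $m\in K_N^\vee\cap M$, $n\in K_N\cap N$ with $m\cdot n=0$. It is a module over the semigroup ring $\mathbb C[K_N^\vee\oplus K_N]$ of lattice points, being its quotient by the ideal spanned by the monomials $[m\oplus n]$ with $m\cdot n>0$. In $d^B$, $[m]$ and $[n]$ denote multiplication by $[m\oplus 0]$ and $[0\oplus n]$; $\wedge n$ is exterior multiplication by $n$ and ${\rm contr.}\,m$ is contraction by $m$ on the exterior algebra $\Lambda^*(N_{\mathbb C})$. **The $B$ ring.** For $g\in G$, let $\mathcal L_g$ be the Milnor ring, in the variables $x_j$ fixed by $g$, of the restriction $W_g$ of $W$ to those variables (i.e. to $x_j=0$ for all $x_j$ not fixed by $g$), namely the quotient of the polynomial ring in the fixed variables by the partial derivatives of $W_g$, shifted by (multiplied by) the product of the variables fixed by $g$. The group $G$ acts diagonally, including on this product, and $\mathcal L_g^G$ is the $G$-invariant part. As a vector space (the ring structure is ignored here), the $B$ ring is $\big(\bigoplus_{g\in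 G}\mathcal L_g\big)^G=\bigoplus_{g\in G}\mathcal L_g^G$, and its components are the $\mathcal L_g^G$. *)

(* Defs.v *)
From HB Require Import structures.
From mathcomp Require Import all_boot all_order all_algebra.
From mathcomp Require Import generic_quotient ring_quotient.
From mathcomp Require Import finmap complex.
From mathcomp Require Import freeg mpoly.
From mathcomp Require Import boolp reals.
From mathcomp Require trigo.

Set Implicit Arguments.
Unset Strict Implicit.
Unset Printing Implicit Defensive.

Import Order.TTheory GRing.Theory Num.Theory.
Local Open Scope ring_scope.
Local Open Scope quotient_scope.

Section LinearAlgebra.
Variable K : fieldType.

Record submodule (V : lmodType K) := Submodule {
  submod_mem : {pred V};
  submod_memP : submod_closed submod_mem
}.
HB.instance Definition _ (V : lmodType K) (S : submodule V) :=
  GRing.isSubmodClosed.Build K V (submod_mem S)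
    (GRing.submod_closed_semi (submod_memP S)).

Section QuotientModule.
Variables (V : lmodType K) (S : submodule V).

Definition quotient := @Quotient.quot V (submod_mem S).
HB.instance Definition _ := GRing.Zmodule.on quotient.

Definition class_of (v : V) : quotient :=
  \pi_(@Quotient.quot V (submod_mem S)) v.
Definition class_repr (x : quotient) : V :=
  repr (x : @Quotient.quot V (submod_mem S)).

Lemma class_reprK : cancel class_repr class_of.
Proof. exact: reprK. Qed.

Lemma class_eq u v : (class_of u = class_of v) <-> (u - v \in submod_mem S).
Proof. by split=> [/eqP|] uv; [|apply/eqP]; move: uv; rewrite Quotient.idealrBE. Qed.

Fact class_is_zmod_morphism : zmod_morphism class_of.
Proof. exact: pi_is_zmod_morphism. Qed.
HB.instance Definition _ :=
  GRing.isZmodMorphism.Build V quotient class_of class_is_zmod_morphism.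

Definition quot_scale (a : K) (x : quotient) : quotient :=
  class_of (a *: class_repr x).

Fact class_scale a v : quot_scale a (class_of v) = class_of (a *: v).
Proof. by apply/class_eq; rewrite -scalerBr rpredZ //; apply/class_eq/class_reprK. Qed.

Fact quot_scaleA a b x : quot_scale a (quot_scale b x) = quot_scale (a * b) x.
Proof. by rewrite -[x]class_reprK !class_scale scalerA. Qed.
Fact quot_scale1 : left_id 1 quot_scale.
Proof. by move=> x; rewrite -[x]class_reprK class_scale scale1r. Qed.
Fact quot_scaleDr : right_distributive quot_scale +%R.
Proof.
move=> a x y; rewrite -[x]class_reprK -[y]class_reprK -raddfD !class_scale.
by rewrite scalerDr raddfD.
Qed.
Fact quot_scaleDl x : {morph quot_scale^~ x : a b / a + b}.
Proof. by move=> a b; rewrite -[x]class_reprK !class_scale scalerDl raddfD. Qed.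

HB.instance Definition _ := GRing.Zmodule_isLmodule.Build K quotient
  quot_scaleA quot_scale1 quot_scaleDr quot_scaleDl.

Fact class_is_scalable : scalable class_of.
Proof. by move=> a v; rewrite -class_scale. Qed.
HB.instance Definition _ :=
  GRing.isScalable.Build K V quotient *:%R class_of class_is_scalable.
End QuotientModule.

Section Subspace.
Variables (V : lmodType K) (S : submodule V).
Record subspace : Type := Subspace { subval : V; _ : subval \in submod_mem S }.
HB.instance Definition _ := [isSub for subval].
HB.instance Definition _ := [Choice of subspace by <:].
HB.instance Definition _ := [SubChoice_isSubZmodule of subspace by <:].
HB.instance Definition _ := [SubZmodule_isSubLmodule of subspace by <:].
End Subspace.

Section Span.
Variables (V : lmodType K) (X : V -> Prop).
Definition span_pred : {pred V} := fun v =>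
  `[< exists2 s : seq (K * V), (forall p, p \in s -> X p.2)
                             & v = \sum_(p <- s) p.1 *: p.2 >].

Fact span_closed : submod_closed span_pred.
Proof.
split=> [|a u v /asboolP[s Xs ->] /asboolP[t Xt ->]].
  by apply/asboolP; exists [::]; rewrite ?big_nil.
apply/asboolP; exists ([seq (a * p.1, p.2) | p <- s] ++ t).
  by move=> p; rewrite mem_cat => /orP[/mapP[q qs ->]|/Xt//]; apply: Xs q qs.
rewrite big_cat big_map scaler_sumr /=; congr (_ + _).
by apply: eq_bigr => p _; rewrite scalerA.
Qed.
Definition spanned := Submodule span_closed.
End Span.

Section Cohomology.
Variables (V : lmodType K) (f : {linear V -> V}).

Definition im_pred : {pred V} := fun w => `[< exists v, w = f v >].
Fact im_closed : submod_closed im_pred.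
Proof.
split=> [|a u v /asboolP[x ->] /asboolP[y ->]]; apply/asboolP.
  by exists 0; rewrite linear0.
by exists (a *: x + y); rewrite linearP.
Qed.
Definition coboundaries := Submodule im_closed.

Definition cocycle_class_pred : {pred quotient coboundaries} := fun c =>
  `[< exists2 z, f z = 0 & c = class_of coboundaries z >].
Fact cocycle_class_closed : submod_closed cocycle_class_pred.
Proof.
split=> [|a u v /asboolP[x fx ->] /asboolP[y fy ->]]; apply/asboolP.
  by exists 0; rewrite linear0.
by exists (a *: x + y); rewrite linearP ?fx ?fy ?scaler0 ?addr0 // linearP.
Qed.

(* Ker f / Im f, as the subspace of V / Im f formed by the classes of the *)
(* elements of Ker f.                                                     *)
Definition cohomology := subspace (Submodule cocycle_class_closed).
HB.instance Definition _ := GRing.Lmodule.on cohomology.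
End Cohomology.

Section FreeLift.
Variables (T : choiceType) (W : lmodType K) (h : T -> W).
Definition free_lift (x : {freeg T / K}) : W := fglift h x.

Lemma free_liftU a t : free_lift << a *g t >> = a *: h t.
Proof. exact: liftU. Qed.

Fact free_lift_is_linear : linear free_lift.
Proof.
have liftB u v : free_lift (u - v) = free_lift u - free_lift v.
  exact: lift_is_additive.
have lift0 : free_lift 0 = 0 by rewrite -(subrr 0) liftB subrr.
have liftD u v : free_lift (u + v) = free_lift u + free_lift v.
  by rewrite -{1}[v]opprK -[- v]sub0r !liftB lift0 sub0r opprK.
have lift_sum (s : seq T) (F : T -> {freeg T / K}) :
    free_lift (\sum_(t <- s) F t) = \sum_(t <- s) free_lift (F t).
  by elim/big_rec2: _ => // t u v _ <-.
move=> a u v; rewrite liftD; congr (_ + _).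
have -> : a *: u = \sum_(t <- dom u) << a * coeff t u *g t >> by [].
rewrite -[in RHS](freeg_sumE u) !lift_sum scaler_sumr.
by apply: eq_bigr => t _; rewrite !free_liftU scalerA.
Qed.
HB.instance Definition _ :=
  GRing.isLinear.Build K {freeg T / K} W _ free_lift free_lift_is_linear.
End FreeLift.

Section Tensor.
Variables V W : lmodType K.
Local Notation pairs := {freeg (V * W) / K}.

Definition tensor_rel (r : pairs) : Prop :=
  (exists a v v' w,
     r = << (a *: v + v', w) >> - a *: << (v, w) >> - << (v', w) >>) \/
  (exists a v w w',
     r = << (v, a *: w + w') >> - a *: << (v, w) >> - << (v, w') >>).

Definition tensor := quotient (spanned tensor_rel).
HB.instance Definition _ := GRing.Lmodule.on tensor.

Definition tens (v : V) (w : W) : tensor :=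
  class_of (spanned tensor_rel) << (v, w) >>.

Lemma tensPl a v v' w : tens (a *: v + v') w = a *: tens v w + tens v' w.
Proof.
rewrite /tens -linearP; apply/class_eq/asboolP.
exists [:: (1, << (a *: v + v', w) >> - (a *: << (v, w) >> + << (v', w) >>))].
  by move=> p; rewrite inE => /eqP-> /=; left; exists a, v, v', w;
     rewrite opprD addrA.
by rewrite big_seq1 scale1r.
Qed.

Lemma tensPr a v w w' : tens v (a *: w + w') = a *: tens v w + tens v w'.
Proof.
rewrite /tens -linearP; apply/class_eq/asboolP.
exists [:: (1, << (v, a *: w + w') >> - (a *: << (v, w) >> + << (v, w') >>))].
  by move=> p; rewrite inE => /eqP-> /=; right; exists a, v, w, w';
     rewrite opprD addrA.
by rewrite big_seq1 scale1r.
Qed.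
End Tensor.

Section TensorMap.
Variables (V W V' W' : lmodType K).
Variables (f : {linear V -> V'}) (g : {linear W -> W'}).
Local Notation rel := (spanned (@tensor_rel V W)).

Definition tens_map (x : tensor V W) : tensor V' W' :=
  free_lift (fun p : V * W => tens (f p.1) (g p.2)) (class_repr x).

Fact tens_map_pi y :
  tens_map (class_of rel y) = free_lift (fun p => tens (f p.1) (g p.2)) y.
Proof.
rewrite /tens_map; set h := free_lift _; apply/eqP; rewrite -subr_eq0.
rewrite /h -linearB.
have : class_repr (class_of rel y) - y \in submod_mem rel.
  by apply/class_eq/class_reprK.
move=> /asboolP[s srel ->]; rewrite linear_sum big_seq big1 // => p /srel.
rewrite linearZ /=; suff h0 r : tensor_rel r -> h r = 0.
  by move=> /h0; rewrite /h => ->; rewrite scaler0.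
have hE u w : h << (u, w) >> = tens (f u) (g w) by rewrite /h free_liftU scale1r.
have hB u w : h (u - w) = h u - h w by rewrite /h linearB.
have hZ a u : h (a *: u) = a *: h u by rewrite /h linearZ.
case=> -[a [u [u' [w ->]]]]; rewrite !hB hZ !hE linearP ?tensPl ?tensPr.
  by rewrite addrAC addrK subrr.
by rewrite addrAC addrK subrr.
Qed.

Lemma tens_mapE v w : tens_map (tens v w) = tens (f v) (g w).
Proof. by rewrite tens_map_pi free_liftU scale1r. Qed.

Fact tens_map_is_linear : linear tens_map.
Proof.
move=> a x y; rewrite -[x]class_reprK -[y]class_reprK.
by rewrite -linearP !tens_map_pi linearP.
Qed.
HB.instance Definition _ :=
  GRing.isLinear.Build K (tensor V W) (tensor V' W') _ tens_map
    tens_map_is_linear.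
End TensorMap.

Section LinearSum.
Variables (V W : lmodType K) (I : finType) (F : I -> {linear V -> W}).
Definition lin_sum (x : V) : W := \sum_(i : I) F i x.
Fact lin_sum_is_linear : linear lin_sum.
Proof.
move=> a x y; rewrite /lin_sum scaler_sumr -big_split.
by apply: eq_bigr => i _; rewrite linearP.
Qed.
HB.instance Definition _ :=
  GRing.isLinear.Build K V W _ lin_sum lin_sum_is_linear.
End LinearSum.

Section DirectSum.
Variables (I : finType) (V : I -> lmodType K).

Definition dsum := {dffun forall i, V i}.
HB.instance Definition _ := Choice.on dsum.
Implicit Types x y z : dsum.

Let dadd x y : dsum := [ffun i => x i + y i].
Let dzero : dsum := [ffun i => 0 : V i].
Let dopp x : dsum := [ffun i => - x i].
Let dscale (a : K) x : dsum := [ffun i => a *: x i].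

Fact dsum_addA : associative dadd.
Proof. by move=> x y z; apply/ffunP => i; rewrite !ffunE addrA. Qed.
Fact dsum_addC : commutative dadd.
Proof. by move=> x y; apply/ffunP => i; rewrite !ffunE addrC. Qed.
Fact dsum_add0 : left_id dzero dadd.
Proof. by move=> x; apply/ffunP => i; rewrite !ffunE add0r. Qed.
Fact dsum_addN : left_inverse dzero dopp dadd.
Proof. by move=> x; apply/ffunP => i; rewrite !ffunE addNr. Qed.
HB.instance Definition _ :=
  GRing.isZmodule.Build dsum dsum_addA dsum_addC dsum_add0 dsum_addN.

Fact dsum_scaleA a b x : dscale a (dscale b x) = dscale (a * b) x.
Proof. by apply/ffunP => i; rewrite !ffunE scalerA. Qed.
Fact dsum_scale1 : left_id 1 dscale.
Proof. by move=> x; apply/ffunP => i; rewrite !ffunE scale1r. Qed.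
Fact dsum_scaleDr : right_distributive dscale +%R.
Proof. by move=> a x y; apply/ffunP => i; rewrite !ffunE scalerDr. Qed.
Fact dsum_scaleDl x : {morph dscale^~ x : a b / a + b}.
Proof. by move=> a b; apply/ffunP => i; rewrite !ffunE scalerDl. Qed.
HB.instance Definition _ := GRing.Zmodule_isLmodule.Build K dsum
  dsum_scaleA dsum_scale1 dsum_scaleDr dsum_scaleDl.

Definition dsum_in (i : I) (v : V i) : dsum :=
  [ffun j => if @eqP _ i j is ReflectT e then ecast k (V k) e v else 0].
End DirectSum.

Definition one_dimensional (V : lmodType K) :=
  exists2 v : V, v != 0 & forall w : V, exists a : K, w = a *: v.

End LinearAlgebra.

Section ExteriorAlgebra.
Variables (K : fieldType) (d : nat).

(* The exterior algebra of the space with basis v_0, ..., v_(d-1); the        *)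
(* coefficient at I = {i_1 < ... < i_k} is that of v_(i_1) /\ ... /\ v_(i_k). *)
Definition ext := {ffun {set 'I_d} -> K^o}.
HB.instance Definition _ := GRing.Lmodule.on ext.

Definition ext_sign (j : 'I_d) (I : {set 'I_d}) : K :=
  (-1) ^+ #|[set i in I | (i < j)%N]|.

(* c /\ -, for the vector \sum_j c_j v_j *)
Definition wedge (c : 'I_d -> K) (w : ext) : ext :=
  [ffun I : {set 'I_d} => \sum_(j in I) c j * ext_sign j I * w (I :\ j)].

(* contraction by the linear form whose value at v_j is c_j *)
Definition contract (c : 'I_d -> K) (w : ext) : ext :=
  [ffun I : {set 'I_d} => \sum_(j | j \notin I) c j * ext_sign j I * w (j |: I)].

Fact wedge_is_linear c : linear (wedge c).
Proof.
move=> a u v; apply/ffunP => I; rewrite !ffunE scaler_sumr -big_split /=.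
by apply: eq_bigr => j _; rewrite !ffunE mulrDr; congr (_ + _); exact: mulrCA.
Qed.
HB.instance Definition _ c :=
  GRing.isLinear.Build K ext ext _ (wedge c) (wedge_is_linear c).

Fact contract_is_linear c : linear (contract c).
Proof.
move=> a u v; apply/ffunP => I; rewrite !ffunE scaler_sumr -big_split /=.
by apply: eq_bigr => j _; rewrite !ffunE mulrDr; congr (_ + _); exact: mulrCA.
Qed.
HB.instance Definition _ c :=
  GRing.isLinear.Build K ext ext _ (contract c) (contract_is_linear c).

(* Lambda^k of the span of the v_j with j in S *)
Definition ext_power_pred (S : {set 'I_d}) (k : nat) : {pred ext} := fun w =>
  [forall I : {set 'I_d}, (w I != 0) ==> (I \subset S) && (#|I| == k)].
Fact ext_power_closed S k : submod_closed (ext_power_pred S k).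
Proof.
have in_pow (w : ext) : reflect
    (forall I : {set 'I_d}, ~~ ((I \subset S) && (#|I| == k)) -> w I = 0)
    (w \in ext_power_pred S k).
  apply: (iffP forallP) => wP I.
    by move=> nI; apply: contraNeq nI => /(implyP (wP I)).
  by apply/implyP; apply: contraNT => /wP->.
split=> [|a u v /in_pow uP /in_pow vP]; apply/in_pow => I nI; rewrite !ffunE //.
by rewrite uP // vP // scaler0 addr0.
Qed.
Definition ext_power S k := Submodule (@ext_power_closed S k).
End ExteriorAlgebra.

Section BerglundHubsch.
Variables (C : fieldType) (d : nat).
Implicit Types (A : 'M[nat]_d) (g : {ffun 'I_d -> C}).
Implicit Types (G : {fset {ffun 'I_d -> C}}) (m n : 'rV[rat]_d).

Definition potential A : {mpoly C[d]} :=
  \sum_(i < d) \prod_(j < d) 'X_j ^+ A i j.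

Definition smooth_away_from_origin (W : {mpoly C[d]}) :=
  forall x : 'I_d -> C, (exists j, x j != 0) -> W.@[x] = 0 ->
  exists j, (W^`M(j)).@[x] != 0.

(* x_j |-> g_j x_j *)
Definition diag_act g (p : {mpoly C[d]}) : {mpoly C[d]} :=
  p \mPo [tuple g j *: 'X_j | j < d].

Definition Aut_potential A g :=
  (forall j, g j != 0) /\ diag_act g (potential A) = potential A.

Definition diag_subgroup G :=
  [/\ [ffun=> 1] \in G,
      forall g h, g \in G -> h \in G -> [ffun j => g j * h j] \in G &
      forall g, g \in G -> [ffun j => (g j)^-1] \in G].

(* m and n are given by their coordinates with respect to (u_i) and (v_j). *)
Definition pairing A m n : rat :=
  \sum_(i < d) \sum_(j < d) m 0 i * (A i j)%:R * n 0 j.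

(* u_i or v_i, according to the side of the pairing *)
Definition basis_vec (i : 'I_d) : 'rV[rat]_d := delta_mx 0 i.

Definition dual_lattice A (N : 'rV[rat]_d -> Prop) m :=
  forall n, N n -> pairing A m n \is a Num.int.
Definition cone_K n := forall j, 0 <= n 0 j.
Definition dual_cone_K A m := forall n, cone_K n -> 0 <= pairing A m n.

Section Complex.
Variables (A : 'M[nat]_d) (N : 'rV[rat]_d -> Prop).

Definition cone_pair_pred (p : 'rV[rat]_d * 'rV[rat]_d) :=
  `[< [/\ dual_lattice A N p.1, dual_cone_K A p.1, N p.2, cone_K p.2
        & pairing A p.1 p.2 = 0] >].
Definition cone_pair := {p | cone_pair_pred p}.
HB.instance Definition _ := Choice.on cone_pair.

(* C[(K_N^v (+) K_N)_0] *)
Definition cone_algebra := {freeg cone_pair / C}.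
HB.instance Definition _ := GRing.Lmodule.on cone_algebra.

(* The image of [m (+) n] in the quotient: for m and n in the cones and      *)
(* lattices, insub fails exactly when m . n > 0.                             *)
Definition monomial m n : cone_algebra :=
  if insub (m, n) is Some p then << p >> else 0.

Definition monomial_mul m n : {linear cone_algebra -> cone_algebra} :=
  free_lift (fun p : cone_pair => monomial (m + (val p).1) (n + (val p).2)).

Definition complex_B := tensor cone_algebra (ext C d).
HB.instance Definition _ := GRing.Lmodule.on complex_B.

Definition diff_B : {linear complex_B -> complex_B} :=
  lin_sum (fun i => tens_map (monomial_mul (basis_vec i) 0)
     (contract (fun j => ratr (pairing A (basis_vec i) (basis_vec j)))))
  \+ lin_sum (fun j => tens_map (monomial_mul 0 (basis_vec j))
     (wedge (fun k => ratr (basis_vec j 0 k)))).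
End Complex.

Definition fixed_vars g : {set 'I_d} := [set j | g j == 1].

Definition poly_in (F : {set 'I_d}) (p : {mpoly C[d]}) :=
  forall e, e \in msupp p -> forall j, j \notin F -> e j = 0%N.

Definition vars_prod (F : {set 'I_d}) : {mpoly C[d]} := \prod_(j in F) 'X_j.

Definition restricted_potential A g : {mpoly C[d]} :=
  potential A \mPo [tuple if j \in fixed_vars g then 'X_j else 0 | j < d].

Section Milnor.
Variables (A : 'M[nat]_d) (G : {fset {ffun 'I_d -> C}}) (g : {ffun 'I_d -> C}).
Local Notation F := (fixed_vars g).

Definition shifted_jacobian : submodule {mpoly C[d]} :=
  spanned (fun p => exists h j, [/\ poly_in F h, j \in F
    & p = vars_prod F * (h * (restricted_potential A g)^`M(j))]).

(* L_g^G as a subspace of C[x_1..x_d] / (pi J), where pi is the product of   *)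
(* the fixed variables and J the ideal generated by the partial derivatives  *)
(* of W_g in the ring P of polynomials in the fixed variables, so that       *)
(* L_g = (pi P) / (pi J). The group acts on classes through representatives. *)
Definition milnor_inv_pred : {pred quotient shifted_jacobian} :=
  fun c => `[< exists p, [/\ poly_in F p,
    c = class_of shifted_jacobian (vars_prod F * p) &
    forall h, h \in G ->
      class_of shifted_jacobian (diag_act h (vars_prod F * p)) = c] >].

Fact milnor_inv_closed : submod_closed milnor_inv_pred.
Proof.
split=> [|a u v /asboolP[p [pF up Gp]] /asboolP[q [qF vq Gq]]]; apply/asboolP.
  exists 0; split=> [e||h _]; rewrite ?msupp0 ?mulr0 ?linear0 //.
  by rewrite /diag_act comp_mpoly0 linear0.
have pi_lin : vars_prod F * (a *: p + q) = a *: (vars_prod F * p) + vars_prod F * q.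
  by rewrite mulrDr; congr (_ + _); rewrite scalerAr.
exists (a *: p + q); split=> [e eapq j jF||h hG].
- have : e \in msupp p ++ msupp q.
    by move/msuppD_le: eapq; rewrite !mem_cat => /orP[/msuppZ_le|] ->; rewrite ?orbT.
  by rewrite mem_cat => /orP[/pF|/qF]; apply.
- by rewrite pi_lin linearP up vq.
by rewrite pi_lin /diag_act comp_mpolyD comp_mpolyZ linearP /= Gp // Gq.
Qed.
Definition milnor_inv := subspace (Submodule milnor_inv_closed).
HB.instance Definition _ := GRing.Lmodule.on milnor_inv.
End Milnor.

(* the top exterior power of the span of the v_j with x_j not fixed by g *)
Definition twist g :=
  subspace (ext_power C (~: fixed_vars g) #|~: fixed_vars g|).
HB.instance Definition _ g := GRing.Lmodule.on (twist g).

Definition twisted_component A G (s : G) :=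
  tensor (milnor_inv A G (val s)) (twist (val s)).
HB.instance Definition _ A G s := GRing.Lmodule.on (@twisted_component A G s).

Definition twisted_B_ring A G := dsum (@twisted_component A G).
HB.instance Definition _ A G := GRing.Lmodule.on (twisted_B_ring A G).

Definition component_in A G (s : G) (x : twisted_component A s) :
  twisted_B_ring A G := @dsum_in C G (@twisted_component A G) s x.
End BerglundHubsch.

Section RootsOfUnity.
Variables (R : realType) (d : nat).
Implicit Types (g : {ffun 'I_d -> R[i]}) (G : {fset {ffun 'I_d -> R[i]}}).

(* e^(2 pi i t) *)
Definition expi (t : rat) : R[i] :=
  let a : R := 2 * trigo.pi * ratr t in Complex (trigo.cos a) (trigo.sin a).

Definition lattice_N G (n : 'rV[rat]_d) : Prop := [ffun j => expi (n 0 j)] \in G.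

(* the lift of g to N with all coordinates in [0, 1) *)
Definition box_point g (n : 'rV[rat]_d) :=
  forall j, 0 <= n 0 j < 1 /\ expi (n 0 j) = g j.
End RootsOfUnity.

(* Main.v *)
Require Import Defs.
From HB Require Import structures.
From mathcomp Require Import all_boot all_order all_algebra.
From mathcomp Require Import finmap complex.
From mathcomp Require Import freeg mpoly.
From mathcomp Require Import boolp reals.
From mathcomp Require Import ring lra zify.

Set Implicit Arguments.
Unset Strict Implicit.
Unset Printing Implicit Defensive.

Import Order.TTheory GRing.Theory Num.Theory.
Local Open Scope ring_scope.

(** Put [X_j = ∑_i a_ij [u_i]] and [Y_j = [v_j]], acting on the ring of the two
    cones. The differential is [∑_j X_j ⊗ ι_j + Y_j ⊗ (v_j ∧)], with [ι_j] the
    contraction along [v_j]; its square is [∑_j X_j Y_j], and this is zero because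
    [u_i . v_j = a_ij > 0] whenever [u_i] occurs in [X_j] ([row_raise0]).

    The cohomology is first computed for the wedge half alone. Dividing by the
    [v_j] gives a homotopy [h] whose anticommutator with the differential is a
    diagonal operator plus an operator that lowers the weight [∑_j n_j]. The
    diagonal entry at [[m ⊕ n] ⊗ v_I] is the number of indices [j] such that
    either [j] is in [I] and [n_j >= 1], or [j] is not in [I] and [m . v_j = 0].
    Since the anticommutator is zero on cohomology, the families supported where
    this number is zero, called reduced, carry the cohomology
    ([cocycle_reduction], [coboundary_reduction]). There [n] has all its
    coordinates in [[0, 1)], so it is the lift of a single [g] in [G]; the set [I]
    contains every index not fixed by [g]; and [m] is a [G]-invariant monomial in
    the variables fixed by [g], divisible by those outside [I]. Dividing by the
    variables outside [I] turns the differential, which on [m] multiplies by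
    [x_j ∂_j W_g], into the Koszul differential of the partial derivatives of
    [W_g] ([theta_diff], [to_poly_contract]).

    This Koszul complex is exact outside its lowest degree, as the Jacobian ideal
    contains the regular sequence of some powers of the variables
    ([koszul_depth], [koszul_potential_exact]). That it contains such powers is
    elementary, thanks to the invertibility of the exponent matrix: every
    monomial of [W_g] is a combination of the [x_j ∂_j W_g]; and for a nonempty set
    [Y] of fixed variables on which no monomial of [W] lives, some partial
    derivative is a single monomial in [Y] modulo the other fixed variables. If not,
    one could choose a torus point where the monomials take values that cancel,
    and project it to a singular point of [W = 0] other than the origin
    ([unique_pointed_row]). Products of variables then lie in the radical of the
    ideal, by descending induction on the set of variables
    ([vars_prod_in_radical]).

    In the lowest degree [I] is the set of indices not fixed by [g], whence the
    twist by the top exterior power; the coefficients are the invariant multiples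
    of the product of the fixed variables, modulo this product times the Jacobian
    ideal. Averaging over [G] shows that they represent all the invariant classes
    of the shifted Milnor ring ([class_to_of]), and the isomorphism sends the
    class of [x^e] to that of the monomial of [m] and [n], where [m . v_j = e_j]
    for all [j] and [n] is the lift of [g]. *)

(** * Linear maps out of free modules, quotients and tensor products *)

Section FreeModules.
Variables (K : fieldType) (T : choiceType).

Lemma freegE (v : {freeg T / K}) : v = \sum_(t <- dom v) coeff t v *: << t >>.
Proof.
rewrite -{1}[v]freeg_sumE; apply: eq_bigr => t _.
apply/eqP/freeg_eqP => s; rewrite coeffU.
have -> : coeff s (coeff t v *: << t >>) = coeff t v * coeff s << t >>.
  exact: coeff_fgscale.
by rewrite coeffU mul1r.
Qed.

Lemma coeffZ s (a : K) (v : {freeg T / K}) : coeff s (a *: v) = a * coeff s v.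
Proof. exact: coeff_fgscale. Qed.

Definition supported_in (P : T -> Prop) (v : {freeg T / K}) :=
  forall t, coeff t v != 0 -> P t.

Lemma supported_in_ind (P : T -> Prop) (U : lmodType K) (S : U -> Prop)
    (L : {linear {freeg T / K} -> U}) v :
  S 0 -> (forall a x y, S x -> S y -> S (a *: x + y)) ->
  (forall t, P t -> S (L << t >>)) -> supported_in P v -> S (L v).
Proof.
move=> S0 SD SP Pv; rewrite [v]freegE linear_sum /= big_seq.
elim/big_rec: _ => // t x; rewrite mem_dom => /Pv/SP ? ?.
by rewrite linearZ /=; apply: SD.
Qed.

Lemma freeg_linear_ext (U : lmodType K) (L M : {linear {freeg T / K} -> U}) v :
  (forall t, coeff t v != 0 -> L << t >> = M << t >>) -> L v = M v.
Proof.
move=> LM; rewrite [v]freegE !linear_sum /= big_seq [RHS]big_seq.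
by apply: eq_bigr => t; rewrite mem_dom => /LM e; rewrite !linearZ /= e.
Qed.

Lemma coeff_diagonal (L : {linear {freeg T / K} -> {freeg T / K}}) (c : T -> K) s v :
  (forall t, L << t >> = c t *: << t >>) -> coeff s (L v) = c s * coeff s v.
Proof.
move=> Lc; have vE := freegE v; rewrite [in LHS]vE [in RHS]vE linear_sum.
rewrite !(raddf_sum (coeff s)) mulr_sumr; apply: eq_bigr => t _.
rewrite linearZ /= Lc !coeffZ coeffU mul1r mulrCA.
by case: (t =P s) => [->|_]; rewrite ?mulr0.
Qed.

Lemma supported_in0 (P : T -> Prop) : supported_in P 0.
Proof. by move=> t; rewrite coeff0 eqxx. Qed.

Lemma supported_inP (P : T -> Prop) a x y :
  supported_in P x -> supported_in P y -> supported_in P (a *: x + y).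
Proof.
move=> Px Py t; rewrite coeffD coeffZ; have [/Py//|] := boolP (coeff t y != 0).
rewrite negbK => /eqP->; rewrite addr0 mulf_eq0 negb_or => /andP[_]; exact: Px.
Qed.

Lemma supported_inD (P : T -> Prop) x y :
  supported_in P x -> supported_in P y -> supported_in P (x + y).
Proof. by move=> Px Py; rewrite -[x]scale1r; apply: supported_inP. Qed.

Lemma supported_inZ (P : T -> Prop) a x :
  supported_in P x -> supported_in P (a *: x).
Proof.
by move=> Px; rewrite -[_ *: _]addr0; apply: supported_inP (@supported_in0 P).
Qed.

Lemma supported_in_sum (P : T -> Prop) (I : Type) (r : seq I) (Q : pred I)
    (F : I -> {freeg T / K}) :
  (forall i, Q i -> supported_in P (F i)) ->
  supported_in P (\sum_(i <- r | Q i) F i).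
Proof.
move=> PF; elim/big_rec: _ => [|i x /PF]; first exact: supported_in0.
exact: supported_inD.
Qed.

Lemma supported_inU (P : T -> Prop) t : P t -> supported_in P << t >>.
Proof.
by move=> Pt s; rewrite coeffU mul1r; case: (t =P s) => [<-//|_]; rewrite eqxx.
Qed.

Lemma sub_supported_in (P Q : T -> Prop) v :
  (forall t, P t -> Q t) -> supported_in P v -> supported_in Q v.
Proof. by move=> PQ Pv t /Pv/PQ. Qed.

End FreeModules.

Section QuotientLift.
Variables (K : fieldType) (V U : lmodType K) (S : submodule V).
Variable L : {linear V -> U}.

Definition quotient_lift (x : quotient S) : U := L (class_repr x).

Hypothesis L0 : forall v, v \in submod_mem S -> L v = 0.

Lemma quotient_liftE v : quotient_lift (class_of S v) = L v.
Proof.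
apply/eqP; rewrite -subr_eq0 -linearB; apply/eqP/L0/class_eq.
exact: class_reprK.
Qed.

Lemma quotient_lift_linear : linear quotient_lift.
Proof.
move=> a x y; rewrite -[x]class_reprK -[y]class_reprK -linearP.
by rewrite !quotient_liftE linearP.
Qed.
End QuotientLift.

Section TensorLift.
Variables (K : fieldType) (V W U : lmodType K) (b : V -> W -> U).
Hypothesis bl : forall a v v' w, b (a *: v + v') w = a *: b v w + b v' w.
Hypothesis br : forall a v w w', b v (a *: w + w') = a *: b v w + b v w'.
Local Notation rel := (spanned (@tensor_rel K V W)).

Definition bilinear_on_pairs := free_lift (fun p : V * W => b p.1 p.2).
HB.instance Definition _ := GRing.Linear.on bilinear_on_pairs.

Lemma bilinear_on_pairsU v w : bilinear_on_pairs << (v, w) >> = b v w.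
Proof. by rewrite [LHS]free_liftU scale1r. Qed.

Lemma bilinear_on_rel r : r \in submod_mem rel -> bilinear_on_pairs r = 0.
Proof.
move=> /asboolP[s srel ->]; rewrite linear_sum big_seq big1 // => p /srel.
rewrite linearZ /= => rp; suff -> : bilinear_on_pairs p.2 = 0 by rewrite scaler0.
have hB u w : bilinear_on_pairs (u - w) = bilinear_on_pairs u - bilinear_on_pairs w.
  exact: linearB.
have hZ a u : bilinear_on_pairs (a *: u) = a *: bilinear_on_pairs u.
  exact: linearZ.
case: rp => -[a [u [u' [w ->]]]]; rewrite !hB hZ !bilinear_on_pairsU ?bl ?br.
  by rewrite addrAC addrK subrr.
by rewrite addrAC addrK subrr.
Qed.

Definition tensor_lift : tensor V W -> U := quotient_lift bilinear_on_pairs.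

Lemma tensor_lift_linear : linear tensor_lift.
Proof. exact/quotient_lift_linear/bilinear_on_rel. Qed.

Lemma tensor_liftE v w : tensor_lift (tens v w) = b v w.
Proof.
rewrite /tensor_lift /tens (quotient_liftE bilinear_on_rel). exact: bilinear_on_pairsU.
Qed.

End TensorLift.

Section TensorGen.
Variables (K : fieldType) (V W : lmodType K).

Lemma tensor_ind (P : tensor V W -> Prop) :
  P 0 -> (forall a v w x, P x -> P (a *: tens v w + x)) -> forall x, P x.
Proof.
move=> P0 PD x; rewrite -[x]class_reprK [class_repr x]freegE.
rewrite linear_sum /=; elim/big_rec: _ => // -[v w] y _ Py.
by rewrite linearZ /=; apply: PD.
Qed.

Lemma tensor_linear_ext (U : lmodType K) (L M : {linear tensor V W -> U}) :
  (forall v w, L (tens v w) = M (tens v w)) -> L =1 M.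
Proof.
move=> LM; apply: tensor_ind => [|a v w x e]; first by rewrite !linear0.
by rewrite !linearP /= LM e.
Qed.

Lemma tens0l (w : W) : tens (0 : V) w = 0.
Proof.
have := tensPl 1 (0 : V) 0 w; rewrite !scale1r addr0 => /eqP.
by rewrite -subr_eq0 opprD addrA subrr sub0r oppr_eq0 => /eqP.
Qed.

Lemma tens0r (v : V) : tens v (0 : W) = 0.
Proof.
have := tensPr 1 v (0 : W) 0; rewrite !scale1r addr0 => /eqP.
by rewrite -subr_eq0 opprD addrA subrr sub0r oppr_eq0 => /eqP.
Qed.

Lemma tensZl a v (w : W) : tens (a *: v : V) w = a *: tens v w.
Proof. by rewrite -[a *: v]addr0 tensPl tens0l addr0. Qed.

Lemma tensZr a (v : V) w : tens v (a *: w : W) = a *: tens v w.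
Proof. by rewrite -[a *: w]addr0 tensPr tens0r addr0. Qed.

Lemma tens_sumr (I : Type) (r : seq I) (P : pred I) (v : V) (F : I -> W) :
  tens v (\sum_(i <- r | P i) F i) = \sum_(i <- r | P i) tens v (F i).
Proof.
elim/big_rec2: _ => [|i x y _ <-]; first exact: tens0r.
by rewrite -[F i]scale1r tensPr !scale1r.
Qed.

End TensorGen.

(** * Contraction and exterior multiplication with operator coefficients *)

Lemma zmod_shuffle (U : zmodType) (x l n r m : U) :
  x - l + (m - r) = (n - l) + ((m - n) + (x - r)).
Proof.
by rewrite [RHS]addrA (addrC (n - l)) subrKA addrACA [RHS]addrACA (addrC x).
Qed.

Section KoszulOperators.
Variables (K : fieldType) (d : nat) (V : lmodType K).
Local Notation family := {ffun {set 'I_d} -> V}.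
Implicit Types (X Y : 'I_d -> {linear V -> V}) (z : family) (I : {set 'I_d}).
Local Notation sg := (ext_sign K).

Lemma ext_signD1 (j k : 'I_d) I : k \in I ->
  sg j I = (-1) ^+ (k < j)%N * sg j (I :\ k).
Proof.
move=> kI; rewrite /ext_sign -exprD; congr (_ ^+ _).
rewrite (cardsD1 k) inE kI /=; congr addn.
by congr #|pred_of_set _|; apply/setP => l; rewrite !inE andbA.
Qed.

Lemma ext_signU1 (j k : 'I_d) I : k \notin I ->
  sg j (k |: I) = (-1) ^+ (k < j)%N * sg j I.
Proof. by move=> kI; rewrite (@ext_signD1 j k) ?setU1K // setU11. Qed.

Lemma ext_sign_sq (j : 'I_d) I : sg j I * sg j I = 1.
Proof. by rewrite -expr2 sqrr_sign. Qed.

Lemma sum_antisym (U : zmodType) (F : 'I_d -> 'I_d -> U) :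
  (forall j k, j != k -> F j k = - F k j) ->
  \sum_j \sum_(k | k != j) F j k = 0.
Proof.
move=> Fa; pose S := \sum_(j : 'I_d) \sum_(k : 'I_d | (k < j)%N) F j k.
transitivity (S + \sum_(j : 'I_d) \sum_(k : 'I_d | (j < k)%N) F j k).
  rewrite -big_split; apply: eq_bigr => j _ /=.
  rewrite (bigID (fun k : 'I_d => (k < j)%N)) /=; congr (_ + _);
    by apply: eq_bigl => k; rewrite -val_eqE /=; case: ltngtP.
rewrite (exchange_big_dep predT) //= -big_split big1 // => j _ /=.
rewrite -big_split big1 // => k kj /=.
by rewrite (Fa j k) ?subrr ?addNr // -val_eqE gtn_eqF.
Qed.

(** A family [z : {set 'I_d} -> V] stands for the element of [V ⊗ Λ] whose
    coefficient at [v_I] is [z I]; [contract_by X] and [wedge_by Y] are then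
    [∑_j X_j ⊗ ι_j] and [∑_j Y_j ⊗ (v_j ∧)]. *)
Definition contract_by X z : family :=
  [ffun I : {set 'I_d} => \sum_(j | j \notin I) sg j I *: X j (z (j |: I))].
Definition wedge_by Y z : family :=
  [ffun I : {set 'I_d} => \sum_(j in I) sg j I *: Y j (z (I :\ j))].

Lemma family_subZ (x y : family) a I : (x - a *: y) I = x I - a *: y I.
Proof. by rewrite !ffunE. Qed.

Fact contract_by_linear X : linear (contract_by X).
Proof.
move=> a u v; apply/ffunP => I; rewrite !ffunE scaler_sumr -big_split.
by apply: eq_bigr => j _; rewrite !ffunE !linearP /= !scalerA mulrC.
Qed.
HB.instance Definition _ X :=
  GRing.isLinear.Build K family family _ (contract_by X) (contract_by_linear X).

Fact wedge_by_linear Y : linear (wedge_by Y).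
Proof.
move=> a u v; apply/ffunP => I; rewrite !ffunE scaler_sumr -big_split.
by apply: eq_bigr => j _; rewrite !ffunE !linearP /= !scalerA mulrC.
Qed.
HB.instance Definition _ Y :=
  GRing.isLinear.Build K family family _ (wedge_by Y) (wedge_by_linear Y).

Lemma contract_by_sq X z :
  (forall j k v, X j (X k v) = X k (X j v)) ->
  contract_by X (contract_by X z) = 0.
Proof.
move=> XC; apply/ffunP => I; rewrite !ffunE.
pose F j k := if (j \notin I) && (k \notin I) then
  sg j I *: X j (sg k (j |: I) *: X k (z (k |: (j |: I)))) else 0.
rewrite -[RHS](@sum_antisym _ F) => [|j k jk]; last first.
  rewrite /F; have [jI|] := boolP (j \in I); first by rewrite andbF oppr0.
  have [kI|kI jI /=] := boolP (k \in I); first by rewrite oppr0.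
  rewrite -scaleNr !linearZ /= !scalerA XC !ext_signU1 // setUCA.
  congr (_ *: _); move: jk; rewrite -val_eqE /=.
  by case: ltngtP => //= _ _; rewrite expr0 expr1; ring.
rewrite big_mkcond; apply: eq_bigr => j _; case: ifP => jI; last first.
  by rewrite big1 // /F jI.
rewrite ffunE linear_sum scaler_sumr /=.
rewrite big_mkcond [RHS]big_mkcond; apply: eq_bigr => k _.
by rewrite /F !inE jI /=; case: (k == j) => //=; case: (k \in I).
Qed.

Lemma wedge_by_sq Y z :
  (forall j k v, Y j (Y k v) = Y k (Y j v)) ->
  wedge_by Y (wedge_by Y z) = 0.
Proof.
move=> YC; apply/ffunP => I; rewrite !ffunE.
pose F j k := if (j \in I) && (k \in I) then
  sg j I *: Y j (sg k (I :\ j) *: Y k (z (I :\ j :\ k))) else 0.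
rewrite -[RHS](@sum_antisym _ F) => [|j k jk]; last first.
  rewrite /F; have [jI|] := boolP (j \in I); last by rewrite andbF oppr0.
  have [kI /=|] := boolP (k \in I); last by rewrite oppr0.
  rewrite -scaleNr !linearZ /= !scalerA YC (@ext_signD1 j k I) // (@ext_signD1 k j I) //.
  have -> : I :\ j :\ k = I :\ k :\ j by rewrite !setDDl setUC.
  congr (_ *: _); move: jk; rewrite -val_eqE /=.
  by case: ltngtP => //= _ _; rewrite expr0 expr1; ring.
rewrite big_mkcond; apply: eq_bigr => j _; case: ifP => jI; last first.
  by rewrite big1 // /F jI.
rewrite ffunE linear_sum scaler_sumr /=.
rewrite big_mkcond [RHS]big_mkcond; apply: eq_bigr => k _.
by rewrite /F !inE jI /=; case: (k == j) => //=; case: (k \in I).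
Qed.

(** The Clifford relation: the off-diagonal terms cancel in pairs by signs, and
    at [j = k] the order of [X_j] and [Y_j] depends on whether [j] is in [I].
    Commutation is required for [j != k] only, because the relation is also used
    for operators with [X_j Y_j != Y_j X_j]. *)
Lemma contract_wedge_by X Y z I :
  (forall j k v, j != k -> X j (Y k v) = Y k (X j v)) ->
  contract_by X (wedge_by Y z) I + wedge_by Y (contract_by X z) I =
  \sum_(j | j \notin I) X j (Y j (z I)) + \sum_(j in I) Y j (X j (z I)).
Proof.
move=> XY; rewrite !ffunE.
pose F j k := sg j I *: (sg k (j |: I) *: X j (Y k (z ((j |: I) :\ k)))).
rewrite (eq_bigr (fun j => X j (Y j (z I)) + \sum_(k in I) F j k)); last first.
  move=> j jI; rewrite !ffunE (bigD1 j) ?setU11 //= linearD scalerDr; congr (_ + _).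
    by rewrite setU1K // linearZ scalerA /= ext_signU1 // ltnn mul1r ext_sign_sq scale1r.
  rewrite linear_sum scaler_sumr /=; apply: eq_big => [k|k _].
    by rewrite !inE; case: eqVneq => [->|//]; rewrite ?(negPf jI) ?andbT.
  by rewrite linearZ.
pose F' k j := sg k I *: (sg j (I :\ k) *: Y k (X j (z (j |: (I :\ k))))).
rewrite [X in _ + X](eq_bigr
  (fun k => Y k (X k (z I)) + \sum_(j | j \notin I) F' k j)); last first.
  move=> k kI; rewrite !ffunE (bigD1 k) ?inE ?eqxx //= linearD scalerDr; congr (_ + _).
    rewrite setD1K // linearZ scalerA /= (@ext_signD1 k k I) // ltnn mul1r.
    by rewrite ext_sign_sq scale1r.
  rewrite linear_sum scaler_sumr /=; apply: eq_big => [j|j _].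
    by rewrite !inE; case: eqVneq => [->|//]; rewrite ?kI ?andbT.
  by rewrite linearZ.
rewrite !big_split /= addrACA [X in _ + X](_ : _ = 0) ?addr0 //.
rewrite exchange_big -big_split big1 //= => k kI.
rewrite -big_split big1 //= => j jI.
have jk : j != k by apply: contraNneq jI => ->.
rewrite /F /F'. have -> : (j |: I) :\ k = j |: (I :\ k).
  by apply/setP => l; rewrite !inE; case: (eqVneq l j) => [->|]; rewrite ?jk.
rewrite XY //.
rewrite !scalerA -scalerDl [X in X *: _](_ : _ = 0) ?scale0r //.
rewrite ext_signU1 // (@ext_signD1 j k) //.
by move: jk; rewrite -val_eqE /=; case: ltngtP => //= _ _; rewrite expr0 expr1; ring.
Qed.

Definition koszul_diff X Y z : family := contract_by X z + wedge_by Y z.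
Fact koszul_diff_linear X Y : linear (koszul_diff X Y).
Proof. exact: (linearP (contract_by X \+ wedge_by Y)). Qed.
HB.instance Definition _ X Y :=
  GRing.isLinear.Build K family family _ (koszul_diff X Y)
    (koszul_diff_linear X Y).

(** The anticommutator of the differential with a candidate homotopy: it acts
    as zero on cohomology, so that its invertible part can be removed. *)
Definition laplacian X Y Z z : family :=
  koszul_diff X Y (contract_by Z z) + contract_by Z (koszul_diff X Y z).
Fact laplacian_linear X Y Z : linear (laplacian X Y Z).
Proof.
exact: (linearP ((koszul_diff X Y \o contract_by Z) \+
                 (contract_by Z \o koszul_diff X Y))).
Qed.
HB.instance Definition _ X Y Z :=
  GRing.isLinear.Build K family family _ (laplacian X Y Z)
    (laplacian_linear X Y Z).

(** The part of [laplacian] in which contractions by [X] do not occur. *)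
Definition count_op Y Z z : family :=
  wedge_by Y (contract_by Z z) + contract_by Z (wedge_by Y z).
Fact count_op_linear Y Z : linear (count_op Y Z).
Proof.
exact: (linearP ((wedge_by Y \o contract_by Z) \+
                 (contract_by Z \o wedge_by Y))).
Qed.
HB.instance Definition _ Y Z :=
  GRing.isLinear.Build K family family _ (count_op Y Z) (count_op_linear Y Z).

Lemma laplacian_count X Y Z z : laplacian X Y Z z - count_op Y Z z =
  contract_by X (contract_by Z z) + contract_by Z (contract_by X z).
Proof. by rewrite /laplacian /koszul_diff linearD /count_op addrACA addrK. Qed.

(** [damp c] kills the eigenvalue [c] of [laplacian] and is homotopic to the
    identity; [deform cs] does this for all the eigenvalues in [cs]. *)
Definition damp X Y Z (c : nat) z : family := z - c%:R^-1 *: laplacian X Y Z z.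
Fact damp_linear X Y Z c : linear (damp X Y Z c).
Proof. exact: (linearP (idfun \- (c%:R^-1 \*: laplacian X Y Z))). Qed.
HB.instance Definition _ X Y Z c :=
  GRing.isLinear.Build K family family _ (damp X Y Z c) (damp_linear X Y Z c).

Lemma damp_subE X Y Z c x (y : family) :
  damp X Y Z c x - (y - c%:R^-1 *: count_op Y Z y) =
  - c%:R^-1 *: (laplacian X Y Z x - count_op Y Z x) +
    (- c%:R^-1 *: count_op Y Z (x - y) + (x - y)).
Proof.
rewrite /damp !scaleNr (linearB (count_op Y Z)) /= !scalerBr.
move: (c%:R^-1 *: laplacian _ _ _ _) (c%:R^-1 *: count_op _ _ _)
  (c%:R^-1 *: count_op _ _ _) => l n m.
by rewrite !opprB (zmod_shuffle _ _ n).
Qed.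

Definition deform X Y Z (cs : seq nat) : family -> family :=
  foldr (fun c f => damp X Y Z c \o f) idfun cs.
Fact deform_linear X Y Z cs : linear (deform X Y Z cs).
Proof.
elim: cs => [|c cs IH] a x y //.
by rewrite -[LHS]/(damp X Y Z c (deform X Y Z cs (a *: x + y))) IH linearP.
Qed.
HB.instance Definition _ X Y Z cs :=
  GRing.isLinear.Build K family family _ (deform X Y Z cs)
    (deform_linear X Y Z cs).

Lemma deform_cons X Y Z c cs z :
  deform X Y Z (c :: cs) z = damp X Y Z c (deform X Y Z cs z).
Proof. by []. Qed.

Section Differential.
Variables X Y Z : 'I_d -> {linear V -> V}.
Hypothesis XC : forall j k v, X j (X k v) = X k (X j v).
Hypothesis YC : forall j k v, Y j (Y k v) = Y k (Y j v).
Hypothesis XYC : forall j k v, X j (Y k v) = Y k (X j v).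
Hypothesis XY0 : forall j v, X j (Y j v) = 0.
Local Notation D := (koszul_diff X Y).
Local Notation lap := (laplacian X Y Z).

Lemma koszul_diff_sq z : D (D z) = 0.
Proof.
rewrite /koszul_diff !linearD /= contract_by_sq // wedge_by_sq // addr0 add0r.
apply/ffunP => I; rewrite [LHS]ffunE contract_wedge_by => [|j k v _]; last first.
  exact: XYC.
rewrite [RHS]ffunE [X in X + _]big1 ?add0r => [|j _]; last exact: XY0.
by rewrite big1 // => j _; rewrite -XYC // XY0.
Qed.

Lemma koszul_diff_subZ x a y : D (x - a *: y) = D x - a *: D y.
Proof. by rewrite -scaleNr addrC linearP /= scaleNr addrC. Qed.

Lemma laplacian_diff z : lap (D z) = D (lap z).
Proof.
rewrite /laplacian [RHS](linearD D) /= !koszul_diff_sq add0r.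
by rewrite (linear0 (contract_by Z)) addr0.
Qed.

Lemma deform_diff cs z : deform X Y Z cs (D z) = D (deform X Y Z cs z).
Proof.
elim: cs => [//|c cs IH]; rewrite !deform_cons IH /damp laplacian_diff.
by rewrite koszul_diff_subZ.
Qed.

(** Each factor changes a cocycle by a multiple of [laplacian], which on cocycles
    is the differential of something. *)
Lemma deform_cocycle cs z : D z = 0 -> exists w, deform X Y Z cs z = z + D w.
Proof.
move=> Dz; elim: cs => [|c cs [w IH]]; first by exists 0; rewrite linear0 addr0.
exists (w - c%:R^-1 *: contract_by Z (z + D w)).
rewrite deform_cons IH /damp /laplacian [D (z + _)](linearD D) /= Dz add0r.
rewrite koszul_diff_sq (linear0 (contract_by Z)) addr0.
by rewrite koszul_diff_subZ [RHS]addrA.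
Qed.
End Differential.

End KoszulOperators.

(** * Depth sensitivity of the Koszul complex *)

Section KoszulDepth.
Variables (K : fieldType) (d : nat) (P : comAlgType K).
Implicit Types (f c : 'I_d -> P) (a : P -> Prop) (ys : seq P).
Implicit Types (z w : {ffun {set 'I_d} -> P}) (I : {set 'I_d}).

Definition times f (j : 'I_d) : {linear P -> P} := f j \*o @idfun P.

Definition in_ideal f (p : P) := exists c, p = \sum_j c j * f j.

Fixpoint regular_mod a ys :=
  if ys is y :: ys' then
    (forall p, a (y * p) -> a p) /\
    regular_mod (fun p => exists q, a (p - y * q)) ys'
  else True.

(** If the ideal of the [f_j] contains an [a]-regular sequence [ys], Koszul
    cycles modulo [a] are boundaries in the degrees above [d - size ys]. The
    induction trades an element [y] of the sequence for one degree. As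
    [y = ∑_j c_j f_j], the exterior product [w0] with [c] satisfies
    [y z = d w0] modulo [a], so [w0] is a cycle modulo [(a, y)] and, by
    induction, [w0 = d w' + y w''] modulo [a]. Hence [y z = y d w''], and [y] can
    be cancelled. *)
Theorem koszul_depth f ys a z :
    a 0 -> (forall p q, a p -> a q -> a (p + q)) ->
    (forall r p, a p -> a (r * p)) ->
    regular_mod a ys -> (forall y, y \in ys -> in_ideal f y) ->
    (forall I, a (contract_by (times f) z I)) ->
  exists w, forall I, (d < #|I| + size ys)%N ->
    a (z I - contract_by (times f) w I).
Proof.
elim: ys a z => [|y ys IH] a z a0 aD aM.
  move=> _ _ _; exists 0 => I; rewrite addn0 ltnNge.
  by rewrite (leq_trans (max_card _)) ?card_ord.
move=> [yreg ysreg] ysf az; have [c yE] := ysf y (mem_head _ _).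
have aN p : a p -> a (- p) by rewrite -mulN1r; apply: aM.
have aS (J : finType) (Q : pred J) (F : J -> P) :
    (forall j, Q j -> a (F j)) -> a (\sum_(j | Q j) F j).
  by move=> aF; elim/big_rec: _ => // j p Qj; apply/aD/aF.
have aZ k p : a p -> a (k *: p) by rewrite -mulr_algl; apply: aM.
pose w0 := wedge_by (times c) z.
(* [d (c ∧ z) + c ∧ d z = (∑_j c_j f_j) z], and [d z] vanishes modulo [a]. *)
have homotopy I : a (y * z I - contract_by (times f) w0 I).
  have -> : y * z I = contract_by (times f) w0 I +
      wedge_by (times c) (contract_by (times f) z) I.
    rewrite contract_wedge_by => [|j k v _]; last exact: mulrCA.
    rewrite yE mulr_suml [LHS](bigID (fun j => j \notin I)) /=.
    congr (_ + _); apply: eq_big => [j|j _]; rewrite ?negbK //.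
      by rewrite mulrA (mulrC (c j)).
    by rewrite mulrA.
  rewrite addrC addKr ffunE; apply: aS => j _; apply: aZ; exact: (aM (c j) _ (az _)).
pose a' p := exists q, a (p - y * q).
have [w' w'P] : exists w', forall I, (d < #|I| + size ys)%N ->
    a' (w0 I - contract_by (times f) w' I).
  apply: IH => //.
  - by exists 0; rewrite mulr0 subr0.
  - move=> p q [r pr] [s qs]; exists (r + s).
    by rewrite mulrDr opprD addrACA; apply: aD.
  - move=> r p [q pq]; exists (r * q).
    by rewrite mulrCA -mulrBr; apply: aM.
  - by move=> x xys; apply: ysf; rewrite inE xys orbT.
  by move=> I; exists (z I); rewrite -[_ - _]opprB; apply: aN.
have /choice[q qP] : forall I, exists q, (d < #|I| + size ys)%N ->
    a (w0 I - contract_by (times f) w' I - y * q).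
  move=> I; have [/w'P[q]|] := boolP (d < #|I| + size ys)%N; first by exists q.
  by exists 0.
pose w'' : {ffun {set 'I_d} -> P} := [ffun I => q I].
exists w'' => I dI; apply: yreg; rewrite mulrBr.
have -> : y * z I - y * contract_by (times f) w'' I =
    (y * z I - contract_by (times f) w0 I) +
    contract_by (times f) (w0 - contract_by (times f) w' - [ffun J => y * q J]) I.
  rewrite !linearB /= contract_by_sq => [|j k v]; last exact: mulrCA.
  rewrite subr0 [(_ - _ : {ffun _}) I]ffunE [(- _ : {ffun _}) I]ffunE addrA subrK.
  congr (_ - _).
  rewrite !ffunE mulr_sumr; apply: eq_bigr => j _.
  by rewrite !ffunE /= -scalerAr mulrCA.
apply: aD => //; rewrite ffunE; apply: aS => j jI; apply: aZ; apply: (aM (f j)).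
have := qP (j |: I); rewrite cardsU1 jI add1n addSnnS => /(_ dI).
by rewrite !ffunE.
Qed.

End KoszulDepth.

(** * Torus points with prescribed monomials *)

Section Torus.
Variables (C : numClosedFieldType) (d : nat) (A : 'M[nat]_d).
Hypothesis A_invertible : map_mx (fun k : nat => k%:R : rat) A \in unitmx.

Lemma expfz_sum (I : Type) (r : seq I) (Q : pred I) (F : I -> int) (x : C) :
  x != 0 -> x ^ (\sum_(i <- r | Q i) F i) = \prod_(i <- r | Q i) x ^ F i.
Proof.
move=> x0; elim/big_rec2: _ => [|i a b _ <-]; first by rewrite expr0z.
by rewrite expfzDr.
Qed.

Lemma expfz_prod (I : Type) (r : seq I) (F : I -> C) (n : int) :
  (\prod_(i <- r) F i) ^ n = \prod_(i <- r) F i ^ n.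
Proof.
elim/big_rec2: _ => [|i a b _ <-]; first by rewrite exp1rz.
by rewrite expfzMl.
Qed.

(** The monomials given by the rows of an invertible integer matrix take any
    prescribed nonzero values at some torus point. The adjugate of the matrix
    inverts it up to the determinant, and [|det|]-th roots of the prescribed
    values absorb that factor. *)
Lemma torus_surjective (c : 'I_d -> C) : (forall i, c i != 0) ->
  exists2 x : 'I_d -> C, (forall j, x j != 0) &
    forall i, \prod_j x j ^+ A i j = c i.
Proof.
move=> c0; pose B : 'M[int]_d := map_mx (fun k : nat => k%:Z) A.
have detB0 : \det B != 0.
  apply: contraTneq A_invertible => B0; rewrite unitmxE unitfE.
  have -> : map_mx (fun k : nat => k%:R : rat) A = map_mx intr B.
    by apply/matrixP => i j; rewrite !mxE.
  by rewrite det_map_mx B0 rmorph0 eqxx.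
pose N := `|\det B|%N; have N0 : (0 < N)%N by rewrite absz_gt0.
pose r i : C := N.-root (c i).
have r0 i : r i != 0 by rewrite rootC_eq0.
(* The sign turns the determinant into its absolute value [N]. *)
pose s : int := sgz (\det B).
exists (fun j => \prod_l r l ^ (s * \adj B j l)) => [j|i].
  by apply/prodf_neq0 => l _; rewrite expfz_neq0.
transitivity (\prod_l r l ^ (s * (B *m \adj B) i l)); last first.
  rewrite mul_mx_adj (bigD1 i) //= !mxE eqxx mulr1n big1 ?mulr1.
    rewrite /s -normrEsg -abszE -exprnP; exact: rootCK.
  by move=> l li; rewrite mxE eq_sym (negPf li) mulr0n mulr0 expr0z.
transitivity (\prod_j \prod_l r l ^ (s * (B i j * \adj B j l))).
  apply: eq_bigr => j _; rewrite exprnP expfz_prod; apply: eq_bigr => l _.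
  by rewrite exprz_exp [B i j]mxE; congr (_ ^ _); ring.
rewrite exchange_big; apply: eq_bigr => l _ /=.
by rewrite -expfz_sum // mxE mulr_sumr.
Qed.

End Torus.

(** * Restrictions of the potential to coordinate subspaces *)

Section InvertiblePotential.
Variables (C : numClosedFieldType) (d : nat) (A : 'M[nat]_d).
Implicit Types (F Y : {set 'I_d}).

Definition row_mnm (i : 'I_d) : 'X_{1..d} := [multinom A i j | j < d].
Definition row_in F (i : 'I_d) := [forall j, (j \notin F) ==> (A i j == 0)].
Definition potential_on F : {mpoly C[d]} := \sum_(i | row_in F i) 'X_[row_mnm i].

Lemma row_inP F i : reflect (forall j, j \notin F -> A i j = 0) (row_in F i).
Proof.
apply: (iffP forallP) => rF j; first by move=> jF; apply/eqP/(implyP (rF j)).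
by apply/implyP => /rF ->.
Qed.

Lemma potentialE : potential C A = \sum_i 'X_[row_mnm i].
Proof.
apply: eq_bigr => i _; rewrite mpolyXE_id.
by apply: eq_bigr => j _; rewrite mnmE.
Qed.

Lemma mderiv_potential_on F j : (potential_on F)^`M(j) =
  \sum_(i | row_in F i) (A i j)%:R *: 'X_[row_mnm i - U_(j)].
Proof.
rewrite linear_sum; apply: eq_bigr => i _ /=.
by rewrite mderivX mnmE.
Qed.

Lemma mul_mderivX j (m : 'X_{1..d}) :
  'X_j * ((m j)%:R *: 'X_[m - U_(j)]) = (m j)%:R *: 'X_[m] :> {mpoly C[d]}.
Proof.
have [->|mj] := posnP (m j); first by rewrite !scale0r mulr0.
rewrite -scalerAr -mpolyXD; congr (_ *: 'X_[_]); rewrite addmC submK //.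
by rewrite lep1mP -lt0n.
Qed.

Lemma euler_potential_on F j : 'X_j * (potential_on F)^`M(j) =
  \sum_(i | row_in F i) (A i j)%:R *: 'X_[row_mnm i].
Proof.
rewrite mderiv_potential_on mulr_sumr; apply: eq_bigr => i _.
by have := mul_mderivX j (row_mnm i); rewrite mnmE.
Qed.

Lemma mderiv_potential_on0 F j : j \notin F -> (potential_on F)^`M(j) = 0.
Proof.
move=> jF; rewrite mderiv_potential_on big1 // => i /row_inP-> //.
by rewrite scale0r.
Qed.
End InvertiblePotential.

(** * Ideals and regular sequences of powers of variables *)

Section MonomialLift.
Variables (K : fieldType) (d : nat) (U : lmodType K).

Lemma mpoly_linear_ext (L M : {linear {mpoly K[d]} -> U}) :
  (forall m, L 'X_[m] = M 'X_[m]) -> L =1 M.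
Proof.
move=> LM p; rewrite [p]mpolyE !linear_sum /=; apply: eq_bigr => m _.
by rewrite !linearZ /= LM.
Qed.

Definition mpoly_lift (s : 'X_{1..d} -> U) (p : {mpoly K[d]}) : U :=
  free_lift s (mpoly_val p).

Fact mpoly_lift_linear s : linear (mpoly_lift s).
Proof. by move=> a p q; rewrite -linearP. Qed.
HB.instance Definition _ s :=
  GRing.isLinear.Build K {mpoly K[d]} U _ (mpoly_lift s) (mpoly_lift_linear s).

Lemma mpoly_liftX s m : mpoly_lift s 'X_[m] = s m.
Proof. by rewrite /mpoly_lift unlock [LHS]free_liftU scale1r. Qed.
End MonomialLift.

Section Ideals.
Variables (K : fieldType) (d : nat) (P : comAlgType K) (f : 'I_d -> P).

Lemma in_ideal0 : in_ideal f 0.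
Proof. by exists (fun=> 0); rewrite big1 // => j _; rewrite mul0r. Qed.

Lemma in_idealD p q : in_ideal f p -> in_ideal f q -> in_ideal f (p + q).
Proof.
move=> [b ->] [c ->]; exists (fun j => b j + c j).
by rewrite -big_split; apply: eq_bigr => j _; rewrite mulrDl.
Qed.

Lemma in_idealM r p : in_ideal f p -> in_ideal f (r * p).
Proof.
move=> [b ->]; exists (fun j => r * b j).
by rewrite mulr_sumr; apply: eq_bigr => j _; rewrite mulrA.
Qed.

Lemma in_idealZ a p : in_ideal f p -> in_ideal f (a *: p).
Proof. by rewrite -mulr_algl; apply: in_idealM. Qed.

Lemma in_ideal_gen j : in_ideal f (f j).
Proof.
exists (fun k => (k == j)%:R); rewrite (bigD1 j) //= eqxx mul1r big1 ?addr0 //.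
by move=> k /negPf->; rewrite mul0r.
Qed.

Lemma in_ideal_sum (I : Type) (r : seq I) (Q : pred I) (F : I -> P) :
  (forall i, Q i -> in_ideal f (F i)) -> in_ideal f (\sum_(i <- r | Q i) F i).
Proof.
move=> QF; elim/big_rec: _ => [|i x /QF]; [exact: in_ideal0 | exact: in_idealD].
Qed.

Definition in_radical p := exists n, in_ideal f (p ^+ n).

Lemma in_radical_ideal p : in_ideal f p -> in_radical p.
Proof. by exists 1%N. Qed.

Lemma in_radicalX n p : in_radical (p ^+ n) -> in_radical p.
Proof. by move=> [k]; rewrite -exprM; exists (n * k)%N. Qed.

Lemma in_radicalM r p : in_radical p -> in_radical (r * p).
Proof. by move=> [k pk]; exists k; rewrite exprMn; apply: in_idealM. Qed.

Lemma in_radicalD p q : in_radical p -> in_radical q -> in_radical (p + q).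
Proof.
move=> [k pk] [l ql]; exists (k + l)%N; rewrite exprDn.
apply: in_ideal_sum => i _; rewrite -mulr_natl; apply: in_idealM.
have [il|/ltnW il] := leqP l i.
  by rewrite -[X in q ^+ X](subnK il) exprD mulrA; apply: in_idealM.
by rewrite -addnBA // exprD -mulrA mulrC; apply: in_idealM.
Qed.

Lemma in_radical_sum (I : Type) (r : seq I) (Q : pred I) (F : I -> P) :
  (forall i, Q i -> in_radical (F i)) ->
  in_radical (\sum_(i <- r | Q i) F i).
Proof.
move=> QF; elim/big_rec: _ => [|i x /QF]; last exact: in_radicalD.
exact/in_radical_ideal/in_ideal0.
Qed.
End Ideals.

Section PowersRegular.
Variables (K : fieldType) (d : nat).
Implicit Types (a : {mpoly K[d]} -> Prop) (s : seq 'I_d).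

(** Division by ['X_k ^+ n] of the monomials that admit it; the others are sent
    to zero. This one-sided inverse of multiplication makes regularity of
    sequences of powers of distinct variables immediate. *)
Definition divide_monomial (k : 'I_d) n : {mpoly K[d]} -> {mpoly K[d]} :=
  mpoly_lift (fun m : 'X_{1..d} =>
    if (n <= m k)%N then 'X_[m - U_(k) *+ n] else 0).
HB.instance Definition _ k n := GRing.Linear.on (divide_monomial k n).

Lemma divide_monomialK k n p : divide_monomial k n ('X_k ^+ n * p) = p.
Proof.
pose L : {linear {mpoly K[d]} -> {mpoly K[d]}} :=
  divide_monomial k n \o ('X_k ^+ n \*o idfun).
rewrite -[LHS]/(L p) -[RHS]/((idfun : {linear _ -> _}) p).
apply: mpoly_linear_ext => m; rewrite /L /= mpolyXn -mpolyXD.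
rewrite /divide_monomial mpoly_liftX mnmDE mulmnE mnm1E eqxx mul1n leq_addr.
by rewrite addmC addmK.
Qed.

Lemma divide_monomialC k n j l p : j != k ->
  divide_monomial k n ('X_j ^+ l * p) = 'X_j ^+ l * divide_monomial k n p.
Proof.
move=> jk.
pose L : {linear {mpoly K[d]} -> {mpoly K[d]}} :=
  divide_monomial k n \o ('X_j ^+ l \*o idfun).
pose M : {linear {mpoly K[d]} -> {mpoly K[d]}} :=
  'X_j ^+ l \*o divide_monomial k n.
rewrite -[LHS]/(L p) -[RHS]/(M p); apply: mpoly_linear_ext => m.
rewrite /L /M /= mpolyXn -mpolyXD /divide_monomial !mpoly_liftX.
rewrite mnmDE mulmnE mnm1E (negPf jk) add0n; case: leqP => nm; last by rewrite mulr0.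
rewrite -mpolyXD; congr 'X_[_]; apply/mnmP => i.
rewrite !(mnmDE, mnmBE, mulmnE, mnm1E).
by case: (k =P i) nm => [<-|_] nm; rewrite ?(negPf jk) ?mul0n ?subn0 ?add0n.
Qed.

(** An ideal stable under division by the powers in question stays so after one
    of them is added to it, because division by one variable commutes with
    multiplication by another. *)
Lemma regular_powers a s (n : 'I_d -> nat) : uniq s ->
  (forall k p, k \in s -> a p -> a (divide_monomial k (n k) p)) ->
  regular_mod a [seq 'X_j ^+ n j | j <- s].
Proof.
elim: s a => //= j s IH a /andP[js us] as_; split=> [p|].
  by move/(as_ j _ (mem_head _ _)); rewrite divide_monomialK.
apply: IH => // k p ks [q apq]; exists (divide_monomial k (n k) q).
rewrite -divide_monomialC; last by apply: contraNneq js => ->.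
by rewrite -linearB; apply: as_ => //; rewrite inE ks orbT.
Qed.
End PowersRegular.

(** * The Jacobian ideal contains powers of the variables *)

Section Nullstellensatz.
Variables (C : numClosedFieldType) (d : nat) (A : 'M[nat]_d).
Hypothesis A_invertible : map_mx (fun k : nat => k%:R : rat) A \in unitmx.
Hypothesis W_smooth : smooth_away_from_origin (potential C A).
Implicit Types (F Y : {set 'I_d}).
Local Notation row_in := (row_in A).
Local Notation row_mnm := (row_mnm A).

(** The monomials [x_k y] of the potential with [y] a monomial in the variables
    of [Y]: on the coordinate subspace of [Y], with [k] not in [Y], they are the
    ones that contribute to the partial derivative at [x_k]. *)
Definition pointed_rows Y (k : 'I_d) : {set 'I_d} :=
  [set i | (A i k == 1%N) && row_in (k |: Y) i].

Lemma pointed_row_neq0 Y i k l : A i l != 0%N -> l \notin Y ->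
  i \in pointed_rows Y k -> l = k.
Proof.
move=> il lY; rewrite inE => /andP[_ /row_inP iY].
apply: contraNeq il => lk; apply/eqP/iY.
by rewrite !inE negb_or lk.
Qed.

(** Nonzero values can be given to the monomials so that they cancel in each
    class [pointed_rows Y k] with at least two members: all values are 1, except
    at one representative of the class. The classes are disjoint because a row
    that is not supported in [Y] has at most one such [k]. *)
Lemma sum_prescribed Y : (forall i, ~~ row_in Y i) ->
  (forall k, k \notin Y -> #|pointed_rows Y k| != 1%N) ->
  exists2 c : 'I_d -> C, (forall i, c i != 0) &
    forall k, k \notin Y -> \sum_(i in pointed_rows Y k) c i = 0.
Proof.
move=> Yrow Bcard; pose B := pointed_rows Y.
pose rep k := [pick i in B k].
pose P i k := [&& k \notin Y, i \in B k & rep k == Some i].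
exists (fun i => if [pick k | P i k] is Some k then - (#|B k|.-1)%:R else 1).
  move=> i; case: pickP => [k /and3P[kY iB _]|_]; last exact: oner_neq0.
  rewrite oppr_eq0 pnatr_eq0; move: (Bcard k kY); rewrite -/B.
  by rewrite (cardD1 i) iB; case: #|_|.
move=> k kY; have [B0|] := eqVneq (B k) set0.
  by rewrite -/B B0 big_set0.
case/set0Pn => i iB; have [i0 repk i0B] : exists2 i0, rep k = Some i0 & i0 \in B k.
  by rewrite /rep; case: pickP => [i0 ?|/(_ i)]; [exists i0 | rewrite iB].
have Puniq i' k' : i' \in B k -> P i' k' -> k' = k.
  move=> i'B /and3P[k'Y i'B' _]; apply/(pointed_row_neq0 _ k'Y i'B).
  by move: i'B'; rewrite inE => /andP[/eqP-> _].
rewrite (bigD1 i0) //=; case: pickP => [k' P'|/(_ k)]; last first.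
  by rewrite /P kY i0B repk eqxx.
rewrite (Puniq _ _ i0B P') (eq_bigr (fun=> 1)) => [|i' /andP[i'B i'i0]]; last first.
  case: pickP => // k'' P''; move: i'i0 (P'').
  by rewrite /P (Puniq _ _ i'B P'') repk => /negPf ni /and3P[_ _ /eqP[/esym/eqP]]; rewrite ni.
rewrite (eq_bigl (mem (B k :\ i0))) => [|i']; last by rewrite !inE andbC.
by rewrite sumr_const (cardsD1 i0 (B k)) i0B addNr.
Qed.

(** Suppose that no monomial lives on [Y] and that no class of monomials
    [pointed_rows Y k] is a singleton. A torus point at which the monomials of
    each class cancel gives, after its coordinates outside [Y] are set to zero,
    a nonzero critical point of the potential on the hypersurface, against
    smoothness. *)
Lemma unique_pointed_row Y : Y != set0 -> (forall i, ~~ row_in Y i) ->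
  exists2 k, k \notin Y & #|pointed_rows Y k| = 1%N.
Proof.
move=> Y0 Yrow; apply: contrapT => noB.
have [|c c0 sumc] := @sum_prescribed Y Yrow.
  by move=> k kY; apply/eqP => B1; apply: noB; exists k.
have [x x0 xc] := torus_surjective A_invertible c0.
pose y j := if j \in Y then x j else 0.
have yE (m : 'X_{1..d}) : \prod_j y j ^+ m j =
    if [forall j, (j \notin Y) ==> (m j == 0%N)] then \prod_j x j ^+ m j else 0.
  case: ifP => [/forallP mY|/negbT].
    apply: eq_bigr => j _; rewrite /y; case: ifP => // /negbT jY.
    by have /implyP/(_ jY)/eqP-> := mY j.
  rewrite negb_forall => /existsP[j]; rewrite negb_imply => /andP[jY mj].
  by rewrite (bigD1 j) //= /y (negPf jY) expr0n (negPf mj) mul0r.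
have [||k] := W_smooth (x := y).
- by case/set0Pn: Y0 => j jY; exists j; rewrite /y jY.
- rewrite potentialE raddf_sum big1 // => i _; rewrite /= mevalX yE.
  case: ifP => // iY; case/negP: (Yrow i); apply/forallP => j.
  by move/forallP: iY => /(_ j); rewrite mnmE.
move/negP; apply; rewrite potentialE. rewrite (linear_sum (mderiv k)) (raddf_sum (meval y)) /=.
have termE i : ((('X_[row_mnm i])^`M(k)).@[y] : C) = if k \notin Y then
    if i \in pointed_rows Y k then (x k)^-1 * c i else 0 else 0.
  rewrite mderivX mnmE mevalZ mevalX yE.
  case: ifP => [/forallP iY|niY]; last first.
    rewrite mulr0; case: ifP => // kY; case: ifP => //; rewrite inE.
    case/andP => /eqP ik /row_inP irow; case/negP: niY; apply/forallP => j.
    apply/implyP => jY; rewrite mnmBE mnm1E mnmE; have [<-|kj] := eqVneq k j.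
      by rewrite ik.
    by rewrite irow // !inE eq_sym negb_or kj.
  have rowk : A i k != 0%N -> k \notin Y /\ i \in pointed_rows Y k.
    move=> ik; have iY' j : j \notin Y -> j != k -> A i j = 0%N.
      move=> jY jk; have /implyP/(_ jY) := iY j.
      by rewrite mnmBE mnm1E mnmE (eq_sym k) (negPf jk) subn0 => /eqP.
    have kY : k \notin Y.
      apply/negP => kY; case/negP: (Yrow i); apply/row_inP => j jY.
      by apply: iY' => //; apply: contraNneq jY => ->.
    split=> //; have /implyP/(_ kY) := iY k.
    rewrite mnmBE mnm1E mnmE eqxx subn_eq0 inE eqn_leq lt0n ik andbT => ->.
    by apply/row_inP => j; rewrite !inE negb_or => /andP[jk jY]; apply: iY'.
  have [ik|ik] := eqVneq (A i k) 0%N.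
    rewrite ik mul0r; case: ifP => // kY; case: ifP => //.
    by rewrite inE ik.
  have [kY iB] := rowk ik; rewrite kY iB -xc.
  move: (iB); rewrite inE => /andP[/eqP ik1 _]; rewrite ik1 mul1r.
  rewrite [in RHS](bigD1 k) //= ik1 expr1 mulKf // (bigD1 k) //=.
  rewrite mnmBE mnm1E eqxx mnmE ik1 expr0 mul1r; apply: eq_bigr => j jk.
  by rewrite mnmBE mnm1E mnmE (eq_sym k) (negPf jk) subn0.
rewrite (eq_bigr _ (fun i _ => termE i)); have [kY|kY] := boolP (k \in Y).
  by rewrite big1 ?eqxx.
by rewrite -big_mkcond -mulr_sumr sumc // mulr0.
Qed.

Variable F : {set 'I_d}.
Hypothesis F_closed : forall i k, A i k = 1%N -> row_in (k |: F) i -> k \in F.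
Local Notation f := (fun j => (potential_on C A F)^`M(j)).
Local Notation vars Y := (vars_prod C Y).

(** By Euler's formula [x_j ∂_j W = ∑_i a_ij x^(A_i)], the inverse matrix
    expresses each monomial through the partial derivatives. *)
Lemma row_monomial_in_ideal i : row_in F i -> in_ideal f 'X_[row_mnm i].
Proof.
move=> iF; pose B := map_mx (fun k : nat => k%:R : rat) A.
exists (fun j => ratr (invmx B j i) *: 'X_j).
have E : B *m invmx B = 1%:M by rewrite mulmxV.
transitivity (\sum_(i' | row_in F i')
    (ratr ((B *m invmx B) i' i) : C) *: ('X_[row_mnm i'] : {mpoly C[d]})).
  rewrite E (bigD1 i) //= mxE eqxx rmorph1 scale1r big1 ?addr0 // => i' /andP[_ i'i].
  by rewrite mxE (negPf i'i) rmorph0 scale0r.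
under [RHS]eq_bigr => j _.
  rewrite -scalerAl euler_potential_on scaler_sumr; over.
rewrite exchange_big /=; apply: eq_bigr => i' _.
rewrite mxE rmorph_sum scaler_suml; apply: eq_bigr => j _ /=.
by rewrite scalerA rmorphM [B i' j]mxE /= ratr_nat mulrC.
Qed.

(** Modulo the variables outside [Y], the Jacobian ideal contains a monomial in
    the variables of [Y]: either one of the monomials of the potential, or the
    partial derivative whose class of monomials is a singleton. *)
Lemma monomial_mod_vars Y : Y != set0 -> Y \subset F ->
  exists2 m : 'X_{1..d}, (forall j, j \notin Y -> m j = 0%N) &
    exists2 p, in_ideal f ('X_[m] - p) &
      in_ideal (fun z => if z \in F :\: Y then 'X_z else 0) p.
Proof.
move=> Y0 YF; have [[i iY]|] := pselect (exists i, row_in Y i).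
  have /row_inP iY0 := iY.
  exists (row_mnm i) => [j jY|]; first by rewrite mnmE iY0.
  exists 0; last exact: in_ideal0.
  rewrite subr0; apply/row_monomial_in_ideal/row_inP => j jF.
  by apply: iY0; apply: contra jF; apply: subsetP.
move=> /forallNP noY.
have [|k kY /eqP/cards1P[i Bk]] := unique_pointed_row Y0.
  by move=> i; apply/negP/noY.
have : i \in pointed_rows Y k by rewrite Bk set11.
rewrite inE => /andP[/eqP ik iY].
have subkY : (forall j, j \notin k |: F -> j \notin k |: Y).
  by move=> j; apply: contra; apply/subsetP/setUS.
have kF : k \in F.
  by apply: (F_closed ik); apply/row_inP => j /subkY; move/row_inP: iY; apply.
have iF : row_in F i.
  apply/row_inP => j jF; move/row_inP: iY; apply; apply: subkY.
  by rewrite !inE negb_or jF andbT; apply: contraNneq jF => ->.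
exists (row_mnm i - U_(k))%MM => [j jY|].
  rewrite mnmBE mnm1E mnmE; have [<-|kj] := eqVneq k j; first by rewrite ik.
  by rewrite (row_inP _ _ _ iY) // !inE eq_sym negb_or kj.
exists ('X_[row_mnm i - U_(k)] - (potential_on C A F)^`M(k)).
  by rewrite opprB addrC subrK; apply: in_ideal_gen.
rewrite mderiv_potential_on (bigD1 i) //= ik scale1r opprD addNKr -sumrN.
apply: in_ideal_sum => i' /andP[i'F i'i]; rewrite -scaleNr.
have [->|i'k] := eqVneq (A i' k) 0%N; first by rewrite oppr0 scale0r; apply: in_ideal0.
have [z zFY zi'] : exists2 z, z \in F :\: Y & (U_(z) <= row_mnm i' - U_(k))%MM.
  have [i'k1|i'k1] := eqVneq (A i' k) 1%N; last first.
    exists k; first by rewrite inE kY kF.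
    by rewrite lep1mP mnmBE mnm1E mnmE eqxx; case: (A i' k) i'k i'k1 => [|[]].
  have /row_inP/existsNP[z /not_implyP[zkY /eqP i'z]] : ~~ row_in (k |: Y) i'.
    apply/negP => i'Y; have : i' \in pointed_rows Y k by rewrite inE i'k1 eqxx.
    by rewrite Bk inE (negPf i'i).
  move: zkY; rewrite !inE negb_or => /andP[zk zY]; exists z.
    rewrite inE zY /=; apply: contraNT i'z => zF.
    by rewrite (row_inP _ _ _ i'F).
  by rewrite lep1mP mnmBE mnm1E mnmE (eq_sym k) (negPf zk) subn0.
rewrite -(submK zi') mpolyXD; apply/in_idealZ/in_idealM.
have := @in_ideal_gen C _ {mpoly C[d]} (fun z => if z \in F :\: Y then 'X_z else 0) z.
by rewrite zFY.
Qed.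

(** Descending induction on [Y]: multiplied by the product of the variables of
    [Y], the error term of [monomial_mod_vars] becomes a combination of products
    of variables over strictly larger sets. *)
Lemma vars_prod_in_radical Y : Y != set0 -> Y \subset F ->
  in_radical f (vars Y).
Proof.
have [n] := ubnP #|F :\: Y|; elim: n Y => // n IH Y Yn Y0 YF.
have [m mY [p mp pY]] := monomial_mod_vars Y0 YF.
have radm : in_radical f (vars Y * 'X_[m]).
  rewrite -(subrK p 'X_[m]) mulrDr; apply: in_radicalD.
    exact/in_radicalM/in_radical_ideal.
  have [c ->] := pY; rewrite mulr_sumr; apply: in_radical_sum => z _.
  case: ifP => [|_]; last by rewrite !mulr0; apply/in_radical_ideal/in_ideal0.
  rewrite inE => /andP[zY zF].
  have -> : vars Y * (c z * 'X_z) = c z * vars (z |: Y).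
    by rewrite /vars_prod big_setU1 //= mulrCA [_ * 'X_z]mulrC.
  apply/in_radicalM/IH.
  - rewrite ltnS in Yn; apply: leq_trans Yn; apply: proper_card.
    apply/properP; split; first exact/setDS/subsetUr.
    by exists z; rewrite !inE ?zY ?zF // eqxx.
  - by apply/set0Pn; exists z; rewrite setU11.
  - by rewrite subUset sub1set zF.
apply: (@in_radicalX _ _ _ _ (mdeg m).+1).
have mE : 'X_[m] = \prod_(j in Y) 'X_j ^+ m j :> {mpoly C[d]}.
  rewrite mpolyXE_id [LHS](bigID (mem Y)) /= [X in _ * X]big1 ?mulr1 // => j jY.
  by rewrite mY.
have -> : vars Y ^+ (mdeg m).+1 =
    (\prod_(j in Y) 'X_j ^+ (mdeg m - m j)) * (vars Y * 'X_[m]).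
  rewrite exprS mulrCA; congr (_ * _); rewrite mE -big_split /vars_prod -prodrXl.
  apply: eq_bigr => j _ /=; rewrite -exprD subnK // mdegE (bigD1 j) //=.
  exact: leq_addr.
exact: in_radicalM.
Qed.

Lemma variables_in_radical j : j \in F -> in_radical f ('X_j).
Proof.
move=> jF; have := @vars_prod_in_radical [set j].
rewrite /vars_prod big_set1; apply; last by rewrite sub1set.
by apply/set0Pn; exists j; rewrite set11.
Qed.

(** The Koszul complex of the partial derivatives with respect to the variables
    of [F] is exact except in the lowest degree. The indices outside [F], where
    the partial derivative is zero, only shift the degrees by [d - #|F|]. *)
Theorem koszul_potential_exact (z : {ffun {set 'I_d} -> {mpoly C[d]}}) :
  (forall I : {set 'I_d}, contract_by (times f) z I = 0) ->
  exists w : {ffun {set 'I_d} -> {mpoly C[d]}},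
    forall I : {set 'I_d}, (d < #|I| + #|F|)%N ->
    z I = contract_by (times f) w I.
Proof.
move=> z0.
have /choice[n nP] : forall j, exists n, j \in F -> in_ideal f ('X_j ^+ n).
  move=> j; have [/variables_in_radical[n]|] := boolP (j \in F); first by exists n.
  by exists 0%N.
have [||||||w wP] := koszul_depth (a := fun p => p = 0) (f := f)
  (ys := [seq 'X_j ^+ n j | j <- enum F]) (z := z).
- by [].
- by move=> p q -> ->; rewrite addr0.
- by move=> r p ->; rewrite mulr0.
- apply: regular_powers; first exact: enum_uniq.
  by move=> k p _ ->; rewrite linear0.
- by move=> y /mapP[j]; rewrite mem_enum => jF ->; apply: nP.
- exact: z0.
exists w => I dI; apply/eqP; rewrite -subr_eq0; apply/eqP/wP.
by rewrite size_map -cardE.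
Qed.

End Nullstellensatz.

(** * The semigroup ring of the two cones *)

Section ConeAlgebra.
Variables (C : numFieldType) (d : nat) (A : 'M[nat]_d) (N : 'rV[rat]_d -> Prop).
Hypothesis N0 : N 0.
Hypothesis Nadd : forall n j, N n -> N (basis_vec j + n).
Hypothesis Nsub : forall n j, N (basis_vec j + n) -> N n.
Hypothesis N_dual : forall i, dual_lattice A N (basis_vec i).
Implicit Types (m n : 'rV[rat]_d) (p : cone_pair A N) (i j k : 'I_d).
Local Notation V := (cone_algebra C A N).
Local Notation pair := (pairing A).
Local Notation mono := (monomial C A N).

Lemma basis_vecE j k : basis_vec j 0 k = (k == j)%:R :> rat.
Proof. by rewrite /basis_vec mxE eqxx. Qed.

Lemma coordD m n j : (m + n) 0 j = m 0 j + n 0 j.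
Proof. exact: mxE. Qed.

Lemma coordN m j : (- m) 0 j = - m 0 j.
Proof. exact: mxE. Qed.

Definition coordE := (coordD, coordN, basis_vecE).

Lemma pairingDl m m' n : pair (m + m') n = pair m n + pair m' n.
Proof.
rewrite /pairing -big_split; apply: eq_bigr => i _ /=; rewrite -big_split.
by apply: eq_bigr => j _; rewrite mxE !mulrDl.
Qed.

Lemma pairing_coord m n : pair m n = \sum_j pair m (basis_vec j) * n 0 j.
Proof.
rewrite /pairing exchange_big; apply: eq_bigr => j _ /=; rewrite mulr_suml.
apply: eq_bigr => i _; congr (_ * _); rewrite (bigD1 j) //= basis_vecE eqxx.
by rewrite mulr1 big1 ?addr0 // => k kj; rewrite basis_vecE (negPf kj) mulr0.
Qed.

Lemma pairing_basis i j : pair (basis_vec i) (basis_vec j) = (A i j)%:R.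
Proof.
rewrite /pairing (bigD1 i) //= [X in _ + X]big1 ?addr0 => [|k ki]; last first.
  by rewrite big1 // => l _; rewrite basis_vecE (negPf ki) !mul0r.
rewrite (bigD1 j) //= !basis_vecE !eqxx mulr1 mul1r big1 ?addr0 // => l lj.
by rewrite basis_vecE (negPf lj) mulr0.
Qed.

Lemma pairing_int m j : dual_lattice A N m -> pair m (basis_vec j) \is a Num.int.
Proof. by move=> Mm; apply: Mm; rewrite -[basis_vec j]addr0; apply: Nadd. Qed.

Lemma dual_coneP m : dual_cone_K A m <-> forall j, 0 <= pair m (basis_vec j).
Proof.
split=> [mK j|mK n nK]; last first.
  by rewrite pairing_coord sumr_ge0 // => j _; rewrite mulr_ge0.
by apply: mK => k; rewrite basis_vecE; case: eqP.
Qed.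

(** All the terms of [m . n = ∑_j (m . v_j) n_j] are nonnegative on the cones,
    so the pairing vanishes as soon as each of them does, and conversely. *)
Lemma cone_pairP m n : cone_pair_pred A N (m, n) <->
  [/\ dual_lattice A N m, forall j, 0 <= pair m (basis_vec j), N n,
      forall j, 0 <= n 0 j & forall j, pair m (basis_vec j) * n 0 j = 0].
Proof.
split=> [/asboolP[/= mM /dual_coneP mK nN nK mn0]|[mM mK nN nK mn0]]; last first.
  apply/asboolP; split=> //=; first exact/dual_coneP.
  by rewrite pairing_coord big1 // => j _; apply: mn0.
split=> // j; apply/eqP; move/eqP: mn0; rewrite pairing_coord psumr_eq0.
  by move/allP/(_ j); rewrite mem_index_enum; apply.
by move=> k _; apply: mulr_ge0.
Qed.

Lemma monomial_pair p : mono (val p).1 (val p).2 = << p >>.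
Proof.
rewrite /monomial; case: p => -[m n] mn /=.
by rewrite (insubT (fun q => cone_pair_pred A N q) mn).
Qed.

Variant monomial_spec m n : V -> Prop :=
  | MonomialPair p of val p = (m, n) : monomial_spec m n << p >>
  | MonomialZero of ~~ cone_pair_pred A N (m, n) : monomial_spec m n 0.

Lemma monomialP m n : monomial_spec m n (mono m n).
Proof. by rewrite /monomial; case: insubP => [p _ pE|]; constructor. Qed.

Lemma monomial0 m n : ~~ cone_pair_pred A N (m, n) -> mono m n = 0.
Proof. by case: monomialP => // p <-; rewrite (valP p). Qed.

Lemma monomial_mulU m n p :
  monomial_mul C A N m n << p >> = mono (m + (val p).1) (n + (val p).2).
Proof. by rewrite [LHS]free_liftU scale1r. Qed.

Lemma monomial_mulE a b m n :
  (cone_pair_pred A N (a + m, b + n) -> cone_pair_pred A N (m, n)) ->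
  monomial_mul C A N a b (mono m n) = mono (a + m) (b + n).
Proof.
move=> mnP; case: (monomialP m n) => [p pE|]; first by rewrite monomial_mulU pE.
by move=> nmn; rewrite linear0 monomial0 //; apply: contra nmn.
Qed.

(** [row_op j] is multiplication by [∑_i a_ij [u_i]], the coefficient of the
    contraction along [v_j]; [raise_op j] is multiplication by [v_j]; and
    [lower_op j] divides by [v_j] the monomials with [n_j >= 1], sending the
    others to zero. *)
Definition row_op j : {linear V -> V} :=
  lin_sum (fun i => (A i j)%:R \*: monomial_mul C A N (basis_vec i) 0).
Definition raise_op j : {linear V -> V} := monomial_mul C A N 0 (basis_vec j).
Definition lower_op j : {linear V -> V} := monomial_mul C A N 0 (- basis_vec j).

Lemma row_opE j v : row_op j v =
  \sum_i (A i j)%:R *: monomial_mul C A N (basis_vec i) 0 v.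
Proof. by []. Qed.

Lemma dual_latticeD m m' :
  dual_lattice A N m -> dual_lattice A N m' -> dual_lattice A N (m + m').
Proof. by move=> mM mM' n nN; rewrite pairingDl rpredD ?mM ?mM'. Qed.

Lemma dual_lattice_row i m :
  dual_lattice A N (basis_vec i + m) <-> dual_lattice A N m.
Proof.
split=> mM; last exact: dual_latticeD.
move=> n nN; have := mM n nN; rewrite pairingDl => /(rpredB (N_dual i nN)).
by rewrite opprD addrA subrr add0r rpredN.
Qed.

Lemma mul_row_monomial i m n : (forall j, 0 <= pair m (basis_vec j)) ->
  monomial_mul C A N (basis_vec i) 0 (mono m n) = mono (basis_vec i + m) n.
Proof.
move=> mK; rewrite monomial_mulE add0r // => /cone_pairP[mM mK' nN nK mn0].
apply/cone_pairP; split=> // [|j]; first exact/dual_lattice_row/mM.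
apply/eqP; have /eqP := mn0 j; rewrite pairingDl mulrDl pairing_basis.
by rewrite paddr_eq0 ?mulr_ge0 // => /andP[].
Qed.

Lemma raise_monomial j m n : cone_K n ->
  raise_op j (mono m n) = mono m (basis_vec j + n).
Proof.
move=> nK; rewrite [LHS]monomial_mulE add0r // => /cone_pairP[mM mK nN _ mn0].
apply/cone_pairP; split=> // [|k]; first exact: Nsub nN.
apply/eqP; have /eqP := mn0 k; rewrite mxE basis_vecE mulrDr.
by rewrite paddr_eq0 ?mulr_ge0 // => /andP[].
Qed.

Lemma pair_spec p : cone_pair_pred A N ((val p).1, (val p).2).
Proof. by rewrite -surjective_pairing; apply: (valP p). Qed.

Lemma lower_raiseC j k v : j != k ->
  lower_op j (raise_op k v) = raise_op k (lower_op j v).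
Proof.
move=> jk; rewrite -[LHS]/((lower_op j \o raise_op k) v).
rewrite -[RHS]/((raise_op k \o lower_op j) v).
apply: freeg_linear_ext => p _ /=; have /cone_pairP[mM mK nN nK mn0] := pair_spec p.
rewrite !monomial_mulU !add0r !monomial_mulE ?add0r; first by rewrite addrCA.
  move=> /cone_pairP[_ _ nN' nK' mn0']; apply/cone_pairP.
  have nE l : l != k -> (- basis_vec j + (val p).2) 0 l =
      (basis_vec k + (- basis_vec j + (val p).2)) 0 l.
    by move=> lk; rewrite [RHS]coordD basis_vecE (negPf lk) add0r.
  split=> // [|l|l]; first exact: Nsub nN'.
    have [->|/nE->//] := eqVneq l k.
    by rewrite !coordE eq_sym (negPf jk) oppr0 add0r.
  have [->|/nE->//] := eqVneq l k.
  by rewrite !coordE eq_sym (negPf jk) oppr0 add0r mn0.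
move=> /cone_pairP[_ _ _ nK' mn0']; apply/cone_pairP.
split=> // [|l|l]; first exact: Nadd.
  by rewrite coordD basis_vecE addr_ge0.
have [lk|lk] := eqVneq l k; last by rewrite coordD basis_vecE (negPf lk) add0r.
have := mn0' l; rewrite !coordD coordN [basis_vec j 0 l]basis_vecE.
by rewrite lk eq_sym (negPf jk) oppr0 add0r.
Qed.

Lemma row_monomial j m n : (forall l, 0 <= pair m (basis_vec l)) ->
  row_op j (mono m n) = \sum_i (A i j)%:R *: mono (basis_vec i + m) n.
Proof. by move=> mK; apply: eq_bigr => i _; rewrite /= mul_row_monomial. Qed.

Lemma pairing_row_ge0 i m : (forall l, 0 <= pair m (basis_vec l)) ->
  forall l, 0 <= pair (basis_vec i + m) (basis_vec l).
Proof. by move=> mK l; rewrite pairingDl pairing_basis addr_ge0. Qed.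

Lemma row_opC j k v : row_op j (row_op k v) = row_op k (row_op j v).
Proof.
rewrite -[LHS]/((row_op j \o row_op k) v) -[RHS]/((row_op k \o row_op j) v).
apply: freeg_linear_ext => p _ /=; have /cone_pairP[mM mK nN nK mn0] := pair_spec p.
have E j' k' : row_op j' (row_op k' << p >>) = \sum_i \sum_i'
    ((A i j')%:R * (A i' k')%:R) *: mono (basis_vec i + (basis_vec i' + (val p).1)) (val p).2.
  rewrite -monomial_pair row_monomial // linear_sum [RHS]exchange_big; apply: eq_bigr => i _.
  rewrite linearZ_LR row_monomial ?scaler_sumr; last exact: pairing_row_ge0.
  by apply: eq_bigr => i' _; rewrite scalerA mulrC.
rewrite !E exchange_big; apply: eq_bigr => i _; apply: eq_bigr => i' _.
by rewrite mulrC addrCA.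
Qed.

Lemma raise_opC j k v : raise_op j (raise_op k v) = raise_op k (raise_op j v).
Proof.
rewrite -[LHS]/((raise_op j \o raise_op k) v) -[RHS]/((raise_op k \o raise_op j) v).
apply: freeg_linear_ext => p _ /=; have /cone_pairP[mM mK nN nK mn0] := pair_spec p.
have vK l : cone_K (basis_vec l + (val p).2).
  by move=> l'; rewrite coordD basis_vecE addr_ge0.
by rewrite -monomial_pair !raise_monomial // addrCA.
Qed.

Lemma row_raiseC j k v : row_op j (raise_op k v) = raise_op k (row_op j v).
Proof.
rewrite -[LHS]/((row_op j \o raise_op k) v) -[RHS]/((raise_op k \o row_op j) v).
apply: freeg_linear_ext => p _ /=; have /cone_pairP[mM mK nN nK mn0] := pair_spec p.
rewrite -monomial_pair raise_monomial // !row_monomial // linear_sum.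
by apply: eq_bigr => i _; rewrite linearZ /= raise_monomial.
Qed.

(** If [u_i] occurs in [row_op j] then [u_i . v_j = a_ij > 0], so the product of
    its monomial with that of [v_j] vanishes. This is why the differential of
    the complex squares to zero. *)
Lemma row_raise0 j v : row_op j (raise_op j v) = 0.
Proof.
rewrite -[LHS]/((row_op j \o raise_op j) v) -[RHS]/((\0 : {linear V -> V}) v).
apply: freeg_linear_ext => p _ /=; have /cone_pairP[mM mK nN nK mn0] := pair_spec p.
rewrite -monomial_pair raise_monomial // row_monomial // big1 // => i _.
have [->|Aij] := eqVneq (A i j) 0%N; first by rewrite scale0r.
rewrite monomial0 ?scaler0 //; apply/negP => /cone_pairP[_ _ _ _ /(_ j)/eqP].
rewrite coordD basis_vecE eqxx pairingDl pairing_basis mulf_eq0 !paddr_eq0 //.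
by rewrite pnatr_eq0 (negPf Aij) oner_eq0.
Qed.

Lemma raise_lower j p : raise_op j (lower_op j << p >>) =
  if 1 <= (val p).2 0 j then << p >> else 0.
Proof.
have /cone_pairP[mM mK nN nK mn0] := pair_spec p.
rewrite [lower_op j _]monomial_mulU add0r; case: ifP => nj; last first.
  rewrite monomial0 ?linear0 //; apply/negP => /cone_pairP[_ _ _ /(_ j)].
  by rewrite !coordE eqxx addrC subr_ge0 nj.
rewrite raise_monomial ?addrA ?subrr ?add0r ?monomial_pair // => k.
rewrite !coordE; case: eqVneq => [->|_]; last by rewrite oppr0 add0r.
by rewrite addrC subr_ge0.
Qed.

Lemma lower_raise j p : lower_op j (raise_op j << p >>) =
  if pair (val p).1 (basis_vec j) == 0 then << p >> else 0.
Proof.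
have /cone_pairP[mM mK nN nK mn0] := pair_spec p.
rewrite -{1}monomial_pair raise_monomial //.
have [mj|mj] := eqVneq; last first.
  rewrite monomial0 ?linear0 //; apply/negP => /cone_pairP[_ _ _ _ /(_ j)/eqP].
  by rewrite coordD basis_vecE eqxx mulf_eq0 (negPf mj) paddr_eq0 ?oner_eq0.
rewrite [LHS]monomial_mulE ?add0r ?addrA ?addNr ?add0r ?monomial_pair // => _.
apply/cone_pairP; split=> // [|k|k]; first exact: Nadd.
  by rewrite coordD basis_vecE addr_ge0.
rewrite coordD basis_vecE mulrDr mn0 addr0.
by case: eqVneq => [->|_]; rewrite ?mulr0 // mj mul0r.
Qed.

End ConeAlgebra.

(** * Reduced families *)

Section Retraction.
Variables (C : numFieldType) (d : nat) (A : 'M[nat]_d) (N : 'rV[rat]_d -> Prop).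
Hypothesis N0 : N 0.
Hypothesis Nadd : forall n j, N n -> N (basis_vec j + n).
Hypothesis Nsub : forall n j, N (basis_vec j + n) -> N n.
Hypothesis N_dual : forall i, dual_lattice A N (basis_vec i).
Local Notation V := (cone_algebra C A N).
Local Notation family := {ffun {set 'I_d} -> V}.
Local Notation pair := (pairing A).
Local Notation mono := (monomial C A N).
Local Notation row_op := (row_op C A N).
Local Notation raise_op := (raise_op C A N).
Local Notation lower_op := (lower_op C A N).
Implicit Types (m n : 'rV[rat]_d) (p : cone_pair A N) (j k : 'I_d).
Implicit Types (I : {set 'I_d}) (z w : family).

Local Notation family_diff := (koszul_diff row_op raise_op).
Local Notation lowering := (contract_by lower_op).
Local Notation laplacian := (laplacian row_op raise_op lower_op).
Local Notation count_op := (count_op raise_op lower_op).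

(** The index [j] is bad for [[m ⊕ n] ⊗ v_I] when the vector is of the form
    [[v_j] v_j ∧ b], or is not killed by [[v_j] v_j ∧]. These two kinds of vectors
    are paired by that operator, so that only vectors without bad indices
    survive in cohomology. *)
Definition bad I p j :=
  if j \in I then 1 <= (val p).2 0 j else pair (val p).1 (basis_vec j) == 0.
Definition bad_count I p : nat := \sum_j bad I p j.
Definition good I p := forall j, ~~ bad I p j.
Definition reduced z := forall I, supported_in (good I) (z I).
Definition weight p : rat := \sum_j (val p).2 0 j.
Definition weight_below (b : nat) z :=
  forall I, supported_in (fun p => weight p < b%:R) (z I).

Lemma goodP I p : bad_count I p = 0%N -> good I p.
Proof.
move/eqP; rewrite sum_nat_eq0 => /forallP bad0 j.
by have := bad0 j; case: (bad I p j).
Qed.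

Lemma family_diff_sq z : family_diff (family_diff z) = 0.
Proof.
apply: koszul_diff_sq => *.
- exact: row_opC.
- exact: raise_opC.
- exact: row_raiseC.
- exact: row_raise0.
Qed.

Lemma supported_in_vanish (P : cone_pair A N -> Prop) (U : lmodType C)
    (L : {linear V -> U}) v :
  (forall p, P p -> L << p >> = 0) -> supported_in P v -> L v = 0.
Proof.
move=> PL; apply: (@supported_in_ind _ _ P U (fun u => u = 0) L) => //.
by move=> a x y -> ->; rewrite scaler0 addr0.
Qed.

Lemma supported_in_map (P Q : cone_pair A N -> Prop) (L : {linear V -> V}) v :
  (forall p, P p -> supported_in Q (L << p >>)) -> supported_in P v ->
  supported_in Q (L v).
Proof.
move=> PL; apply: (@supported_in_ind _ _ P V (supported_in Q) L) => //.
  exact: supported_in0.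
exact: supported_inP.
Qed.

Lemma supported_in_monomial (P : cone_pair A N -> Prop) m n :
  (forall p, val p = (m, n) -> P p) -> supported_in P (mono m n).
Proof.
move=> Pmn; case: monomialP => [p /Pmn|_]; last exact: supported_in0.
exact: supported_inU.
Qed.

Lemma reduced_wedge0 z : reduced z -> wedge_by raise_op z = 0.
Proof.
move=> zE; apply/ffunP => I; rewrite !ffunE big1 // => j jI.
rewrite (supported_in_vanish _ (zE (I :\ j))) ?scaler0 // => p /(_ j).
rewrite /bad !inE eqxx /= => mj.
have /cone_pairP[mM mK nN nK mn0] := pair_spec p.
rewrite -monomial_pair raise_monomial // monomial0 //.
apply/negP => /cone_pairP[_ _ _ _ /(_ j)/eqP].
by rewrite coordD basis_vecE eqxx mulf_eq0 (negPf mj) paddr_eq0 ?oner_eq0.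
Qed.

Lemma reduced_lowering0 z : reduced z -> lowering z = 0.
Proof.
move=> zE; apply/ffunP => I; rewrite !ffunE big1 // => j jI.
rewrite (supported_in_vanish _ (zE (j |: I))) ?scaler0 // => p /(_ j).
rewrite /bad setU11 => nj; rewrite [LHS]monomial_mulU monomial0 //.
apply/negP => /cone_pairP[_ _ _ /(_ j)].
by rewrite !coordE eqxx addrC subr_ge0 (negPf nj).
Qed.

Lemma reduced_row z : reduced z -> reduced (contract_by row_op z).
Proof.
move=> zE I; rewrite ffunE; apply: supported_in_sum => j jI.
apply: supported_inZ; apply: supported_in_map (zE (j |: I)) => p pI.
have /cone_pairP[mM mK nN nK mn0] := pair_spec p.
rewrite -monomial_pair row_monomial //; apply: supported_in_sum => i _.
have [->|Aij] := eqVneq (A i j) 0%N; first by rewrite scale0r; exact: supported_in0.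
apply: supported_inZ; apply: supported_in_monomial => q qE k.
have := pI k; rewrite /bad qE in_setU1 /=; case: (k \in I); rewrite ?orbT // orbF.
rewrite pairingDl pairing_basis paddr_eq0 // negb_and.
case: eqVneq => [-> _|_ ->]; last by rewrite orbT.
by rewrite pnatr_eq0 (negPf Aij).
Qed.

Lemma reduced_diffE z : reduced z -> family_diff z = contract_by row_op z.
Proof. by move=> zE; rewrite /koszul_diff reduced_wedge0 // addr0. Qed.

(** On reduced families the homotopy and the wedge half of the differential both
    vanish, and the contraction half preserves them. *)
Lemma reduced_laplacian0 z : reduced z -> laplacian z = 0.
Proof.
move=> zE; rewrite /laplacian.
rewrite (reduced_lowering0 zE) linear0 add0r reduced_diffE //.
exact/reduced_lowering0/reduced_row.
Qed.

Lemma coeff_raise_lower j p v :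
  coeff p (raise_op j (lower_op j v)) = (1 <= (val p).2 0 j)%R%:R * coeff p v.
Proof.
apply: (coeff_diagonal (L := raise_op j \o lower_op j)
  (c := fun q => (1 <= (val q).2 0 j)%R%:R)) => q /=.
by rewrite raise_lower //; case: ifP; rewrite ?scale1r ?scale0r.
Qed.

Lemma coeff_lower_raise j p v : coeff p (lower_op j (raise_op j v)) =
  (pair (val p).1 (basis_vec j) == 0)%R%:R * coeff p v.
Proof.
apply: (coeff_diagonal (L := lower_op j \o raise_op j)
  (c := fun q => (pair (val q).1 (basis_vec j) == 0)%R%:R)) => q /=.
by rewrite lower_raise //; case: ifP; rewrite ?scale1r ?scale0r.
Qed.

Lemma coeff_sum (J : finType) (Q : pred J) p (F : J -> V) :
  coeff p (\sum_(j | Q j) F j) = \sum_(j | Q j) coeff p (F j).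
Proof. exact: raddf_sum. Qed.

(** The Clifford relation for [raise_op] and [lower_op]: each of the two orders
    of composition acts on basis vectors by 0 or 1, and together they test for
    badness. *)
Lemma coeff_count z I p :
  coeff p (count_op z I) = (bad_count I p)%:R * coeff p (z I).
Proof.
rewrite /count_op addrC ffunE contract_wedge_by => [|j k v]; last first.
  exact: lower_raiseC.
rewrite coeffD !coeff_sum.
under eq_bigr do rewrite coeff_lower_raise.
under [X in _ + X]eq_bigr do rewrite coeff_raise_lower.
rewrite -!mulr_suml -mulrDl /bad_count natr_sum; congr (_ * _).
rewrite [RHS](bigID (fun j => j \notin I)) /=.
congr (_ + _); apply: eq_big => j; rewrite ?negbK // => jI.
  by rewrite /bad (negPf jI).
by rewrite /bad jI.
Qed.

Lemma weight_below_P b a x y :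
  weight_below b x -> weight_below b y -> weight_below b (a *: x + y).
Proof. by move=> xb yb I; rewrite !ffunE; apply: supported_inP. Qed.

Lemma weight_below_row b z : weight_below b z -> weight_below b (contract_by row_op z).
Proof.
move=> zb I; rewrite ffunE; apply: supported_in_sum => j _; apply: supported_inZ.
apply: supported_in_map (zb _) => p pb.
have /cone_pairP[mM mK nN nK mn0] := pair_spec p.
rewrite -monomial_pair row_monomial //; apply: supported_in_sum => i _.
by apply: supported_inZ; apply: supported_in_monomial => q qE; rewrite /weight qE.
Qed.

Lemma weight_below_lowering b z : weight_below b.+1 z -> weight_below b (lowering z).
Proof.
move=> zb I; rewrite ffunE; apply: supported_in_sum => j _; apply: supported_inZ.
apply: supported_in_map (zb _) => p pb; rewrite [lower_op _ _]monomial_mulU.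
apply: supported_in_monomial => q qE; rewrite /weight qE /=.
under eq_bigr do rewrite coordD coordN basis_vecE.
rewrite big_split /= -/(weight p) sumrN (bigD1 j) //= eqxx big1 ?addr0.
  by rewrite mulr1n addrC ltrBlDr natr1.
by move=> k /negPf->.
Qed.

Lemma weight_below_count b z : weight_below b z -> weight_below b (count_op z).
Proof.
move=> zb I p; rewrite coeff_count mulf_eq0 negb_or => /andP[_]; exact: zb.
Qed.

Lemma weight_below_leq a b z : (a <= b)%N -> weight_below a z -> weight_below b z.
Proof.
move=> ab za I; apply: sub_supported_in (za I) => p pa.
by apply: lt_le_trans pa _; rewrite ler_nat.
Qed.

Lemma weight_below0 z : weight_below 0 z -> z = 0.
Proof.
move=> z0; apply/ffunP => I; rewrite [RHS]ffunE; apply/eqP/freeg_eqP => p.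
rewrite coeff0; apply/eqP/negP => /negP/z0.
have /cone_pairP[mM mK nN nK mn0] := pair_spec p.
by rewrite ltNge sumr_ge0.
Qed.

Lemma weight_bounded z : exists b, weight_below b z.
Proof.
exists (\sum_I \sum_(p <- dom (z I)) (Num.truncn (weight p)).+1)%N => I p pI.
apply: lt_le_trans (truncnS_gt _) _; rewrite ler_nat (bigD1 I) //=.
apply: leq_trans (leq_addr _ _).
by rewrite (big_rem p) ?mem_dom //= leq_addr.
Qed.

(** What the laplacian has besides its diagonal part involves [lower_op] once and
    [row_op], which keeps [n] fixed; it lowers the weight by one. *)
Lemma weight_below_laplacian b z : weight_below b.+1 z ->
  weight_below b (laplacian z - count_op z).
Proof.
move=> zb; rewrite laplacian_count -[contract_by _ _]scale1r; apply: weight_below_P.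
  exact/weight_below_row/weight_below_lowering.
exact/weight_below_lowering/weight_below_row.
Qed.

End Retraction.

(** * Reduction of cocycles and coboundaries *)

Section Deformation.
Variables (C : numFieldType) (d : nat) (A : 'M[nat]_d) (N : 'rV[rat]_d -> Prop).
Hypothesis N0 : N 0.
Hypothesis Nadd : forall n j, N n -> N (basis_vec j + n).
Hypothesis Nsub : forall n j, N (basis_vec j + n) -> N n.
Hypothesis N_dual : forall i, dual_lattice A N (basis_vec i).
Local Notation V := (cone_algebra C A N).
Local Notation family := {ffun {set 'I_d} -> V}.
Local Notation X := (row_op C A N).
Local Notation Y := (raise_op C A N).
Local Notation Z := (lower_op C A N).
Local Notation D := (koszul_diff X Y).
Local Notation lap := (laplacian X Y Z).
Local Notation deform := (deform X Y Z).
Implicit Types (z w : family) (cs : seq nat).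

Lemma deformD cs z : deform cs (D z) = D (deform cs z).
Proof.
by apply: deform_diff => *; [exact: row_opC | exact: raise_opC | exact: row_raiseC
  | exact: row_raise0].
Qed.

Lemma cohomotopy cs z : D z = 0 -> exists w, deform cs z = z + D w.
Proof.
by apply: deform_cocycle => *; [exact: row_opC | exact: raise_opC
  | exact: row_raiseC | exact: row_raise0].
Qed.

Lemma deform_reduced cs z : reduced z -> deform cs z = z.
Proof.
move=> zE; elim: cs => [//|c cs IH]; rewrite deform_cons IH /damp.
by rewrite reduced_laplacian0 // scaler0 subr0.
Qed.

(** Up to terms of lower weight the deformation acts diagonally, with the
    eigenvalue [∏_c (1 - k / c)] on vectors with [k] bad indices. *)
Lemma coeff_deform cs b z : weight_below b.+1 z ->
  weight_below b.+1 (deform cs z) /\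
  exists2 r : family, weight_below b (deform cs z - r) &
    forall I p, coeff p (r I) =
      \prod_(c <- cs) (1 - c%:R^-1 * (bad_count I p)%:R) * coeff p (z I).
Proof.
move=> zb; elim: cs => [|c cs [IHb [r rb rE]]].
  split=> //; exists z => [|I p]; last by rewrite big_nil mul1r.
  by rewrite subrr => I; rewrite ffunE; apply: supported_in0.
have Nr : weight_below b.+1 (lap (deform cs z)).
  rewrite -[lap _](subrK (count_op Y Z (deform cs z))) -[_ - _]scale1r.
  apply: weight_below_P; last exact: weight_below_count.
  exact/(weight_below_leq (leqnSn b))/weight_below_laplacian.
rewrite !deform_cons; split.
  by rewrite /damp addrC -scaleNr; apply: weight_below_P.
exists (r - c%:R^-1 *: count_op Y Z r) => [|I p]; last first.
  rewrite big_cons -mulrA -rE family_subZ coeffD coeffN coeffZ coeff_count //.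
  by rewrite mulrBl mul1r !mulrA.
rewrite damp_subE; apply: weight_below_P; first exact: weight_below_laplacian.
by apply: weight_below_P; [exact: weight_below_count | exact: rb].
Qed.

(** A vector has at most [d] bad indices, so the product over [c = 1, .., d] of
    the factors [1 - k / c] is zero unless [k = 0]. *)
Lemma deform_step b z : weight_below b.+1 z -> exists e r : family,
  [/\ deform (iota 1 d) z = e + r, reduced e & weight_below b r].
Proof.
move=> zb; have [_ [e rb eE]] := coeff_deform (iota 1 d) zb.
exists e, (deform (iota 1 d) z - e); split=> //; first by rewrite addrC subrK.
move=> I p; rewrite eE mulf_eq0 negb_or => /andP[cnt _]; apply: goodP.
apply/eqP; apply: contraNT cnt => cnt0; rewrite prodf_seq_eq0; apply/hasP.
exists (bad_count I p); last by rewrite mulVf ?subrr ?eqxx // pnatr_eq0.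
rewrite mem_iota lt0n cnt0 add1n ltnS /bad_count.
rewrite -[leqRHS]card_ord -sum1_card; apply: leq_sum => j _.
by case: bad.
Qed.

Lemma deform_iter_reduced b e z : reduced e -> weight_below b z ->
  reduced (iter b (deform (iota 1 d)) (e + z)).
Proof.
elim: b e z => [|b IH] e z eE zb; first by rewrite (weight_below0 zb) addr0.
have [e' [z' [zE e'E z'b]]] := deform_step zb.
rewrite iterSr linearD /= deform_reduced // zE addrA; apply: IH => // I.
by rewrite ffunE; apply: supported_inD.
Qed.

(** The deformation, iterated until the weight is exhausted, makes a cocycle
    reduced within its cohomology class; it fixes reduced families and commutes
    with the differential, so it also makes a primitive of a reduced coboundary
    reduced. *)
Theorem cocycle_reduction z : D z = 0 -> exists z' w : family,
  reduced z' /\ z' = z + D w.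
Proof.
move=> Dz; have [b zb] := weight_bounded z.
have E0 : reduced (0 : family) by move=> I; rewrite ffunE; apply: supported_in0.
have := deform_iter_reduced E0 zb; rewrite add0r => zE.
suff [w ww] : exists w : family, iter b (deform (iota 1 d)) z = z + D w.
  by exists (iter b (deform (iota 1 d)) z), w.
elim: (b) => [|c [w IH]] /=; first by exists 0; rewrite linear0 addr0.
have [|w' w'E] := @cohomotopy (iota 1 d) (z + D w).
  by rewrite (linearD D) /= Dz add0r; exact: family_diff_sq.
by exists (w + w'); rewrite IH w'E (linearD D) /= [RHS]addrA.
Qed.

Theorem coboundary_reduction z w : reduced z -> z = D w ->
  exists2 w' : family, reduced w' & z = D w'.
Proof.
move=> zE zw; have [b wb] := weight_bounded w.
have E0 : reduced (0 : family) by move=> I; rewrite ffunE; apply: supported_in0.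
have := deform_iter_reduced E0 wb; rewrite add0r => wE.
exists (iter b (deform (iota 1 d)) w) => //.
elim: (b) => //= c IH; rewrite -deformD -IH deform_reduced //.
Qed.

End Deformation.

(** * Polynomials and the part of the ring over a box point *)

Section BoxPoint.
Variables (C : numClosedFieldType) (d : nat) (A : 'M[nat]_d).
Variable N : 'rV[rat]_d -> Prop.
Hypothesis A_invertible : map_mx (fun k : nat => k%:R : rat) A \in unitmx.
Hypothesis N0 : N 0.
Hypothesis Nadd : forall n j, N n -> N (basis_vec j + n).
Hypothesis Nsub : forall n j, N (basis_vec j + n) -> N n.
Hypothesis N_dual : forall i, dual_lattice A N (basis_vec i).
Local Notation V := (cone_algebra C A N).
Local Notation poly := {mpoly C[d]}.
Local Notation pair := (pairing A).
Local Notation mono := (monomial C A N).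
Local Notation Aq := (map_mx (fun k : nat => k%:R : rat) A).
Implicit Types (m n : 'rV[rat]_d) (p : cone_pair A N) (i j k : 'I_d).
Implicit Types (e : 'X_{1..d}) (q : poly) (I : {set 'I_d}) (v : V).

Lemma pairing_mulmx m j : pair m (basis_vec j) = (m *m Aq) 0 j.
Proof.
rewrite [RHS]mxE /pairing; apply: eq_bigr => i _; rewrite (bigD1 j) //=.
rewrite basis_vecE eqxx mulr1 mxE big1 ?addr0 // => k kj.
by rewrite basis_vecE (negPf kj) mulr0.
Qed.

Lemma pairing_inj m m' :
  (forall j, pair m (basis_vec j) = pair m' (basis_vec j)) -> m = m'.
Proof.
move=> mm'; rewrite -[m](mulmxK A_invertible) -[m'](mulmxK A_invertible).
by congr (_ *m _); apply/rowP => j; rewrite -!pairing_mulmx.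
Qed.

(** The point [m] of the first lattice with [m . v_j = e_j] for all [j]; the
    monomial of [m] corresponds to [x^e]. *)
Definition mnm_vec e : 'rV[rat]_d := (\row_j (e j)%:R) *m invmx Aq.

Lemma pairing_mnm_vec e j : pair (mnm_vec e) (basis_vec j) = (e j)%:R.
Proof. by rewrite pairing_mulmx /mnm_vec mulmxKV // mxE. Qed.

Lemma mnm_vec_ge0 e j : 0 <= pair (mnm_vec e) (basis_vec j).
Proof. by rewrite pairing_mnm_vec. Qed.

Lemma mnm_vec_row i e : mnm_vec (row_mnm A i + e) = basis_vec i + mnm_vec e.
Proof.
apply: pairing_inj => j; rewrite pairingDl !pairing_mnm_vec pairing_basis.
by rewrite mnmDE mnmE natrD.
Qed.

Definition exponent p : 'X_{1..d} :=
  [multinom Num.truncn (pair (val p).1 (basis_vec j)) | j < d].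

Lemma exponentE p j : (exponent p j)%:R = pair (val p).1 (basis_vec j).
Proof.
have /cone_pairP[mM mK nN nK mn0] := pair_spec p.
rewrite mnmE; apply/eqP; rewrite -natrE natrEint mK andbT.
exact: (pairing_int N0 Nadd j mM).
Qed.

Lemma exponentK p : mnm_vec (exponent p) = (val p).1.
Proof. by apply: pairing_inj => j; rewrite pairing_mnm_vec exponentE. Qed.

Lemma exponent_mnm_vec p e n : val p = (mnm_vec e, n) -> exponent p = e.
Proof.
move=> pE; apply/mnmP => j; apply/eqP; rewrite -(eqr_nat rat) exponentE pE.
by rewrite pairing_mnm_vec.
Qed.

(** For fixed [n], [of_poly n] sends [x^e] to the monomial of [mnm_vec e] and
    [n]. It kills the monomials that do not come from the dual lattice, that is,
    are not invariant under the group, and those that involve a variable with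
    [n_j != 0], since their pairing with [n] is positive. *)
Definition of_poly n : {linear poly -> V} :=
  mpoly_lift (fun e => mono (mnm_vec e) n).
Definition to_poly n : {linear V -> poly} :=
  free_lift (fun p => if (val p).2 == n then 'X_[exponent p] else 0).

Lemma of_polyX n e : of_poly n 'X_[e] = mono (mnm_vec e) n.
Proof. exact: mpoly_liftX. Qed.

Lemma of_polyP n a q r : of_poly n (a *: q + r) = a *: of_poly n q + of_poly n r.
Proof. exact: linearP. Qed.

Lemma of_polyZ n a q : of_poly n (a *: q) = a *: of_poly n q.
Proof. exact: linearZ. Qed.

Lemma to_polyU n p :
  to_poly n << p >> = if (val p).2 == n then 'X_[exponent p] else 0.
Proof. by rewrite [LHS]free_liftU scale1r. Qed.

Lemma to_poly_monomial n n' e : to_poly n' (mono (mnm_vec e) n) =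
  if cone_pair_pred A N (mnm_vec e, n) && (n == n') then 'X_[e] else 0.
Proof.
case: monomialP => [p pE|/negPf->]; last by rewrite linear0.
by rewrite to_polyU (exponent_mnm_vec pE) -pE (valP p) pE.
Qed.

Lemma of_poly_supported n q : supported_in (fun p => (val p).2 = n) (of_poly n q).
Proof.
rewrite [q]mpolyE linear_sum /=; apply: supported_in_sum => e _.
rewrite linearZ /= of_polyX; apply: supported_inZ.
by apply: supported_in_monomial => p ->.
Qed.

Lemma to_of_poly0 n n' q : n != n' -> to_poly n' (of_poly n q) = 0.
Proof.
move=> nn'; apply: (supported_in_vanish _ (@of_poly_supported n q)) => p pn.
by rewrite to_polyU pn (negPf nn').
Qed.

Lemma to_of_polyX n e : to_poly n (of_poly n 'X_[e]) =
  if cone_pair_pred A N (mnm_vec e, n) then 'X_[e] else 0.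
Proof. by rewrite of_polyX to_poly_monomial eqxx andbT. Qed.

Lemma of_to_poly n v :
  supported_in (fun p => (val p).2 = n) v -> of_poly n (to_poly n v) = v.
Proof.
move=> vn; rewrite -[LHS]/((of_poly n \o to_poly n) v).
rewrite -[RHS]/((idfun : {linear V -> V}) v).
apply: freeg_linear_ext => p /vn pn /=.
by rewrite to_polyU pn eqxx of_polyX exponentK -pn monomial_pair.
Qed.

Variable n : 'rV[rat]_d.
Hypothesis n_box : forall j, 0 <= n 0 j < 1.
Definition box_zeros : {set 'I_d} := [set j | n 0 j == 0].
Local Notation F := box_zeros.
Local Notation f := (fun j => (potential_on C A F)^`M(j)).

Lemma box_ge0 j : 0 <= n 0 j. Proof. by case/andP: (n_box j). Qed.

Lemma box_pair0 p j : (val p).2 = n -> j \notin F -> exponent p j = 0%N.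
Proof.
move=> pn; rewrite inE => nj; have /cone_pairP[_ _ _ _ /(_ j)/eqP] := pair_spec p.
by rewrite pn mulf_eq0 (negPf nj) orbF -exponentE pnatr_eq0 => /eqP.
Qed.

Lemma cone_pair_row i e : cone_pair_pred A N (mnm_vec (row_mnm A i + e), n) =
  row_in A F i && cone_pair_pred A N (mnm_vec e, n).
Proof.
apply/idP/andP => [/cone_pairP[mM mK nN nK mn0]|[iF /cone_pairP[mM mK nN nK mn0]]].
  split.
    apply/row_inP => j; rewrite inE => nj; have /eqP := mn0 j.
    rewrite mulf_eq0 (negPf nj) orbF pairing_mnm_vec pnatr_eq0 mnmDE addn_eq0.
    by rewrite mnmE => /andP[/eqP].
  apply/cone_pairP; split=> //.
    by move: mM; rewrite mnm_vec_row => /dual_lattice_row; apply.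
    exact: mnm_vec_ge0.
  move=> j; have /eqP := mn0 j; rewrite !pairing_mnm_vec mulf_eq0 => /orP[|/eqP->].
    by rewrite pnatr_eq0 mnmDE addn_eq0 => /andP[_ /eqP->]; rewrite mul0r.
  by rewrite mulr0.
apply/cone_pairP; split=> //; first by rewrite mnm_vec_row; apply/dual_lattice_row.
  exact: mnm_vec_ge0.
move=> j; rewrite mnm_vec_row pairingDl mulrDl mn0 addr0 pairing_basis.
have [->|nj] := eqVneq (n 0 j) 0; first by rewrite mulr0.
by rewrite (row_inP _ _ _ iF) ?mul0r // inE.
Qed.

(** By Euler's formula [row_op j] is multiplication by [x_j ∂_j W]; the monomials
    of [W] that are not supported on the zeros of [n] vanish in the ring. *)
Lemma row_of_poly j q :
  row_op C A N j (of_poly n q) = of_poly n ('X_j * f j * q).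
Proof.
rewrite -[LHS]/((row_op C A N j \o of_poly n) q).
rewrite -[RHS]/((of_poly n \o (('X_j * f j) \*o idfun)) q).
apply: mpoly_linear_ext => e /=.
rewrite of_polyX row_monomial //; last exact: mnm_vec_ge0.
rewrite euler_potential_on mulr_suml linear_sum [RHS]big_mkcond; apply: eq_bigr => i _ /=.
rewrite -scalerAl linearZ /= -mpolyXD of_polyX -mnm_vec_row.
case: ifP => // /negbT ni; rewrite monomial0 ?scaler0 //.
by rewrite cone_pair_row (negPf ni).
Qed.

Lemma to_poly_row j v : to_poly n (row_op C A N j v) = 'X_j * f j * to_poly n v.
Proof.
rewrite -[LHS]/((to_poly n \o row_op C A N j) v).
rewrite -[RHS]/((('X_j * f j) \*o to_poly n) v).
apply: freeg_linear_ext => p _ /=.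
rewrite -[in LHS]monomial_pair row_monomial //; last first.
  by have /cone_pairP[] := pair_spec p.
rewrite linear_sum to_polyU /=; have pP : cone_pair_pred A N (mnm_vec (exponent p), (val p).2).
  by rewrite exponentK pair_spec.
case: eqP => [pn|/eqP pn]; last first.
  rewrite mulr0 big1 // => i _; rewrite linearZ /= -exponentK -mnm_vec_row.
  by rewrite to_poly_monomial (negPf pn) andbF scaler0.
rewrite euler_potential_on mulr_suml [RHS]big_mkcond; apply: eq_bigr => i _.
rewrite linearZ /= -exponentK -mnm_vec_row to_poly_monomial pn eqxx andbT.
rewrite pn in pP; rewrite cone_pair_row pP andbT; case: ifP; rewrite ?scaler0 // => _.
by rewrite mpolyXD scalerAl.
Qed.

Lemma raise_of_poly j q :
  j \in F -> raise_op C A N j (of_poly n ('X_j * q)) = 0.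
Proof.
move=> jF; rewrite -[LHS]/((raise_op C A N j \o (of_poly n \o ('X_j \*o idfun))) q).
rewrite -[RHS]/((\0 : {linear _ -> _}) q); apply: mpoly_linear_ext => e /=.
rewrite -mpolyXD of_polyX raise_monomial //; last exact: box_ge0.
rewrite monomial0 //; apply/negP => /cone_pairP[_ _ _ _ /(_ j)/eqP].
rewrite pairing_mnm_vec coordD basis_vecE eqxx mnmDE mnm1E eqxx mulf_eq0.
by rewrite pnatr_eq0 /= paddr_eq0 ?oner_eq0 // box_ge0.
Qed.

Lemma poly_in_lin (S : {set 'I_d}) a (x y : poly) :
  poly_in S x -> poly_in S y -> poly_in S (a *: x + y).
Proof.
move=> xS yS e eaxy j jS; have : e \in msupp x ++ msupp y.
  by move/msuppD_le: eaxy; rewrite !mem_cat => /orP[/msuppZ_le|] ->; rewrite ?orbT.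
by rewrite mem_cat => /orP[/xS|/yS]; apply.
Qed.

Lemma poly_in0 (S : {set 'I_d}) : poly_in S (0 : poly).
Proof. by move=> e; rewrite msupp0. Qed.

Lemma poly_inX (S : {set 'I_d}) e :
  (forall j, j \notin S -> e j = 0%N) -> poly_in S ('X_[e] : poly).
Proof. by move=> eS k /mem_msuppXP <-. Qed.

Lemma vars_prodX (S : {set 'I_d}) :
  vars_prod C S = 'X_[[multinom (j \in S : nat) | j < d]].
Proof.
rewrite mpolyXE_id /vars_prod big_mkcond; apply: eq_bigr => j _.
by rewrite mnmE; case: (j \in S).
Qed.

(** A vector without bad indices has [m . v_j != 0] for [j] outside [I], so its
    monomial is divisible by [x_j]. This divisibility is where the shift of the
    Milnor ring by the product of the variables comes from. *)
Lemma to_poly_good I v : supported_in (good I) v ->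
  exists2 z, poly_in F z & to_poly n v = vars_prod C (F :\: I) * z.
Proof.
apply: (@supported_in_ind _ _ (good I) _
  (fun u => exists2 z, poly_in F z & u = vars_prod C (F :\: I) * z)).
- by exists 0; [exact: poly_in0 | rewrite mulr0].
- move=> a x y [zx xF ->] [zy yF ->]; exists (a *: zx + zy); first exact: poly_in_lin.
  by rewrite mulrDr -scalerAr.
move=> p pI; rewrite to_polyU; case: eqP => [pn|_]; last first.
  by exists 0; [exact: poly_in0 | rewrite mulr0].
pose s : 'X_{1..d} := [multinom (j \in F :\: I : nat) | j < d].
have sp : (s <= exponent p)%MM.
  apply/mnm_lepP => j; rewrite [s j]mnmE in_setD; case: andP => // -[jI _].
  by have := pI j; rewrite /bad (negPf jI) -exponentE pnatr_eq0 lt0n.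
exists 'X_[exponent p - s]; last by rewrite vars_prodX -mpolyXD addmC submK.
by apply: poly_inX => j jF; rewrite mnmBE box_pair0.
Qed.

Lemma to_poly_good0 I v : ~~ (~: F \subset I) -> supported_in (good I) v ->
  to_poly n v = 0.
Proof.
move=> /subsetPn[j]; rewrite !inE => nj jI; apply: supported_in_vanish => p pI.
rewrite to_polyU; case: eqP => // pn; have := pI j.
by rewrite /bad (negPf jI) -exponentE box_pair0 ?inE ?eqxx.
Qed.

Lemma of_poly_good I q : ~: F \subset I ->
  supported_in (good I) (of_poly n (vars_prod C (F :\: I) * q)).
Proof.
move=> FI; rewrite [q]mpolyE mulr_sumr linear_sum /=; apply: supported_in_sum => e _.
rewrite -scalerAr linearZ /= vars_prodX -mpolyXD of_polyX; apply: supported_inZ.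
apply: supported_in_monomial => p pE j; rewrite /bad pE /=.
case: ifP => [_|/negbT jI]; first by rewrite -ltNge; case/andP: (n_box j).
have jF : j \in F by apply: contraNT jI => jF; apply: (subsetP FI); rewrite inE.
by rewrite pairing_mnm_vec pnatr_eq0 mnmDE mnmE in_setD jI jF.
Qed.

End BoxPoint.

(** * Roots of unity *)

Section Expi.
Variable R : realType.
Implicit Types (t s : rat).
Local Notation expi := (@expi R).

Lemma expiD t s : expi (t + s) = expi t * expi s.
Proof.
rewrite /expi rmorphD mulrDr trigo.cosD trigo.sinD.
by apply/eqP; rewrite eq_complex /= eqxx addrC eqxx.
Qed.

Lemma expi0 : expi 0 = 1.
Proof. by rewrite /expi rmorph0 mulr0 trigo.cos0 trigo.sin0. Qed.

Lemma expi1 : expi 1 = 1.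
Proof.
by rewrite /expi rmorph1 mulr1 mulr_natl trigo.cos2pi trigo.sin2pi.
Qed.

Lemma expi_neq0 t : expi t != 0.
Proof.
apply/negP => /eqP e0; have := expiD t (- t).
by rewrite subrr expi0 e0 mul0r => /eqP; rewrite oner_eq0.
Qed.

Lemma expiN t : expi (- t) = (expi t)^-1.
Proof.
apply: (mulfI (expi_neq0 t)); rewrite -expiD subrr expi0 mulfV //.
exact: expi_neq0.
Qed.

Lemma expiMn t n : expi (t *+ n) = expi t ^+ n.
Proof.
by elim: n => [|n IH]; rewrite ?mulr0n ?expi0 ?expr0 // mulrS expiD IH exprS.
Qed.

Lemma expi_sum (I : Type) (r : seq I) (P : pred I) (F : I -> rat) :
  expi (\sum_(i <- r | P i) F i) = \prod_(i <- r | P i) expi (F i).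
Proof. exact: (big_morph expi expiD expi0). Qed.

Lemma expi_int (z : int) : expi z%:~R = 1.
Proof.
by case: z => n; rewrite ?NegzE ?mulrNz ?expiN expiMn expi1 expr1n ?invr1.
Qed.

(** [cos (2 u) = 1] forces [sin u = 0], while [sin] is positive on [(0, π)]. *)
Lemma expi_eq1_box t : 0 <= t < 1 -> expi t = 1 -> t = 0.
Proof.
move=> /andP[t0 t1] e1.
have c1 : trigo.cos (2 * trigo.pi * ratr t : R) = 1 by have [] := e1.
have half (x : R) : trigo.cos (2 * trigo.pi * x) = 1 -> trigo.sin (trigo.pi * x) = 0.
  move=> cx; have := trigo.cos_mulr2n (trigo.pi * x).
  rewrite -[in X in X = _]mulr_natl mulrA cx trigo.cos2sin2 => h.
  by apply/eqP; rewrite -sqrf_eq0; apply/eqP; lra.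
have := half _ c1.
apply: contra_eq => tn0; rewrite gt_eqF // trigo.sin_gt0_pi //.
have pi0 := trigo.pi_gt0 R.
rewrite mulr_gt0 //; last by rewrite ltr0q lt_neqAle eq_sym tn0.
by rewrite gtr_pMr // -(rmorph1 (ratr : rat -> R)) ltr_rat.
Qed.

Lemma expi_eq1 t : (expi t == 1) = (t \is a Num.int).
Proof.
apply/eqP/idP => [t1|/intrP[z ->]]; last exact: expi_int.
have -> : t = (Num.floor t)%:~R + (t - (Num.floor t)%:~R) by rewrite addrC subrK.
rewrite [t - _]expi_eq1_box ?addr0 ?intr_int //.
  by have := floor_itv t; rewrite subr_ge0 ltrBlDr intrD addrC.
by rewrite expiD expiN expi_int invr1 mulr1.
Qed.

Lemma expi_inj_box t s : 0 <= t < 1 -> 0 <= s < 1 -> expi t = expi s -> t = s.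
Proof.
move=> /andP[t0 t1] /andP[s0 s1] ts.
have : t - s \is a Num.int by rewrite -expi_eq1 expiD expiN ts mulfV ?expi_neq0.
move=> /intrP[z zE]; have : z = 0.
  have zl : (-1)%:~R < z%:~R :> rat by rewrite -zE; lra.
  have zu : z%:~R < 1%:~R :> rat by rewrite -zE; lra.
  by move: zl zu; rewrite !ltr_int; lia.
by move=> z0; move: zE; rewrite z0 => /eqP; rewrite subr_eq0 => /eqP.
Qed.

(** The [n] numbers [e^(2 π i k / n)] are distinct roots of [X^n - 1], which has
    no more than [n] of them. *)
Lemma root_of_unity_expi (x : R[i]) n : (0 < n)%N -> x ^+ n = 1 ->
  exists2 t, 0 <= t < 1 & expi t = x.
Proof.
move=> n0 xn.
pose rs := [seq expi (k%:R / n%:R) | k <- iota 0 n].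
have nq : (n%:R : rat) != 0 by rewrite pnatr_eq0 -lt0n.
have box k : (k < n)%N -> 0 <= (k%:R / n%:R : rat) < 1.
  by move=> kn; rewrite divr_ge0 // ltr_pdivrMr ?ltr0n // mul1r ltr_nat.
have rsu : uniq rs.
  rewrite map_inj_in_uniq ?iota_uniq // => k l; rewrite !mem_iota /= => kn ln.
  move/(expi_inj_box (box _ kn) (box _ ln)) => /(mulIf (invr_neq0 nq)) /eqP.
  by rewrite eqr_nat => /eqP.
have rsroot : all (root ('X^n - 1 : {poly R[i]})) rs.
  apply/allP => y /mapP[k _ ->]; rewrite rootE !hornerE -expiMn.
  have -> : (k%:R / n%:R : rat) *+ n = k%:~R by rewrite -[LHS]mulr_natr divfK.
  by rewrite expi_int subrr.
have [x_rs|x_rs] := boolP (x \in rs).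
  by move/mapP: x_rs => [k]; rewrite mem_iota => /box kb ->; exists (k%:R / n%:R).
have := @max_poly_roots _ ('X^n - 1 : {poly R[i]}) (x :: rs).
rewrite /= x_rs rsu rsroot rootE !hornerE xn subrr eqxx.
rewrite size_XnsubC // size_map size_iota ltnn => /(_ _ erefl erefl).
by rewrite -size_poly_eq0 size_XnsubC // => /(_ isT).
Qed.

End Expi.

(** * The group and its lattices *)

Section DiagonalGroup.
Variables (C : fieldType) (d : nat).
Implicit Types (g h : {ffun 'I_d -> C}) (e : 'X_{1..d}) (p : {mpoly C[d]}).

Definition diag_char g e : C := \prod_j g j ^+ e j.

Lemma diag_actX g e : diag_act g 'X_[e] = diag_char g e *: 'X_[e].
Proof.
rewrite /diag_act comp_mpolyX mpolyXE_id -scaler_prod; apply: eq_bigr => j _.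
by rewrite tnth_mktuple exprZn.
Qed.

Fact diag_act_linear g : linear (diag_act g).
Proof. by move=> a p q; rewrite /diag_act comp_mpolyD comp_mpolyZ. Qed.
HB.instance Definition _ g := GRing.isLinear.Build C {mpoly C[d]} {mpoly C[d]} _
  (diag_act g) (diag_act_linear g).

Definition diag_mul g h : {ffun 'I_d -> C} := [ffun j => g j * h j].

Lemma diag_char_mul g h e : diag_char (diag_mul g h) e = diag_char g e * diag_char h e.
Proof.
by rewrite /diag_char -big_split; apply: eq_bigr => j _; rewrite ffunE exprMn.
Qed.

Variable G : {fset {ffun 'I_d -> C}}.
Hypothesis G_subgroup : diag_subgroup G.
Hypothesis G_neq0 : forall g, g \in G -> forall j, g j != 0.

Lemma perm_diag_mul g : g \in G ->
  perm_eq [seq diag_mul g h | h <- enum_fset G] (enum_fset G).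
Proof.
move=> gG; have [_ Gmul _] := G_subgroup.
have inj : injective (diag_mul g).
  move=> h k /ffunP hk; apply/ffunP => j; apply: (mulfI (G_neq0 gG j)).
  by have := hk j; rewrite !ffunE.
apply: uniq_perm; rewrite ?map_inj_uniq ?fset_uniq //.
have sub : {subset [seq diag_mul g h | h <- enum_fset G] <= enum_fset G}.
  by move=> k /mapP[h hG ->]; apply: Gmul.
by have [||_] := uniq_min_size _ sub; rewrite ?size_map ?map_inj_uniq ?fset_uniq.
Qed.

(** Multiplication by [g] permutes [G], so it leaves the product of the [j]-th
    coordinates over [G] unchanged. *)
Lemma diag_finite_order g j : g \in G -> g j ^+ #|` G| = 1.
Proof.
move=> gG; have P0 : \prod_(h <- enum_fset G) h j != 0.
  by rewrite prodf_seq_neq0; apply/allP => h hG /=; apply: G_neq0.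
apply: (mulIf P0); rewrite mul1r -[RHS](perm_big _ (perm_diag_mul gG)) big_map /=.
rewrite [RHS](eq_bigr (fun h : {ffun 'I_d -> C} => g j * h j)) => [|h _]; last exact: ffunE.
by rewrite big_split /= big_const_seq count_predT iter_mulr_1.
Qed.

Lemma sum_diag_char e : \sum_(h <- enum_fset G) diag_char h e =
  if all (fun h => diag_char h e == 1) (enum_fset G) then #|` G|%:R else 0.
Proof.
case: ifP => [/allP all1|/negbT/allPn[g gG g1]].
  rewrite big_seq (eq_bigr (fun=> 1)) => [|h hG]; last exact/eqP/all1.
  by rewrite -big_seq big_const_seq count_predT iter_addr_0.
apply/eqP; have : (1 - diag_char g e) * \sum_(h <- enum_fset G) diag_char h e == 0.
  rewrite mulrBl mul1r subr_eq0; apply/eqP.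
  rewrite -[LHS](perm_big _ (perm_diag_mul gG)) big_map mulr_sumr /=.
  by apply: eq_bigr => h _; rewrite diag_char_mul.
by rewrite mulf_eq0 subr_eq0 eq_sym (negPf g1).
Qed.
End DiagonalGroup.

Lemma restricted_potentialE (C : numClosedFieldType) d (A : 'M[nat]_d)
  (g : {ffun 'I_d -> C}) :
  restricted_potential A g = potential_on C A (fixed_vars g).
Proof.
rewrite /restricted_potential potentialE linear_sum [RHS]big_mkcond.
apply: eq_bigr => i _; rewrite [LHS]comp_mpolyX.
case: ifP => [/row_inP iF|/negbT].
  rewrite mpolyXE_id; apply: eq_bigr => j _; rewrite tnth_mktuple mnmE.
  by case: ifP => // /negbT/iF->; rewrite !expr0.
rewrite negb_forall => /existsP[j]; rewrite negb_imply => /andP[jF Aij].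
by rewrite (bigD1 j) //= tnth_mktuple (negPf jF) mnmE expr0n (negPf Aij) mul0r.
Qed.

Section Lattice.
Variables (R : realType) (d : nat) (A : 'M[nat]_d) (G : {fset {ffun 'I_d -> R[i]}}).
Hypothesis A_invertible : map_mx (fun k : nat => k%:R : rat) A \in unitmx.
Hypothesis G_Aut : forall g, g \in G -> Aut_potential A g.
Hypothesis G_subgroup : diag_subgroup G.
Local Notation C := R[i].
Local Notation N := (lattice_N G).
Implicit Types (g h : {ffun 'I_d -> C}) (n : 'rV[rat]_d) (e : 'X_{1..d}).

Definition expi_point n : {ffun 'I_d -> C} := [ffun j => expi R (n 0 j)].

Lemma G_neq0 g : g \in G -> forall j, g j != 0.
Proof. by case/G_Aut. Qed.

Lemma row_mnm_inj : injective (row_mnm A).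
Proof.
move=> i k ik; have : basis_vec i = basis_vec k :> 'rV[rat]_d.
  apply: (pairing_inj A_invertible) => j; rewrite !pairing_basis.
  by move/mnmP: ik => /(_ j); rewrite !mnmE => ->.
move=> /rowP/(_ i); rewrite !basis_vecE eqxx.
by case: eqP => // _ /eqP; rewrite oner_eq0.
Qed.

(** The monomials of [W] are distinct, so each of them is invariant under the
    symmetries of [W]. *)
Lemma diag_char_row g i : g \in G -> diag_char g (row_mnm A i) = 1.
Proof.
case/G_Aut => _; rewrite potentialE linear_sum /=.
move/(congr1 (mcoeff (row_mnm A i))); rewrite !raddf_sum /=.
rewrite (bigD1 i) //= [in RHS](bigD1 i) //= diag_actX mcoeffZ mcoeffX eqxx mulr1.
rewrite !big1 ?addr0 // => k ki; last rewrite diag_actX mcoeffZ; rewrite mcoeffX;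
  by rewrite (inj_eq row_mnm_inj) (negPf ki) ?mulr0.
Qed.

Lemma expi_diag_char n e : expi R (\sum_j (e j)%:R * n 0 j) = diag_char (expi_point n) e.
Proof.
rewrite expi_sum; apply: eq_bigr => j _.
by rewrite mulr_natl expiMn ffunE.
Qed.

Lemma lattice_N0 : N 0.
Proof.
rewrite /lattice_N; have [G1 _ _] := G_subgroup.
suff -> : [ffun j => expi R ((0 : 'rV[rat]_d) 0 j)] = [ffun=> 1] by [].
by apply/ffunP => j; rewrite !ffunE mxE expi0.
Qed.

Lemma expi_point_basis n j : expi_point (basis_vec j + n) = expi_point n.
Proof.
apply/ffunP => k; rewrite !ffunE coordD basis_vecE expiD.
by case: (k == j); rewrite ?expi1 ?expi0 mul1r.
Qed.

Lemma lattice_Nadd n j : N n -> N (basis_vec j + n).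
Proof. by rewrite /lattice_N -!/(expi_point _) expi_point_basis. Qed.

Lemma lattice_Nsub n j : N (basis_vec j + n) -> N n.
Proof. by rewrite /lattice_N -!/(expi_point _) expi_point_basis. Qed.

Lemma lattice_N_dual i : dual_lattice A N (basis_vec i).
Proof.
move=> n nN; rewrite pairing_coord -(expi_eq1 R).
under eq_bigr do rewrite pairing_basis -[A i _](mnmE (fun j => A i j)).
by rewrite expi_diag_char -/(row_mnm A i) diag_char_row.
Qed.

Lemma box_point_exists g : g \in G -> exists n, box_point g n.
Proof.
move=> gG; have /choice[t tP] : forall j, exists t : rat, 0 <= t < 1 /\ expi R t = g j.
  move=> j; have G0 : (0 < #|` G|)%N by rewrite cardfs_gt0; apply/fset0Pn; exists g.
  have [t] := root_of_unity_expi G0 (diag_finite_order G_subgroup G_neq0 j gG).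
  by exists t.
by exists (\row_j t j) => j; rewrite mxE; apply: tP.
Qed.

Lemma box_point_uniq g n n' : box_point g n -> box_point g n' -> n = n'.
Proof.
move=> nb n'b; apply/rowP => j; have [bj ej] := nb j; have [b'j e'j] := n'b j.
by apply: (@expi_inj_box R); rewrite // ej.
Qed.

Lemma box_point_expi g n : box_point g n -> expi_point n = g.
Proof. by move=> nb; apply/ffunP => j; rewrite ffunE; case: (nb j). Qed.

Lemma box_point_zeros g n : box_point g n -> box_zeros n = fixed_vars g.
Proof.
move=> nb; apply/setP => j; have [bj ej] := nb j; rewrite !inE -ej.
apply/eqP/eqP => [->|]; [exact: expi0 | exact: expi_eq1_box].
Qed.

Lemma dual_lattice_mnm_vec e : dual_lattice A N (mnm_vec A e) <->
  forall g, g \in G -> diag_char g e = 1.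
Proof.
have E n : pairing A (mnm_vec A e) n = \sum_j (e j)%:R * n 0 j.
  by rewrite pairing_coord; apply: eq_bigr => j _; rewrite pairing_mnm_vec.
split=> [eM g gG|eG n nN]; last first.
  by rewrite -(expi_eq1 R) E expi_diag_char eG.
have [n nb] := box_point_exists gG; rewrite -(box_point_expi nb) -expi_diag_char.
apply/eqP; rewrite expi_eq1 -E; apply: eM.
by rewrite /lattice_N -/(expi_point n) (box_point_expi nb).
Qed.

(** If all the other variables of an invariant monomial [x_k y] are fixed by [g],
    then so is [x_k]. *)
Lemma fixed_vars_closed g i k : g \in G -> A i k = 1%N ->
  row_in A (k |: fixed_vars g) i -> k \in fixed_vars g.
Proof.
move=> gG ik /row_inP irow; have := diag_char_row i gG.
rewrite /diag_char (bigD1 k) //= mnmE ik expr1 big1 ?mulr1 => [gk|j jk].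
  by rewrite inE gk.
have [jF|jF] := boolP (j \in fixed_vars g).
  by move: jF; rewrite inE => /eqP->; rewrite expr1n.
by rewrite mnmE irow ?expr0 // !inE negb_or jk; rewrite inE in jF.
Qed.

End Lattice.

(** * The complex as a space of families *)

Section FamilyModel.
Variables (K : fieldType) (d : nat) (V : lmodType K).
Local Notation family := {ffun {set 'I_d} -> V}.
Implicit Types (v : V) (w : ext K d) (z : family) (I J : {set 'I_d}).

Definition ext_basis J : ext K d := [ffun I : {set 'I_d} => (I == J)%:R].
Definition single J v : family := [ffun I : {set 'I_d} => if I == J then v else 0].
Definition ext_scale v w : family := [ffun I : {set 'I_d} => w I *: v].

Definition to_family : tensor V (ext K d) -> family := tensor_lift ext_scale.

Lemma ext_scale_linearl a v v' w :
  ext_scale (a *: v + v') w = a *: ext_scale v w + ext_scale v' w.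
Proof. by apply/ffunP => I; rewrite !ffunE scalerDr !scalerA mulrC. Qed.

Lemma ext_scale_linearr a v w w' :
  ext_scale v (a *: w + w') = a *: ext_scale v w + ext_scale v w'.
Proof. by apply/ffunP => I; rewrite !ffunE scalerDl scalerA. Qed.

HB.instance Definition _ := GRing.isLinear.Build K (tensor V (ext K d)) family _
  to_family (tensor_lift_linear ext_scale_linearl ext_scale_linearr).

Lemma to_familyE v w : to_family (tens v w) = ext_scale v w.
Proof. exact: (tensor_liftE ext_scale_linearl ext_scale_linearr). Qed.

Lemma to_family_basis v J : to_family (tens v (ext_basis J)) = single J v.
Proof.
rewrite to_familyE; apply/ffunP => I; rewrite !ffunE.
by case: eqP; rewrite ?scale1r ?scale0r.
Qed.

Definition of_family z : tensor V (ext K d) := \sum_I tens (z I) (ext_basis I).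

Fact of_family_linear : linear of_family.
Proof.
move=> a x y; rewrite /of_family scaler_sumr -big_split; apply: eq_bigr => I _.
by rewrite !ffunE tensPl.
Qed.
HB.instance Definition _ := GRing.isLinear.Build K family (tensor V (ext K d)) _
  of_family of_family_linear.

Lemma ext_basisE w : w = \sum_I w I *: ext_basis I.
Proof.
apply/ffunP => I; rewrite sum_ffunE (bigD1 I) //= !ffunE eqxx big1 ?addr0.
  by rewrite [RHS]mulr1.
by move=> J JI; rewrite !ffunE eq_sym (negPf JI) scaler0.
Qed.

Lemma to_familyK : cancel to_family of_family.
Proof.
move=> x; rewrite -[LHS]/((of_family \o to_family) x).
rewrite -[RHS]/((idfun : {linear _ -> _}) x); apply: tensor_linear_ext => v w /=.
rewrite to_familyE /of_family [in RHS](ext_basisE w) tens_sumr.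
by apply: eq_bigr => I _; rewrite ffunE tensZl tensZr.
Qed.

Lemma of_familyK : cancel of_family to_family.
Proof.
move=> z; rewrite /of_family linear_sum /=; apply/ffunP => I.
rewrite sum_ffunE (bigD1 I) //= to_family_basis ffunE eqxx big1 ?addr0 // => J JI.
by rewrite to_family_basis ffunE eq_sym (negPf JI).
Qed.

Lemma of_family_sum (T : finType) (J : T -> {set 'I_d}) (v : T -> V) :
  of_family (\sum_t single (J t) (v t)) = \sum_t tens (v t) (ext_basis (J t)).
Proof.
rewrite linear_sum; apply: eq_bigr => t _ /=.
by rewrite -to_family_basis to_familyK.
Qed.

Lemma of_familyD (x y : family) : of_family (x + y) = of_family x + of_family y.
Proof. exact: linearD. Qed.

Lemma of_family0 : of_family 0 = 0.
Proof. exact: linear0. Qed.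

Lemma to_family0 : to_family 0 = 0.
Proof. exact: linear0. Qed.

End FamilyModel.

Section DifferentialModel.
Variables (C : numFieldType) (d : nat) (A : 'M[nat]_d) (N : 'rV[rat]_d -> Prop).

Lemma diff_B_tens v w : diff_B C A N (tens v w) =
  \sum_i tens (monomial_mul C A N (basis_vec i) 0 v)
     (contract (fun j => ratr (pairing A (basis_vec i) (basis_vec j))) w) +
  \sum_j tens (monomial_mul C A N 0 (basis_vec j) v)
     (wedge (fun k => ratr (basis_vec j 0 k)) w).
Proof.
transitivity (\sum_i tens_map (monomial_mul C A N (basis_vec i) 0)
    (contract (fun j => ratr (pairing A (basis_vec i) (basis_vec j)))) (tens v w) +
  \sum_j tens_map (monomial_mul C A N 0 (basis_vec j))
    (wedge (fun k => ratr (basis_vec j 0 k))) (tens v w)); first by [].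
by congr (_ + _); apply: eq_bigr => i _; exact: tens_mapE.
Qed.

Lemma to_family_diff (x : complex_B C A N) : to_family (diff_B C A N x) =
  koszul_diff (row_op C A N) (raise_op C A N) (to_family x).
Proof.
rewrite -[LHS]/((@to_family C d (cone_algebra C A N) \o diff_B C A N) x).
rewrite -[RHS]/((koszul_diff (row_op C A N) (raise_op C A N) \o
  @to_family C d (cone_algebra C A N)) x).
apply: tensor_linear_ext => v w.
rewrite -[LHS]/(to_family (diff_B C A N (tens v w))).
rewrite -[RHS]/(koszul_diff _ _ (to_family (tens v w))).
rewrite diff_B_tens linearD !linear_sum /= to_familyE /koszul_diff; congr (_ + _).
  under eq_bigr do rewrite to_familyE.
  apply/ffunP => I; rewrite sum_ffunE !ffunE.
  under eq_bigr do rewrite !ffunE scaler_suml.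
  rewrite exchange_big; apply: eq_bigr => j jI /=.
  rewrite ffunE linearZ /= scalerA row_opE scaler_sumr; apply: eq_bigr => i _.
  rewrite pairing_basis ratr_nat scalerA; congr (_ *: _).
  by rewrite -mulrA mulrC.
under eq_bigr do rewrite to_familyE.
apply/ffunP => I; rewrite sum_ffunE !ffunE.
under eq_bigr do rewrite !ffunE scaler_suml.
rewrite exchange_big; apply: eq_bigr => j jI /=.
rewrite (bigD1 j) //= [X in _ + X]big1 ?addr0 => [|k kj]; last first.
  by rewrite basis_vecE eq_sym (negPf kj) rmorph0 !mul0r scale0r.
by rewrite basis_vecE eqxx rmorph1 mul1r ffunE linearZ scalerA.
Qed.

End DifferentialModel.

(** * Koszul complexes of the restricted potentials *)

Section BoxComplexes.
Variables (C : numClosedFieldType) (d : nat) (A : 'M[nat]_d).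
Variable N : 'rV[rat]_d -> Prop.
Hypothesis A_invertible : map_mx (fun k : nat => k%:R : rat) A \in unitmx.
Hypothesis W_smooth : smooth_away_from_origin (potential C A).
Hypothesis N0 : N 0.
Hypothesis Nadd : forall n j, N n -> N (basis_vec j + n).
Hypothesis Nsub : forall n j, N (basis_vec j + n) -> N n.
Hypothesis N_dual : forall i, dual_lattice A N (basis_vec i).
Local Notation V := (cone_algebra C A N).
Local Notation poly := {mpoly C[d]}.
Local Notation family := {ffun {set 'I_d} -> V}.
Local Notation X := (row_op C A N).
Local Notation Y := (raise_op C A N).
Local Notation D := (koszul_diff X Y).
Local Notation of_poly := (of_poly C A N).
Local Notation to_poly := (to_poly C A N).
Local Notation partials F := (fun j => (potential_on C A F)^`M(j)).
Implicit Types (I J F : {set 'I_d}) (w : {ffun {set 'I_d} -> poly}) (z : family).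

Lemma vars_prodD1 F I j : j \in F -> j \notin I ->
  vars_prod C (F :\: I) = 'X_j * vars_prod C (F :\: (j |: I)).
Proof.
move=> jF jI; rewrite /vars_prod (bigD1 j) /= ?inE ?jF ?jI //; congr (_ * _).
by apply: eq_bigl => k; rewrite !inE negb_or; case: eqP; rewrite ?andbF ?andbT.
Qed.

Lemma vars_prod_neq0 F : vars_prod C F != 0.
Proof. by rewrite vars_prodX -msupp_eq0 msuppX. Qed.

Section OneBoxPoint.
Variable n : 'rV[rat]_d.
Hypothesis n_box : forall j, 0 <= n 0 j < 1.
Local Notation F := (box_zeros n).
Local Notation f := (partials F).

(** The Koszul complex of the partial derivatives of the potential restricted to
    the zeros of [n], embedded in the complex: the coefficient at [v_I] is
    multiplied by the variables of [F] outside [I], so that [x_j ∂_j] turns into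
    [∂_j]. *)
Definition theta w : family :=
  [ffun I => of_poly n (vars_prod C (F :\: I) * w I)].

Fact theta_linear : linear theta.
Proof.
move=> a x y; apply/ffunP => I; rewrite !ffunE -linearP; congr (of_poly n _).
by rewrite mulrDr -scalerAr.
Qed.
HB.instance Definition _ :=
  GRing.isLinear.Build C {ffun {set 'I_d} -> poly} family _ theta theta_linear.

Lemma theta_diff w : (forall I, ~~ (~: F \subset I) -> w I = 0) ->
  D (theta w) = theta (contract_by (times f) w).
Proof.
move=> w0; apply/ffunP => I; rewrite [LHS]ffunE [X in _ + X]ffunE.
rewrite [X in _ + X]big1 ?addr0 => [|j jI]; last first.
  rewrite ffunE; have [jF|jF] := boolP (j \in F); last first.
    rewrite w0 ?mulr0 ?linear0 ?scaler0 //.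
    by apply/subsetPn; exists j; rewrite ?setD11 ?in_setC.
  rewrite (@vars_prodD1 _ _ j) ?setD11 // -mulrA raise_of_poly ?scaler0 //.
rewrite !ffunE mulr_sumr linear_sum; apply: eq_bigr => j jI /=.
rewrite ffunE row_of_poly // -scalerAr [in RHS]linearZ /=; congr (_ *: of_poly n _).
have [jF|jF] := boolP (j \in F); last first.
  by rewrite mderiv_potential_on0 // mulr0 !mul0r mulr0.
rewrite (@vars_prodD1 _ I j) //; ring.
Qed.

Lemma theta_reduced w : (forall I, ~~ (~: F \subset I) -> w I = 0) ->
  reduced (theta w).
Proof.
move=> w0 I; rewrite ffunE; have [FI|/w0->] := boolP (~: F \subset I).
  exact: of_poly_good.
by rewrite mulr0 linear0; apply: supported_in0.
Qed.

Lemma theta_single (q : poly) : theta (single (~: F) q) =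
  single (~: F) (of_poly n (vars_prod C F * q)).
Proof.
apply/ffunP => I; rewrite !ffunE; case: eqP => [->|_].
  by rewrite setDE setCK setIid.
by rewrite mulr0 linear0.
Qed.

Lemma contract_single (q : poly) :
  contract_by (times f) (single (~: F) q) = 0.
Proof.
apply/ffunP => I; rewrite !ffunE big1 // => j jI; rewrite ffunE.
case: eqP => [/setP/(_ j)|_]; last by rewrite linear0 scaler0.
rewrite setU11 in_setC => /esym jF.
by rewrite /= mderiv_potential_on0 // mul0r scaler0.
Qed.

Lemma single_cocycle (q : poly) :
  D (single (~: F) (of_poly n (vars_prod C F * q))) = 0.
Proof.
rewrite -theta_single theta_diff ?contract_single ?linear0 // => I.
by rewrite ffunE; case: eqP => // ->; rewrite subxx.
Qed.

Lemma single_reduced (q : poly) :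
  reduced (single (~: F) (of_poly n (vars_prod C F * q))).
Proof.
rewrite -theta_single; apply: theta_reduced => I.
by rewrite ffunE; case: eqP => // ->; rewrite subxx.
Qed.

(** The Koszul differential of [h v_j] is [h ∂_j W]. *)
Lemma jacobian_coboundary (h : poly) j : j \in F ->
  exists w : family,
    single (~: F) (of_poly n (vars_prod C F * (h * f j))) = D w.
Proof.
move=> jF; pose s : C := ext_sign C j (~: F).
pose w : {ffun {set 'I_d} -> poly} := single (j |: ~: F) (s *: h).
exists (theta w); rewrite theta_diff => [|I]; last first.
  by rewrite ffunE; case: eqP => // ->; rewrite subsetUr.
rewrite -theta_single; congr (theta _); apply/ffunP => I; rewrite !ffunE.
case: (eqVneq I (~: F)) => [->|IF]; last first.
  rewrite big1 // => k kI; rewrite ffunE; case: eqP => [E|_]; last first.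
    by rewrite linear0 scaler0.
  have kF : k \notin F.
    apply: contra IF => kF; have kj : k = j.
      by apply/eqP; move/setP/(_ k): E; rewrite setU11 in_setU1 in_setC kF orbF => /esym.
    by rewrite -(setU1K kI) E kj setU1K // in_setC jF.
  by rewrite /= mderiv_potential_on0 // mul0r scaler0.
rewrite (bigD1 j) ?in_setC ?negbK //= ffunE eqxx big1 ?addr0 => [|k /andP[kF kj]].
  by rewrite -scalerAr scalerA ext_sign_sq scale1r mulrC.
rewrite ffunE; case: eqP => [/setP/(_ k)|_]; last by rewrite mulr0 scaler0.
by rewrite setU11 in_setU1 (negPf kj) (negPf kF).
Qed.

Lemma to_of_vars_prod (q : poly) : exists2 q', poly_in F q' &
  to_poly n (of_poly n (vars_prod C F * q)) = vars_prod C F * q'.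
Proof.
have qgood := @of_poly_good C d A N A_invertible n n_box (~: F) q (subxx _).
have [q' q'F] := to_poly_good N0 Nadd n qgood.
by rewrite setDE setCK setIid => E; exists q'.
Qed.

End OneBoxPoint.

Variables (T : finType) (box : T -> 'rV[rat]_d).
Hypothesis box_inj : injective box.
Hypothesis box01 : forall t j, 0 <= box t 0 j < 1.
Hypothesis box_complete : forall n, N n -> (forall j, 0 <= n 0 j < 1) ->
  exists t, n = box t.
Hypothesis box_closed : forall t i k, A i k = 1%N ->
  row_in A (k |: box_zeros (box t)) i -> k \in box_zeros (box t).
Local Notation zeros t := (box_zeros (box t)).
Local Notation f t := (partials (zeros t)).

(** In a reduced vector [n_j < 1] for all [j]: if [j] is outside [I] then
    [m . v_j != 0], hence [n_j = 0]. So [n] is one of the box points. *)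
Lemma reduced_decomposition z I : reduced z ->
  z I = \sum_t of_poly (box t) (to_poly (box t) (z I)).
Proof.
move=> zE; pose L : {linear V -> V} :=
  lin_sum (fun t => of_poly (box t) \o to_poly (box t)).
rewrite -[LHS]/((idfun : {linear V -> V}) (z I)) -[RHS]/(L (z I)).
apply: freeg_linear_ext => p pI.
have /cone_pairP[mM mK nN nK mn0] := pair_spec p.
have [|t pt] := box_complete nN.
  move=> j; rewrite nK ltNge /=; have := zE I p pI j; rewrite /bad.
  case: ifP => // _ mj; move/eqP: (mn0 j); rewrite mulf_eq0 (negPf mj) /=.
  by move/eqP->; rewrite ler10.
rewrite -[LHS]/(<< p >>) -[RHS]/(\sum_t of_poly (box t) (to_poly (box t) << p >>)).
rewrite (bigD1 t) //= big1 ?addr0 => [|u ut].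
  by rewrite of_to_poly //; apply: supported_inU.
rewrite to_polyU pt (inj_eq box_inj) eq_sym (negPf ut); exact: linear0.
Qed.

Lemma reduced_quotients z t : reduced z -> exists w,
  [/\ forall I, to_poly (box t) (z I) = vars_prod C (zeros t :\: I) * w I,
      forall I, ~~ (~: zeros t \subset I) -> w I = 0 &
      forall I, poly_in (zeros t) (w I)].
Proof.
move=> zE; have /choice[w wP] : forall I, exists q,
    [/\ to_poly (box t) (z I) = vars_prod C (zeros t :\: I) * q,
        ~~ (~: zeros t \subset I) -> q = 0 & poly_in (zeros t) q].
  move=> I; have [FI|FI] := boolP (~: zeros t \subset I); last first.
    exists 0; split=> //; last exact: poly_in0.
    by rewrite mulr0 (to_poly_good0 _ _ FI).
  by have [q qF qE] := to_poly_good N0 Nadd (box t) (zE I); exists q.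
exists [ffun I => w I]; split=> I; rewrite ffunE; by have [] := wP I.
Qed.

Lemma to_poly_contract w z t :
    (forall I, to_poly (box t) (z I) = vars_prod C (zeros t :\: I) * w I) ->
  forall I, to_poly (box t) (contract_by X z I) =
    vars_prod C (zeros t :\: I) * contract_by (times (f t)) w I.
Proof.
move=> wE I; rewrite !ffunE linear_sum mulr_sumr; apply: eq_bigr => j jI.
rewrite linearZ_LR to_poly_row // wE -[RHS]scalerAr; congr (_ *: _) => /=.
have [jF|jF] := boolP (j \in zeros t); last first.
  by rewrite mderiv_potential_on0 // mulr0 !mul0r mulr0.
rewrite (@vars_prodD1 _ I j) //; ring.
Qed.

(** Over each box point a reduced cocycle is a Koszul cycle, hence a boundary
    outside the lowest degree, where [I] is the complement of the zeros of the
    box point. *)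
Theorem reduced_cocycle z : reduced z -> D z = 0 ->
  exists (q : T -> poly) (w : family),
  z = \sum_t single (~: zeros t)
        (of_poly (box t) (vars_prod C (zeros t) * q t)) + D w.
Proof.
move=> zE Dz0; have Dz : contract_by X z = 0.
  by rewrite -Dz0 /koszul_diff reduced_wedge0 // addr0.
have /choice[q_w q_wP] : forall t, exists qw : poly * {ffun {set 'I_d} -> poly},
    (forall I, ~~ (~: zeros t \subset I) -> qw.2 I = 0) /\
    forall I, of_poly (box t) (to_poly (box t) (z I)) =
      theta (box t) (single (~: zeros t) qw.1 +
        contract_by (times (f t)) qw.2) I.
  move=> t; have [u [uE u0 _]] := reduced_quotients t zE.
  have cycle I : contract_by (times (f t)) u I = 0.
    apply: (mulfI (vars_prod_neq0 (zeros t :\: I))).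
    by rewrite -(to_poly_contract uE) Dz ffunE linear0 mulr0.
  have [w wP] := koszul_potential_exact A_invertible W_smooth (@box_closed t) cycle.
  (* Coefficients at sets that miss an index outside [F] have no place in [theta]. *)
pose w' := [ffun I : {set 'I_d} => if ~: zeros t \subset I then w I else 0].
  have w'0 I : ~~ (~: zeros t \subset I) -> w' I = 0.
    by rewrite ffunE => /negPf->.
  exists (u (~: zeros t) - contract_by (times (f t)) w' (~: zeros t), w'); split=> // I.
  rewrite ffunE uE; congr (of_poly _ (_ * _)); rewrite /= [RHS]ffunE [X in X + _]ffunE.
  case: eqVneq => [->|IF]; first by rewrite subrK.
  rewrite add0r; have [FI|FI] := boolP (~: zeros t \subset I); last first.
    rewrite u0 // ffunE big1 // => j jI.
    have [jF|jF] := boolP (j \in zeros t); last first.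
      by rewrite /= mderiv_potential_on0 // mul0r scaler0.
    rewrite w'0 ?linear0 ?scaler0 //; apply: contra FI => /subsetP Fj.
    apply/subsetP => k kF; have := Fj k kF; rewrite in_setU1.
    by case: eqP kF => // ->; rewrite in_setC jF.
  rewrite wP; last first.
    have FIlt : (#|~: zeros t| < #|I|)%N.
      by apply: proper_card; rewrite properEneq eq_sym IF.
    by rewrite -[X in (X < _)%N](card_ord d) -(cardsC (zeros t)) addnC ltn_add2r.
  rewrite !ffunE; apply: eq_bigr => j jI; congr (_ *: (_ * _)).
  by rewrite ffunE (subset_trans FI) // subsetUr.
exists (fun t => (q_w t).1), (\sum_t theta (box t) (q_w t).2).
rewrite (linear_sum D) -big_split; apply/ffunP => I; rewrite sum_ffunE /=.
rewrite {1}reduced_decomposition //; apply: eq_bigr => t _.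
have [w0 ->] := q_wP t; rewrite theta_diff // -theta_single // -linearD.
by [].
Qed.

Theorem cocycle_normal_form z : D z = 0 ->
  exists (q : T -> poly) (w : family),
  z = \sum_t single (~: zeros t)
        (of_poly (box t) (vars_prod C (zeros t) * q t)) + D w.
Proof.
move=> Dz; have [z' [w [z'E zE]]] := cocycle_reduction Nadd Nsub N_dual Dz.
have Dz' : D z' = 0.
  by rewrite zE (linearD D) /= Dz add0r; exact: family_diff_sq.
have [q [w' qE]] := reduced_cocycle z'E Dz'.
exists q, (w' - w); rewrite (linearB D) /= addrA -qE zE.
by rewrite addrK.
Qed.

(** A primitive can be chosen reduced; in lowest degree its differential is a
    combination of the partial derivatives. *)
Theorem reduced_coboundary (q : T -> poly) (w : family) :
    \sum_t single (~: zeros t)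
      (of_poly (box t) (vars_prod C (zeros t) * q t)) = D w ->
  forall t, exists2 c : 'I_d -> poly, forall j, poly_in (zeros t) (c j) &
    to_poly (box t) (of_poly (box t) (vars_prod C (zeros t) * q t)) =
    \sum_(j in zeros t) vars_prod C (zeros t) * (c j * f t j).
Proof.
set z := \sum_t _ => zw t.
have zE : reduced z.
  move=> I; rewrite sum_ffunE; apply: supported_in_sum => u _.
  exact: single_reduced.
have [w' w'E] := coboundary_reduction Nadd Nsub N_dual zE zw.
rewrite /koszul_diff reduced_wedge0 // addr0 => zw'.
have [u [uE _ uF]] := reduced_quotients t w'E.
have := congr1 (fun x : family => to_poly (box t) (x (~: zeros t))) zw'.
rewrite (to_poly_contract uE) setDE setCK setIid sum_ffunE linear_sum /=.
rewrite (bigD1 t) //= ffunE eqxx big1 ?addr0 => [->|s st]; last first.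
  rewrite ffunE; case: eqP => _; last exact: linear0.
  by rewrite to_of_poly0 // (inj_eq box_inj).
exists (fun j => ext_sign C j (~: zeros t) *: u (j |: ~: zeros t)).
  move=> j; rewrite -[_ *: _]addr0; apply: poly_in_lin; [exact: uF | exact: poly_in0].
rewrite ffunE mulr_sumr; apply: eq_big => [j|j _]; first by rewrite in_setC negbK.
by rewrite -scalerAl; congr (_ * (_ *: _)); exact: mulrC.
Qed.

End BoxComplexes.

(** * Direct sums and one-dimensional twists *)

Lemma linear_into_subspace (K : fieldType) (V U : lmodType K) (S : submodule U)
  (L : {linear V -> U}) : (forall x, L x \in submod_mem S) ->
  exists L' : {linear V -> subspace S}, forall x, val (L' x) = L x.
Proof.
move=> LS; pose L' x : subspace S := Subspace (LS x).
have L'_linear : linear L'.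
  by move=> a x y; apply: val_inj; rewrite /= linearP.
pose packed := GRing.isLinear.Build K V (subspace S) _ L' L'_linear.
pose M : {linear V -> subspace S} := HB.pack L' packed.
by exists M.
Qed.

Lemma spanned_ind (K : fieldType) (V U : lmodType K) (X : V -> Prop)
  (L : {linear V -> U}) v :
  (forall x, X x -> L x = 0) -> v \in submod_mem (spanned X) -> L v = 0.
Proof.
move=> LX /asboolP[s sX ->]; rewrite linear_sum big_seq big1 // => p /sX/LX e.
by rewrite linearZ /= e scaler0.
Qed.

Section DirectSumInclusion.
Variables (K : fieldType) (I : finType) (V : I -> lmodType K).

Lemma dsum_inE i (v : V i) : dsum_in v i = v.
Proof. by rewrite ffunE; case: eqP => // e; rewrite eq_axiomK. Qed.

Lemma dsum_in_neq i j (v : V i) : i != j -> dsum_in v j = 0.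
Proof. by rewrite ffunE; case: eqP. Qed.

End DirectSumInclusion.

Section Twist.
Variables (C : fieldType) (d : nat) (g : {ffun 'I_d -> C}).
Local Notation F := (fixed_vars g).

Lemma ext_basis_twist : ext_basis C (~: F) \in submod_mem (ext_power C (~: F) #|~: F|).
Proof.
apply/forallP => I; rewrite ffunE; apply/implyP.
by case: (I =P ~: F) => [->|_]; rewrite ?subxx ?eqxx.
Qed.

Definition twist_gen : twist g := Subspace ext_basis_twist.

(** A subset of the complement of [F] with as many elements is all of it. *)
Lemma twistE (w : twist g) : val w = (val w (~: F)) *: ext_basis C (~: F).
Proof.
apply/ffunP => I; rewrite !ffunE; case: eqVneq => [->|IF]; first by rewrite [RHS]mulr1.
rewrite [RHS]mulr0; apply/eqP; apply: contraNT IF => wI.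
have /forallP/(_ I)/implyP/(_ wI)/andP[IF /eqP cI] := valP w.
by rewrite eqEcard IF cI leqnn.
Qed.

Lemma twist_gen_span (w : twist g) :
  exists c, w = c *: (twist_gen : GRing.Lmodule.sort (twist g)).
Proof. by exists (val w (~: F)); apply: val_inj; rewrite /= [LHS]twistE. Qed.

Lemma twist_one_dimensional : one_dimensional (twist g).
Proof.
exists twist_gen => [|w]; last exact: twist_gen_span.
apply/negP => /eqP/(congr1 val)/ffunP/(_ (~: F)); rewrite /= !ffunE eqxx.
by move/eqP; rewrite oner_eq0.
Qed.
End Twist.

(** * Cohomology as a direct sum of quotients *)

Section DirectSumOfTensors.
Variables (K : fieldType) (T : finType) (P U : lmodType K) (f : {linear U -> U}).
Variables (X : T -> P -> Prop) (W : T -> lmodType K) (om : forall t, W t).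
Local Notation S t := (spanned (X t)).
Variable M : forall t, submodule (quotient (S t)).
(** [psi t p w] is the cocycle attached to a representative [p] of a class in
    [M t] and to a vector [w] of the line [W t]; it is only required to be a
    cocycle for the representatives called nice. *)
Variable psi : forall t, P -> W t -> U.
Arguments psi : clear implicits.

Hypothesis psi_l : forall t a p q w,
  psi t (a *: p + q) w = a *: psi t p w + psi t q w.
Hypothesis psi_r : forall t a p w v,
  psi t p (a *: w + v) = a *: psi t p w + psi t p v.
Hypothesis om_gen : forall t (w : W t), exists c, w = c *: om t.
Hypothesis psi_rel : forall t p w, X t p -> exists y, psi t p w = f y.

Variable nice : T -> P -> Prop.
Hypothesis nice_repr : forall t c, c \in submod_mem (M t) ->
  exists2 p, nice t p & c = class_of (S t) p.
Hypothesis nice_cocycle : forall t p, nice t p -> f (psi t p (om t)) = 0.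
Hypothesis nice_injective : forall (p : T -> P) y, (forall t, nice t (p t)) ->
  \sum_t psi t (p t) (om t) = f y -> forall t, class_of (S t) (p t) = 0.
Hypothesis psi_surjective : forall z, f z = 0 ->
  exists (p : T -> P) y, (forall t, class_of (S t) (p t) \in submod_mem (M t)) /\
    z = \sum_t psi t (p t) (om t) + f y.

Local Notation cob := (coboundaries f).
Local Notation comp t := (tensor (subspace (M t)) (W t)).

Definition psi_class t w p : quotient cob := class_of cob (psi t p w).
Arguments psi_class : clear implicits.
Fact psi_class_linear t w : linear (psi_class t w).
Proof. by move=> a p q; rewrite /psi_class psi_l linearP. Qed.
Arguments psi_class_linear : clear implicits.
HB.instance Definition _ t w := GRing.isLinear.Build K P (quotient cob) _
  (psi_class t w) (psi_class_linear t w).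

Lemma psi_class_rel t w p : p \in submod_mem (S t) -> psi_class t w p = 0.
Proof.
apply: spanned_ind => q Xq; have [y yE] := psi_rel w Xq.
rewrite -[RHS](linear0 (class_of cob)); apply/class_eq; rewrite subr0.
by apply/asboolP; exists y.
Qed.

Definition component_map t (l : subspace (M t)) (w : W t) : quotient cob :=
  quotient_lift (psi_class t w) (val l).
Arguments component_map : clear implicits.

Lemma component_mapE t (l : subspace (M t)) (w : W t) p :
  val l = class_of (S t) p -> component_map t l w = class_of cob (psi t p w).
Proof.
move=> lp; rewrite /component_map lp quotient_liftE //; exact: psi_class_rel.
Qed.

Lemma component_map_l t a (l l' : subspace (M t)) (w : W t) :
  component_map t (a *: l + l') w =
  a *: component_map t l w + component_map t l' w.
Proof.
have lE (x : subspace (M t)) : val x = class_of (S t) (class_repr (val x)).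
  by rewrite class_reprK.
rewrite (component_mapE _ (lE l)) (component_mapE _ (lE l')).
rewrite (@component_mapE _ _ _ (a *: class_repr (val l) + class_repr (val l'))).
  by rewrite psi_l linearP.
by rewrite !linearP /= !class_reprK.
Qed.

Lemma component_map_r t a (l : subspace (M t)) (w w' : W t) :
  component_map t l (a *: w + w') =
  a *: component_map t l w + component_map t l w'.
Proof.
have lE : val l = class_of (S t) (class_repr (val l)) by rewrite class_reprK.
by rewrite !(component_mapE _ lE) psi_r linearP.
Qed.

Definition component_lift t : comp t -> quotient cob := tensor_lift (component_map t).
Arguments component_lift : clear implicits.
Fact component_lift_linear t : linear (component_lift t).
Proof. exact: (tensor_lift_linear (@component_map_l t) (@component_map_r t)). Qed.
Arguments component_lift_linear : clear implicits.
HB.instance Definition _ t := GRing.isLinear.Build K (comp t) (quotient cob) _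
  (component_lift t) (component_lift_linear t).

Lemma component_liftE t (l : subspace (M t)) (w : W t) :
  component_lift t (tens l w) = component_map t l w.
Proof. exact: (tensor_liftE (@component_map_l t) (@component_map_r t)). Qed.

Lemma tensor_om t (x : comp t) : exists l, x = tens l (om t).
Proof.
move: x; apply: tensor_ind => [|a v w x [l ->]]; first by exists 0; rewrite tens0l.
have [c ->] := om_gen w; exists ((a * c) *: v + l).
by rewrite tensPl tensZr scalerA.
Qed.

Definition total_map (x : dsum (fun t => comp t)) : quotient cob :=
  \sum_t component_lift t (x t).
Fact total_map_linear : linear total_map.
Proof.
move=> a x y; rewrite /total_map scaler_sumr -big_split; apply: eq_bigr => t _ /=.
by rewrite !ffunE linearP.
Qed.
HB.instance Definition _ := GRing.isLinear.Build K (dsum (fun t => comp t))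
  (quotient cob) _ total_map total_map_linear.

Lemma total_map_component t (y : comp t) :
  total_map (@dsum_in K T (fun t => comp t) t y) = component_lift t y.
Proof.
rewrite /total_map (bigD1 t) //= dsum_inE big1 ?addr0 // => u ut.
by rewrite dsum_in_neq ?linear0 // eq_sym.
Qed.

Lemma nice_component (x : dsum (fun t => comp t)) : exists p : T -> P,
  [/\ forall t, nice t (p t),
      forall t, exists2 l : subspace (M t), x t = tens l (om t) &
        val l = class_of (S t) (p t) &
      total_map x = class_of cob (\sum_t psi t (p t) (om t))].
Proof.
have /choice[p pP] : forall t, exists p, nice t p /\
    exists2 l : subspace (M t), x t = tens l (om t) & val l = class_of (S t) p.
  move=> t; have [l lE] := tensor_om (x t).
  have [p np pE] := nice_repr (valP l).
  by exists p; split=> //; exists l.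
exists p; split=> [t|t|]; try by have [] := pP t.
rewrite /total_map linear_sum; apply: eq_bigr => t _ /=.
have [_ [l lE pE]] := pP t.
by rewrite lE component_liftE (component_mapE _ pE).
Qed.

Lemma total_map_cocycle x : total_map x \in
  submod_mem (Submodule (cocycle_class_closed f)).
Proof.
have [p [np _ ->]] := nice_component x; apply/asboolP; eexists; last reflexivity.
by rewrite linear_sum big1 // => t _; apply: nice_cocycle.
Qed.

Lemma total_map_injective x : total_map x = 0 -> x = 0.
Proof.
have [p [np xE ->]] := nice_component x.
rewrite -(linear0 (class_of cob)) => /class_eq; rewrite subr0 => /asboolP[y yE].
apply/ffunP => t; have [l -> lE] := xE t; rewrite [RHS]ffunE.
have -> : l = 0; last exact: tens0l.
by apply: val_inj; rewrite lE (nice_injective np yE).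
Qed.

Lemma total_map_surjective (c : cohomology f) : exists x, total_map x = val c.
Proof.
have /asboolP[z fz ->] := valP c; have [p [y [pM zE]]] := psi_surjective fz.
pose l t : subspace (M t) := Subspace (pM t).
exists [ffun t => tens (l t) (om t)]; rewrite zE linearD /=.
rewrite [X in _ = _ + X](_ : _ = 0) ?addr0; last first.
  rewrite -[RHS](linear0 (class_of cob)); apply/class_eq; rewrite subr0.
  by apply/asboolP; exists y.
rewrite /total_map linear_sum; apply: eq_bigr => t _ /=.
by rewrite ffunE component_liftE (@component_mapE _ _ _ (p t)).
Qed.

(** The map is induced by [psi]. The modules [B] and [H] are given together with
    the maps into and out of them that the conclusion speaks of, so that one
    equation identifies both the module and these maps. *)
Theorem direct_sum_cohomology (B H : lmodType K)
    (incl : forall t, subspace (M t) -> W t -> B) (repr : H -> quotient cob) :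
    existT (fun B : lmodType K => forall t, subspace (M t) -> W t -> B) B incl =
      existT _ (dsum (fun t => comp t) : lmodType K)
        (fun t l w => @dsum_in K T (fun t => comp t) t (tens l w)) ->
    existT (fun H : lmodType K => H -> quotient cob) H repr =
      existT _ (subspace (Submodule (cocycle_class_closed f)) : lmodType K) val ->
  exists Phi : {linear B -> H}, bijective Phi /\
    forall t (l : subspace (M t)) (w : W t) p, val l = class_of (S t) p ->
      repr (Phi (incl t l w)) = class_of cob (psi t p w).
Proof.
set B0 := existT _ _ (fun t l w => dsum_in (tens l w)).
set H0 := existT _ (subspace (Submodule (cocycle_class_closed f)) : lmodType K) val.
suff: forall Bi Hr, Bi = B0 -> Hr = H0 ->
    exists Phi : {linear projT1 Bi -> projT1 Hr}, bijective Phi /\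
    forall t (l : subspace (M t)) (w : W t) p, val l = class_of (S t) p ->
      projT2 Hr (Phi (projT2 Bi t l w)) = class_of cob (psi t p w).
  by move=> iso BE HE; have := iso _ _ BE HE.
move=> _ _ -> ->; rewrite /B0 /H0 /=.
have [Phi PhiE] := linear_into_subspace total_map_cocycle.
exists Phi; split=> [|t l w p lE]; last first.
  rewrite PhiE; transitivity (component_lift t (tens l w)).
    exact: total_map_component.
  by rewrite component_liftE; apply: component_mapE.
have Phi_inj : injective Phi.
  move=> x y xy; apply/eqP; rewrite -subr_eq0; apply/eqP/total_map_injective.
  by rewrite linearB /= -!PhiE xy subrr.
have /choice[inv invP] : forall c, exists x, Phi x = c.
  move=> c; have [x xc] := total_map_surjective c.
  by exists x; apply: val_inj; rewrite PhiE; exact: xc.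
exists inv => x; last exact: invP.
by apply: (Phi_inj (inv (Phi x)) x); exact: invP.
Qed.

End DirectSumOfTensors.

(** * The isomorphism *)

Lemma jacobian_sum_mem (C : numClosedFieldType) d (A : 'M[nat]_d)
    (g : {ffun 'I_d -> C}) (c : 'I_d -> {mpoly C[d]}) :
    (forall j, poly_in (fixed_vars g) (c j)) ->
  \sum_(j in fixed_vars g) vars_prod C (fixed_vars g) *
    (c j * (potential_on C A (fixed_vars g))^`M(j)) \in
  submod_mem (shifted_jacobian A g).
Proof.
move=> cF; apply: rpred_sum => j jF; apply/asboolP.
exists [:: (1, vars_prod C (fixed_vars g) *
    (c j * (potential_on C A (fixed_vars g))^`M(j)))].
  move=> r; rewrite inE => /eqP->; exists (c j), j.
  by split; [exact: cF | exact: jF | rewrite restricted_potentialE].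
by rewrite big_seq1 scale1r.
Qed.

Lemma twisted_B_ring_dsum (C : fieldType) d (A : 'M[nat]_d)
    (G : {fset {ffun 'I_d -> C}}) :
  let M (g : G) := Submodule (milnor_inv_closed A G (val g)) in
  existT (fun B : lmodType C => forall g : G, subspace (M g) -> twist (val g) -> B)
    (twisted_B_ring A G)
    (fun g (l : milnor_inv A G (val g)) (w : twist (val g)) =>
      component_in (tens l w : twisted_component A g)) =
  existT _ (dsum (fun g : G => tensor (subspace (M g)) (twist (val g))) : lmodType C)
    (fun g l w => @dsum_in C G
      (fun g : G => tensor (subspace (M g)) (twist (val g))) g (tens l w)).
Proof. reflexivity. Qed.

Section Assembly.
Variables (C : numClosedFieldType) (d : nat) (A : 'M[nat]_d).
Variables (G : {fset {ffun 'I_d -> C}}) (N : 'rV[rat]_d -> Prop).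
Hypothesis A_invertible : map_mx (fun k : nat => k%:R : rat) A \in unitmx.
Hypothesis W_smooth : smooth_away_from_origin (potential C A).
Hypothesis G_subgroup : diag_subgroup G.
Hypothesis G_neq0 : forall g, g \in G -> forall j, g j != 0.
Hypothesis N0 : N 0.
Hypothesis Nadd : forall n j, N n -> N (basis_vec j + n).
Hypothesis Nsub : forall n j, N (basis_vec j + n) -> N n.
Hypothesis N_dual : forall i, dual_lattice A N (basis_vec i).
Hypothesis dual_char : forall e, dual_lattice A N (mnm_vec A e) <->
  forall g, g \in G -> diag_char g e = 1.
Variable box : G -> 'rV[rat]_d.
Hypothesis box_inj : injective box.
Hypothesis box_N : forall g, N (box g).
Hypothesis box_bound : forall g j, 0 <= box g 0 j < 1.
Hypothesis box_complete : forall n, N n -> (forall j, 0 <= n 0 j < 1) ->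
  exists g, n = box g.
Hypothesis box_fixed : forall g, box_zeros (box g) = fixed_vars (val g).
Hypothesis box_closed : forall g i k, A i k = 1%N ->
  row_in A (k |: box_zeros (box g)) i -> k \in box_zeros (box g).
Local Notation V := (cone_algebra C A N).
Local Notation poly := {mpoly C[d]}.
Local Notation family := {ffun {set 'I_d} -> V}.
Local Notation D := (koszul_diff (row_op C A N) (raise_op C A N)).
Local Notation CB := (diff_B C A N).
Local Notation of_poly := (of_poly C A N).
Local Notation to_poly := (to_poly C A N).
Local Notation sj g := (shifted_jacobian A (val g)).
Implicit Types (g : G) (p q : poly).

Lemma of_family_diff (z : family) :
  of_family (D z) = CB (of_family z) :> complex_B C A N.
Proof.
apply: (can_inj (@to_familyK _ _ _)).
by rewrite of_familyK to_family_diff of_familyK.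
Qed.

Lemma poly_in_vars_prod (F : {set 'I_d}) p : poly_in F p -> poly_in F (vars_prod C F * p).
Proof.
move=> pF; rewrite [p]mpolyE mulr_sumr big_seq.
elim/big_rec: _ => [|e x ep xF]; first exact: poly_in0.
rewrite -scalerAr; apply: poly_in_lin xF; rewrite vars_prodX -mpolyXD.
by apply: poly_inX => j jF; rewrite mnmDE mnmE (negPf jF) (pF e ep).
Qed.

Lemma diag_act_to_of h n p : h \in G ->
  diag_act h (to_poly n (of_poly n p)) = to_poly n (of_poly n p).
Proof.
move=> hG; pose L : {linear poly -> poly} := to_poly n \o of_poly n.
rewrite -[LHS]/((diag_act h \o L) p) -[RHS]/(L p).
apply: mpoly_linear_ext => e; rewrite -[LHS]/(diag_act h (to_poly n (of_poly n 'X_[e]))).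
rewrite -[RHS]/(to_poly n (of_poly n 'X_[e])).
rewrite (to_of_polyX _ A_invertible N0 Nadd).
case: ifP => [/cone_pairP[eM _ _ _ _]|_]; last exact: linear0.
have eG := (dual_char e).1 eM.
by rewrite diag_actX eG ?scale1r.
Qed.

(** Averaging over [G] keeps exactly the invariant monomials, and so does the
    passage to the ring of the cones and back. *)
Lemma reynolds g p : poly_in (fixed_vars (val g)) p ->
  \sum_(h <- enum_fset G) diag_act h p =
  #|` G|%:R *: to_poly (box g) (of_poly (box g) p).
Proof.
move=> pF; pose L : {linear poly -> poly} := to_poly (box g) \o of_poly (box g).
rewrite -[to_poly _ _]/(L p) [p]mpolyE (linear_sum L) scaler_sumr.
under eq_bigr do rewrite linear_sum.
rewrite exchange_big big_seq [RHS]big_seq; apply: eq_bigr => e ep.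
rewrite linearZ_LR -[L _]/(to_poly (box g) (of_poly (box g) 'X_[e])).
rewrite (to_of_polyX _ A_invertible N0 Nadd).
under eq_bigr do rewrite linearZ_LR /= diag_actX scalerA mulrC -scalerA.
rewrite -scaler_suml (sum_diag_char G_subgroup G_neq0).
set b := (X in (if X then _ else _) *: _).
have -> : cone_pair_pred A N (mnm_vec A e, box g) = b.
  apply/idP/allP => [/cone_pairP[/dual_char eG _ _ _ _] h hG|eG].
    exact/eqP/eG.
  apply/cone_pairP; split=> [||//||j].
  - by apply/dual_char => h hG; apply/eqP/eG.
  - exact: mnm_vec_ge0.
  - by move=> j; have /andP[] := box_bound g j.
  rewrite pairing_mnm_vec //; have [jF|jF] := boolP (j \in box_zeros (box g)).
    by move: jF; rewrite inE => /eqP->; rewrite mulr0.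
  by rewrite (pF e) ?mul0r // -box_fixed.
by case: b; rewrite ?scale0r ?scaler0 // !scalerA mulrC.
Qed.

(** Representatives, as in the definition of the invariant part of the shifted
    Milnor ring, of invariant classes. *)
Definition nice g p := [/\ exists2 q, poly_in (fixed_vars (val g)) q &
    p = vars_prod C (fixed_vars (val g)) * q &
  forall h, h \in G -> class_of (sj g) (diag_act h p) = class_of (sj g) p].

(** An invariant class equals its average, so it has an invariant
    representative. *)
Lemma class_to_of g p : nice g p ->
  class_of (sj g) p = class_of (sj g) (to_poly (box g) (of_poly (box g) p)).
Proof.
move=> [[q qF pE] pG]; have G0 : #|` G|%:R != 0 :> C.
  rewrite pnatr_eq0 -lt0n cardfs_gt0; apply/fset0Pn; exists (val g); exact: fsvalP.
have pF : poly_in (fixed_vars (val g)) p by rewrite pE; apply: poly_in_vars_prod.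
apply: (scalerI G0); rewrite -[RHS]linearZ.
have <- := reynolds pF.
rewrite linear_sum big_seq (eq_bigr (fun=> class_of (sj g) p)) => [|h hG]; last exact: pG.
rewrite -big_seq big_const_seq count_predT iter_addr_0.
exact: scaler_nat.
Qed.

Definition milnor_submodule g := Submodule (milnor_inv_closed A G (val g)).

Lemma nice_repr g c : c \in submod_mem (milnor_submodule g) ->
  exists2 p, nice g p & c = class_of (sj g) p.
Proof.
move=> /asboolP[q [qF -> qG]]; exists (vars_prod C (fixed_vars (val g)) * q) => //.
by split=> //; exists q.
Qed.

Lemma nice_milnor g p : nice g p -> class_of (sj g) p \in submod_mem (milnor_submodule g).
Proof. by move=> [[q qF ->] pG]; apply/asboolP; exists q. Qed.

Definition box_tens g p (w : twist (val g)) : complex_B C A N :=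
  tens (of_poly (box g) p) (val w).

Lemma box_tens_l g a p q (w : twist (val g)) :
  box_tens (a *: p + q) w = a *: box_tens p w + box_tens q w :> complex_B C A N.
Proof.
by rewrite /box_tens of_polyP; exact: tensPl.
Qed.

Lemma box_tens_r g a p (w v : twist (val g)) :
  box_tens p (a *: w + v) = a *: box_tens p w + box_tens p v :> complex_B C A N.
Proof. exact: tensPr. Qed.

Lemma box_tensE g p (w : twist (val g)) : box_tens p w =
  of_family (single (~: box_zeros (box g))
    (of_poly (box g) (val w (~: fixed_vars (val g)) *: p))).
Proof.
rewrite /box_tens {1}twistE tensZr -tensZl -to_family_basis to_familyK box_fixed.
by rewrite of_polyZ.
Qed.

Lemma box_tens_gen g p : box_tens p (twist_gen (val g)) =
  of_family (single (~: box_zeros (box g)) (of_poly (box g) p)).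
Proof. by rewrite box_tensE /= ffunE eqxx scale1r. Qed.

Lemma box_tens_jacobian g p (w : twist (val g)) :
    (exists h j, [/\ poly_in (fixed_vars (val g)) h, j \in fixed_vars (val g)
      & p = vars_prod C (fixed_vars (val g)) *
            (h * (restricted_potential A (val g))^`M(j))]) ->
  exists y, box_tens p w = CB y.
Proof.
move=> [h [j [hF jF ->]]]; rewrite box_tensE restricted_potentialE; move: (val w _) => a.
rewrite -box_fixed in jF *.
have [x xE] := jacobian_coboundary A_invertible Nsub
  N_dual (box_bound g)
  (a *: h) jF.
by exists (of_family x); rewrite -of_family_diff -xE scalerAr scalerAl.
Qed.

Lemma nice_cocycle g p : nice g p -> CB (box_tens p (twist_gen (val g))) = 0.
Proof.
move=> [[q qF ->] _]; rewrite box_tens_gen -of_family_diff -box_fixed.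
rewrite (single_cocycle A_invertible Nsub
  N_dual (box_bound g)).
exact: of_family0.
Qed.

Lemma sum_box_tens (p : G -> poly) :
  \sum_g box_tens (p g) (twist_gen (val g)) =
  of_family (\sum_g single (~: box_zeros (box g)) (of_poly (box g) (p g)))
  :> complex_B C A N.
Proof.
rewrite of_family_sum; apply: eq_bigr => g _.
by rewrite box_tens_gen -to_family_basis to_familyK.
Qed.

(** If the cocycles attached to the [p g] add up to a coboundary, the invariant
    part of each [p g] lies in the shifted Jacobian ideal, and it represents the
    same class as [p g]. *)
Lemma nice_injective (p : G -> poly) (y : complex_B C A N) :
    (forall g, nice g (p g)) ->
    \sum_g box_tens (p g) (twist_gen (val g)) = CB y :> complex_B C A N ->
  forall g, class_of (sj g) (p g) = 0.
Proof.
move=> np; rewrite sum_box_tens => yE g.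
have /choice[q qE] : forall g, exists q, p g = vars_prod C (box_zeros (box g)) * q.
  by move=> h; have [[q _ qE] _] := np h; exists q; rewrite box_fixed.
have zE : \sum_g single (~: box_zeros (box g))
    (of_poly (box g) (vars_prod C (box_zeros (box g)) * q g)) = D (to_family y).
  rewrite -to_family_diff -yE of_familyK.
  by apply: eq_bigr => h _; rewrite qE.
have [c cF cE] := reduced_coboundary A_invertible N0
  Nadd Nsub N_dual
  box_inj box_bound zE g.
rewrite class_to_of // qE cE box_fixed -[RHS](linear0 (class_of (sj g))).
apply/class_eq; rewrite subr0; apply: jacobian_sum_mem => j.
by rewrite -box_fixed.
Qed.

Lemma box_tens_surjective (z : complex_B C A N) : CB z = 0 ->
  exists (p : G -> poly) (y : complex_B C A N),
    (forall g, class_of (sj g) (p g) \in submod_mem (milnor_submodule g)) /\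
    z = \sum_g box_tens (p g) (twist_gen (val g)) + CB y.
Proof.
move=> Cz; have Dz : D (to_family z) = 0 by rewrite -to_family_diff Cz to_family0.
have [q [w qE]] := cocycle_normal_form A_invertible W_smooth N0
  Nadd Nsub N_dual
  box_inj box_bound box_complete box_closed Dz.
pose p g := to_poly (box g) (of_poly (box g) (vars_prod C (box_zeros (box g)) * q g)).
exists p, (of_family w); split=> [g|].
  apply: nice_milnor; split=> [|h hG]; last by rewrite diag_act_to_of.
  have [p' p'F pE] := to_of_vars_prod A_invertible N0
    Nadd (box_bound g) (q g).
  by exists p'; rewrite -box_fixed.
rewrite sum_box_tens -of_family_diff -of_familyD -[LHS]to_familyK qE.
congr (of_family (_ + _)); apply: eq_bigr => g _; congr single.
rewrite (of_to_poly A_invertible N0 Nadd) //.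
exact: of_poly_supported.
Qed.

Lemma nice_box_monomial g (e : 'X_{1..d}) :
    dual_lattice A N (mnm_vec A e) ->
    (forall j, (0 < e j)%N = (j \in fixed_vars (val g))) ->
  nice g 'X_[e].
Proof.
move=> eM eF; pose s : 'X_{1..d} := [multinom (j \in fixed_vars (val g) : nat) | j < d].
have eE : 'X_[e] = vars_prod C (fixed_vars (val g)) * 'X_[e - s].
  rewrite vars_prodX -mpolyXD addmC submK //; apply/mnm_lepP => j.
  by rewrite [s j]mnmE -eF; case: (e j).
split=> [|h hG]; last by rewrite diag_actX (dual_char e).1 ?scale1r.
exists 'X_[e - s] => //; apply: poly_inX => j jF; rewrite mnmBE; have := eF j.
by rewrite (negPf jF); case: (e j).
Qed.

Theorem twisted_B_ring_cohomology :
  exists Phi : {linear twisted_B_ring A G -> cohomology CB}, bijective Phi /\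
    forall g m (e : 'X_{1..d}), dual_lattice A N m ->
      (forall j, pairing A m (basis_vec j) = (e j)%:R) ->
      (forall j, (0 < e j)%N = (j \in fixed_vars (val g))) ->
      exists2 l : milnor_inv A G (val g), val l = class_of (sj g) 'X_[e] &
        forall w : twist (val g),
          val (Phi (component_in (tens l w : twisted_component A g))) =
          class_of (coboundaries CB) (tens (monomial C A N m (box g)) (val w)).
Proof.
have [||Phi [Phi_bij PhiE]] := direct_sum_cohomology
  (om := fun g : G => twist_gen (val g)) (M := fun g : G => milnor_submodule g)
  (psi := @box_tens) box_tens_l box_tens_r (fun g => @twist_gen_span _ d (val g))
  box_tens_jacobian (nice := @nice) nice_repr nice_cocycle nice_injective
  box_tens_surjective
  (B := twisted_B_ring A G) (H := cohomology CB) (repr := val)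
  (incl := fun g (l : milnor_inv A G (val g)) (w : twist (val g)) =>
    component_in (tens l w : twisted_component A g)).
- exact: twisted_B_ring_dsum.
- reflexivity.
exists Phi; split; first exact: Phi_bij.
move=> g m e mM me eF.
have mE : m = mnm_vec A e.
  by apply: (pairing_inj A_invertible) => j; rewrite me pairing_mnm_vec.
have eP : class_of (sj g) 'X_[e] \in submod_mem (milnor_submodule g).
  by apply/nice_milnor/nice_box_monomial; rewrite -?mE.
exists (Subspace eP) => // w.
have -> : tens (monomial C A N m (box g)) (val w) = box_tens 'X_[e] w.
  by rewrite /box_tens of_polyX mE.
exact: PhiE.
Qed.

End Assembly.

Theorem proposition3p3p2 (R : realType) (d : nat) (A : 'M[nat]_d)
    (G : {fset {ffun 'I_d -> R[i]}})
    (A_invertible : map_mx (fun k : nat => k%:R : rat) A \in unitmx)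
    (A_weights : exists q : 'I_d -> rat,
       (forall j, 0 < q j) /\ (forall i, \sum_(j < d) (A i j)%:R * q j = 1))
    (W_nondegenerate : smooth_away_from_origin (potential R[i] A))
    (G_Aut : forall g, g \in G -> Aut_potential A g)
    (G_subgroup : diag_subgroup G) :
  (forall g : G, one_dimensional (twist (val g))) /\
  exists Phi : {linear twisted_B_ring A G -> cohomology (diff_B R[i] A (lattice_N G))},
    bijective Phi /\
    forall (g : G) (m n : 'rV[rat]_d) (e : 'X_{1..d}),
      box_point (val g) n ->
      dual_lattice A (lattice_N G) m ->
      (forall j, pairing A m (basis_vec j) = (e j)%:R) ->
      (forall j, (0 < e j)%N = (j \in fixed_vars (val g))) ->
      exists2 l : milnor_inv A G (val g),
        val l = class_of (shifted_jacobian A (val g)) 'X_[e] &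
        forall w : twist (val g),
          val (Phi (component_in (tens l w : twisted_component A g))) =
          class_of (coboundaries (diff_B R[i] A (lattice_N G)))
            (tens (monomial R[i] A (lattice_N G) m n) (val w)).
Proof.
split=> [g|]; first exact: twist_one_dimensional.
have /choice[box boxP] : forall g : G, exists n, box_point (val g) n.
  by move=> g; apply: (box_point_exists G_Aut G_subgroup (fsvalP g)).
have box_val g : expi_point R (box g) = val g by apply: box_point_expi.
have [Phi [Phi_bij PhiE]] : exists Phi : {linear twisted_B_ring A G ->
    cohomology (diff_B R[i] A (lattice_N G))}, bijective Phi /\
    forall (g : G) m (e : 'X_{1..d}), dual_lattice A (lattice_N G) m ->
      (forall j, pairing A m (basis_vec j) = (e j)%:R) ->
      (forall j, (0 < e j)%N = (j \in fixed_vars (val g))) ->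
      exists2 l : milnor_inv A G (val g),
        val l = class_of (shifted_jacobian A (val g)) 'X_[e] &
        forall w : twist (val g),
          val (Phi (component_in (tens l w : twisted_component A g))) =
          class_of (coboundaries (diff_B R[i] A (lattice_N G)))
            (tens (monomial R[i] A (lattice_N G) m (box g)) (val w)).
  apply: twisted_B_ring_cohomology => //.
  - exact: (G_neq0 G_Aut).
  - exact: (lattice_N0 G_subgroup).
  - exact: lattice_Nadd.
  - exact: lattice_Nsub.
  - exact: (lattice_N_dual A_invertible G_Aut).
  - exact: (dual_lattice_mnm_vec A_invertible G_Aut G_subgroup).
  - by move=> g h gh; apply: val_inj; rewrite -!box_val gh.
  - by move=> g; rewrite /lattice_N -/(expi_point R (box g)) box_val fsvalP.
  - by move=> g j; case: (boxP g j).
  - move=> n nN n01; exists [` nN]%fset; apply: box_point_uniq (boxP _) => j.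
    by split=> //=; rewrite ffunE.
  - by move=> g; apply/box_point_zeros/boxP.
  move=> g i k ik; rewrite (box_point_zeros (boxP g)).
  exact: (fixed_vars_closed A_invertible G_Aut (fsvalP g)).
exists Phi; split=> // g m n e nb; rewrite (box_point_uniq nb (boxP g)).
exact: PhiE.
Qed.
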